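(* $\mathsf{eL}\exists\forall\mathsf{DT}$ is polynomially simulated by $\mathsf{eLNDT}$ over NDT sequents: there is a polynomial-time procedure transforming any $\mathsf{eL}\exists\forall\mathsf{DT}$ proof of a sequent $\Sigma\to\Pi$ of NDT formulas into an $\mathsf{eLNDT}$ proof of $\Sigma\to\Pi$ (over some set of eNDT extension axioms).
   Context: Propositional variables $p,q,\dots$; $ApB$ is a decision ''if $p$ then $B$ else $A$''; $p$ is identified with $0p1$. NDT formulas: $A::=0\mid1\mid ApB\mid A\lor B$. eNDT formulas additionally allow extension variables $e_0,e_1,\dots$; a set of eNDT extension axioms is $\{e_i\leftrightarrow E_i\}_{i<n}$ with $E_i$ eNDT mentioning only $e_0,\dots,e_{i-1}$. co-eNDT formulas: $U,V::=0\mid1\mid UpV\mid U\land V\mid u_i$ with fresh extension variables $u_0,u_1,\dots$; a set of co-eNDT extension axioms is $\{u_i\leftrightarrow U_i\}_{i<n}$ with $U_i$ mentioning only $u_0,\dots,u_{i-1}$. e$\exists\forall$DT formulas: $X,Y::=0\mid1\mid U\mid XpY\mid X\lor Y\mid x_i$ with $U$ co-eNDT and fresh extension variables $x_0,x_1,\dots$; a set of e$\exists\forall$DT extension axioms is $\{x_i\leftrightarrow X_i\}_{i<n}$ with $X_i$ mentioning only $x_0,\dots,x_{i-1}$ among the $x$'s. Rules of $\mathsf{LNDT}$: identity $A\to A$; cut; exchange, weakening, contraction on both sides; axiom $0\to$; from $\Gamma\to\Delta$ infer $\Gamma,1\to\Delta$ and $\Gamma\to\Delta,0$; axiom $\to1$;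 $\lor$-left (from $\Gamma,A\to\Delta$ and $\Gamma,B\to\Delta$ infer $\Gamma,A\lor B\to\Delta$); $\lor$-right (from $\Gamma\to\Delta,A,B$ infer $\Gamma\to\Delta,A\lor B$); $p$-left (from $\Gamma,A\to\Delta,p$ and $\Gamma,p,B\to\Delta$ infer $\Gamma,ApB\to\Delta$); $p$-right (from $\Gamma\to\Delta,A,p$ and $\Gamma,p\to\Delta,B$ infer $\Gamma\to\Delta,ApB$). An $\mathsf{eLNDT}$ proof over a set of eNDT extension axioms is a finite list of sequents of eNDT formulas, each a hypothesis $e_i\to E_i$ or $E_i\to e_i$ or derived from earlier ones by an $\mathsf{LNDT}$ rule. $\mathsf{eL}\exists\forall\mathsf{DT}$ is defined the same way over e$\exists\forall$DT formulas, with the $\mathsf{LNDT}$ rules plus $\land$-left (from $\Gamma,P,Q\to\Delta$ infer $\Gamma,P\land Q\to\Delta$) and $\land$-right (from $\Gamma\to\Delta,P$ and $\Gamma\to\Delta,Q$ infer $\Gamma\to\Delta,P\land Q$), and with hypotheses from a set of co-eNDT extension axioms and a set of e$\exists\forall$DT extension axioms (both directions of each axiom). *)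

(* Defs.v *)
From HB Require Import structures.
From Corelib Require Import PosDef.
From mathcomp Require Import all_boot.

Set Implicit Arguments.
Unset Strict Implicit.
Unset Printing Implicit Defensive.

(** * Formulas *)

(* All formula classes are carved out of one raw syntax, so that a formula
   belonging to several of them (e.g. an NDT formula, or a decision [U p V]
   between co-eNDT formulas) is literally the same object in each.
   [Dec A p B] is the decision [A p B]: if [p] then [B] else [A]. *)
Inductive form : Type :=
| Zero
| One
| Dec of form & nat & form
| Or of form & form
| And of form & form
| Evar of nat
| Uvar of nat
| Xvar of nat.

Definition form_eq_dec : comparable form.
Proof. by move=> A B; rewrite /decidable; do 2 decide equality. Defined.

HB.instance Definition _ := hasDecEq.Build form (compareP form_eq_dec).

Definition pvar (p : nat) : form := Dec Zero p One.

Fixpoint is_NDT (A : form) : bool :=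
  match A with
  | Zero | One => true
  | Dec B _ C | Or B C => is_NDT B && is_NDT C
  | _ => false
  end.

Fixpoint is_eNDT (A : form) : bool :=
  match A with
  | Zero | One | Evar _ => true
  | Dec B _ C | Or B C => is_eNDT B && is_eNDT C
  | _ => false
  end.

Fixpoint is_coeNDT (A : form) : bool :=
  match A with
  | Zero | One | Uvar _ => true
  | Dec B _ C | And B C => is_coeNDT B && is_coeNDT C
  | _ => false
  end.

Fixpoint is_eEADT (A : form) : bool :=
  is_coeNDT A ||
  match A with
  | Zero | One | Xvar _ => true
  | Dec B _ C | Or B C => is_eEADT B && is_eEADT C
  | _ => false
  end.

Fixpoint evars (A : form) : seq nat :=
  match A with
  | Evar i => [:: i]
  | Dec B _ C | Or B C | And B C => evars B ++ evars C
  | _ => [::]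
  end.

Fixpoint uvars (A : form) : seq nat :=
  match A with
  | Uvar i => [:: i]
  | Dec B _ C | Or B C | And B C => uvars B ++ uvars C
  | _ => [::]
  end.

Fixpoint xvars (A : form) : seq nat :=
  match A with
  | Xvar i => [:: i]
  | Dec B _ C | Or B C | And B C => xvars B ++ xvars C
  | _ => [::]
  end.

(** * Extension axioms *)

(* A set of extension axioms [{v_i <-> A_i}_(i < n)] is given by the sequence
   [A_0, ..., A_(n-1)] of its right-hand sides. *)
Definition extension_axioms (K : pred form) (vars : form -> seq nat)
    (axs : seq form) : Prop :=
  forall i, i < size axs ->
    K (nth Zero axs i) /\ all (fun j => j < i) (vars (nth Zero axs i)).

Definition eNDT_axioms := extension_axioms is_eNDT evars.
Definition coeNDT_axioms := extension_axioms is_coeNDT uvars.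
Definition eEADT_axioms := extension_axioms is_eEADT xvars.

(** * Sequents and rules *)

Definition sequent : Type := (seq form * seq form)%type.

Definition sequent_over (K : pred form) (S : sequent) : bool :=
  all K S.1 && all K S.2.

Definition extension_hyp (v : nat -> form) (axs : seq form) (S : sequent) :
    Prop :=
  exists2 i, i < size axs &
    S = ([:: v i], [:: nth Zero axs i]) \/ S = ([:: nth Zero axs i], [:: v i]).

(* [R premises conclusion]. *)
Definition rules : Type := seq sequent -> sequent -> Prop.

Inductive LNDT_rule : rules :=
| r_id A : LNDT_rule [::] ([:: A], [:: A])
| r_cut G D A :
    LNDT_rule [:: (G, rcons D A); (rcons G A, D)] (G, D)
| r_exchl G1 G2 D A B :
    LNDT_rule [:: (G1 ++ A :: B :: G2, D)] (G1 ++ B :: A :: G2, D)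
| r_exchr G D1 D2 A B :
    LNDT_rule [:: (G, D1 ++ A :: B :: D2)] (G, D1 ++ B :: A :: D2)
| r_weakl G D A : LNDT_rule [:: (G, D)] (rcons G A, D)
| r_weakr G D A : LNDT_rule [:: (G, D)] (G, rcons D A)
| r_contrl G D A : LNDT_rule [:: (rcons (rcons G A) A, D)] (rcons G A, D)
| r_contrr G D A : LNDT_rule [:: (G, rcons (rcons D A) A)] (G, rcons D A)
| r_zerol : LNDT_rule [::] ([:: Zero], [::])
| r_zeror G D : LNDT_rule [:: (G, D)] (G, rcons D Zero)
| r_onel G D : LNDT_rule [:: (G, D)] (rcons G One, D)
| r_oner : LNDT_rule [::] ([::], [:: One])
| r_orl G D A B :
    LNDT_rule [:: (rcons G A, D); (rcons G B, D)] (rcons G (Or A B), D)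
| r_orr G D A B :
    LNDT_rule [:: (G, rcons (rcons D A) B)] (G, rcons D (Or A B))
| r_decl G D A p B :
    LNDT_rule [:: (rcons G A, rcons D (pvar p)); (rcons (rcons G (pvar p)) B, D)]
              (rcons G (Dec A p B), D)
| r_decr G D A p B :
    LNDT_rule [:: (G, rcons (rcons D A) (pvar p)); (rcons G (pvar p), rcons D B)]
              (G, rcons D (Dec A p B)).

Inductive LEADT_rule : rules :=
| r_LNDT ps S : LNDT_rule ps S -> LEADT_rule ps S
| r_andl G D P Q :
    LEADT_rule [:: (rcons (rcons G P) Q, D)] (rcons G (And P Q), D)
| r_andr G D P Q :
    LEADT_rule [:: (G, rcons D P); (G, rcons D Q)] (G, rcons D (And P Q)).

(* [derivation K hyp R l]: [l] is a list of sequents of [K]-formulas, each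
   satisfying [hyp] or following by [R] from sequents strictly before it. *)
Definition derivation (K : pred form) (hyp : sequent -> Prop) (R : rules)
    (l : seq sequent) : Prop :=
  forall l1 S l2, l = l1 ++ S :: l2 ->
    sequent_over K S /\
    (hyp S \/ exists2 ps, {subset ps <= l1} & R ps S).

Definition ends_with (l : seq sequent) (S : sequent) : Prop :=
  exists l', l = rcons l' S.

(** * Proofs: a list of sequents together with the extension axioms *)

Record eLNDT_pf := ELNDTPf { e_axs : seq form; e_lines : seq sequent }.

Definition eLNDT_proves (pi : eLNDT_pf) (S : sequent) : Prop :=
  [/\ eNDT_axioms (e_axs pi),
      derivation is_eNDT (extension_hyp Evar (e_axs pi)) LNDT_rule (e_lines pi)
    & ends_with (e_lines pi) S].

Record eLEADT_pf := ELEADTPf {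
  u_axs : seq form;
  x_axs : seq form;
  ea_lines : seq sequent }.

Definition eLEADT_proves (pi : eLEADT_pf) (S : sequent) : Prop :=
  [/\ coeNDT_axioms (u_axs pi),
      eEADT_axioms (x_axs pi),
      derivation is_eEADT
        (fun T => extension_hyp Uvar (u_axs pi) T
                  \/ extension_hyp Xvar (x_axs pi) T)
        LEADT_rule (ea_lines pi)
    & ends_with (ea_lines pi) S].

(** * Polynomial time *)

(* The machine model is the WHILE language over binary trees of N. D. Jones
   (Computability and Complexity from a Programming Perspective, MIT Press
   1997). Every evaluation of a (sub)expression is charged the full size of
   its value, as if values were copied and never shared. Hence a run of cost
   [t] only produces trees of size at most [t], and each step can be carried
   out on a Turing machine in time polynomial in [t] and the size of the
   input; conversely tapes are lists, so that a Turing machine step costs at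
   most linearly in the tape contents. Polynomial time in this model is thus
   polynomial time on Turing machines. *)

Inductive data : Type := Leaf | Node of data & data.

Definition data_eq_dec : comparable data.
Proof. by move=> a b; rewrite /decidable; decide equality. Defined.

HB.instance Definition _ := hasDecEq.Build data (compareP data_eq_dec).

Fixpoint dsize (d : data) : nat :=
  if d is Node a b then (dsize a + dsize b).+1 else 1.

Inductive expr : Type :=
| EVar of nat
| ENil
| ECons of expr & expr
| EHd of expr
| ETl of expr
| EEq of expr & expr.

Inductive cmd : Type :=
| CSkip
| CAssign of nat & expr
| CSeq of cmd & cmd
| CIf of expr & cmd & cmd
| CWhile of expr & cmd.

Definition store : Type := nat -> data.

Definition update (s : store) (x : nat) (d : data) : store :=
  fun y => if y == x then d else s y.

Fixpoint eval (s : store) (e : expr) : data :=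
  match e with
  | EVar x => s x
  | ENil => Leaf
  | ECons e1 e2 => Node (eval s e1) (eval s e2)
  | EHd e1 => if eval s e1 is Node a _ then a else Leaf
  | ETl e1 => if eval s e1 is Node _ b then b else Leaf
  | EEq e1 e2 => if eval s e1 == eval s e2 then Node Leaf Leaf else Leaf
  end.

Fixpoint ecost (s : store) (e : expr) : nat :=
  dsize (eval s e) +
  match e with
  | EVar _ | ENil => 0
  | EHd e1 | ETl e1 => ecost s e1
  | ECons e1 e2 | EEq e1 e2 => ecost s e1 + ecost s e2
  end.

(* [exec c s t s']: started in store [s], the command [c] halts in store [s']
   at cost [t]. Conditions hold when their value is not [Leaf]. *)
Inductive exec : cmd -> store -> nat -> store -> Prop :=
| x_skip s : exec CSkip s 1 s
| x_assign x e s : exec (CAssign x e) s (ecost s e).+1 (update s x (eval s e))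
| x_seq c1 c2 s1 s2 s3 t1 t2 :
    exec c1 s1 t1 s2 -> exec c2 s2 t2 s3 ->
    exec (CSeq c1 c2) s1 (t1 + t2).+1 s3
| x_if_true e c1 c2 s s' t :
    eval s e <> Leaf -> exec c1 s t s' ->
    exec (CIf e c1 c2) s (ecost s e + t).+1 s'
| x_if_false e c1 c2 s s' t :
    eval s e = Leaf -> exec c2 s t s' ->
    exec (CIf e c1 c2) s (ecost s e + t).+1 s'
| x_while_true e c s1 s2 s3 t1 t2 :
    eval s1 e <> Leaf -> exec c s1 t1 s2 -> exec (CWhile e c) s2 t2 s3 ->
    exec (CWhile e c) s1 (ecost s1 e + t1 + t2).+1 s3
| x_while_false e c s :
    eval s e = Leaf -> exec (CWhile e c) s (ecost s e).+1 s.

(* Input and output are passed in variable 0. *)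
Definition init_store (d : data) : store := update (fun=> Leaf) 0 d.

Definition polytime (A B : Type) (encA : A -> data) (encB : B -> data)
    (f : A -> B) : Prop :=
  exists (c : cmd) (k : nat), forall a : A, exists t s',
    [/\ exec c (init_store (encA a)) t s',
        s' 0 = encB (f a)
      & t <= k * dsize (encA a) ^ k + k].

(** * Encoding of proofs as trees *)

Definition enc_seq (A : Type) (enc : A -> data) (l : seq A) : data :=
  foldr (fun a d => Node (enc a) d) Leaf l.

Definition enc_bool (b : bool) : data := if b then Node Leaf Leaf else Leaf.

(* Indices of variables are written in binary, least significant bit first. *)
Fixpoint bits_pos (p : positive) : seq bool :=
  match p with
  | xH => [:: true]
  | xO q => false :: bits_pos q
  | xI q => true :: bits_pos q
  end.

Definition bits_nat (n : nat) : seq bool :=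
  if bin_of_nat n is Npos p then bits_pos p else [::].

Definition enc_nat (n : nat) : data := enc_seq enc_bool (bits_nat n).

Definition tag (k : nat) : data := iter k (Node Leaf) Leaf.

Fixpoint enc_form (A : form) : data :=
  match A with
  | Zero => enc_seq id [:: tag 0]
  | One => enc_seq id [:: tag 1]
  | Dec B p C => enc_seq id [:: tag 2; enc_form B; enc_nat p; enc_form C]
  | Or B C => enc_seq id [:: tag 3; enc_form B; enc_form C]
  | And B C => enc_seq id [:: tag 4; enc_form B; enc_form C]
  | Evar i => enc_seq id [:: tag 5; enc_nat i]
  | Uvar i => enc_seq id [:: tag 6; enc_nat i]
  | Xvar i => enc_seq id [:: tag 7; enc_nat i]
  end.

Definition enc_sequent (S : sequent) : data :=
  Node (enc_seq enc_form S.1) (enc_seq enc_form S.2).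

Definition enc_eLNDT_pf (pi : eLNDT_pf) : data :=
  Node (enc_seq enc_form (e_axs pi)) (enc_seq enc_sequent (e_lines pi)).

Definition enc_eLEADT_pf (pi : eLEADT_pf) : data :=
  Node (enc_seq enc_form (u_axs pi))
    (Node (enc_seq enc_form (x_axs pi)) (enc_seq enc_sequent (ea_lines pi))).

(* Main.v *)
Require Import Defs.
From HB Require Import structures.
From Corelib Require Import PosDef.
From mathcomp Require Import all_boot zify.

Set Implicit Arguments.
Unset Strict Implicit.
Unset Printing Implicit Defensive.

(** Formulas are translated homomorphically, except that a conjunction or a variable
    [u_i] becomes an eNDT extension variable for the complement of its De Morgan dual,
    which is a nondeterministic branching program. NDT formulas are thus unchanged, the
    LNDT rules translate to themselves, and only the conjunction rules and the axioms
    [u_i <-> U_i] require an argument.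

    Complements are obtained by inductive counting (Immerman and Szelepcsenyi) along a
    topological order of the nodes of the branching program, rather than along distances:
    given the number of accepting nodes among the first [k], the node [k] is rejecting if
    and only if that many accepting nodes can be guessed while avoiding its successors.
    The sequents that express the correctness of the counting program have bounded width
    and are derived from one another by induction on [k].

    The translation does not construct derivations explicitly. It saturates, under the
    rules of LNDT, a polynomial set of candidate sequents: those of bounded width, placed
    next to prefixes of the translated lines. It then suffices that every line has some
    derivation within the candidates. *)

(** * Functions computable in polynomial time *)

(** The calculus has no negation, so complementarity of two formulas is expressed by a pair of
    sequents: they exclude each other, and one of them holds. It has no conjunction of eNDT formulas
    either; adding the condition that a node is refuted to a guess is done by composing programs,
    the guess being substituted for the accepting leaves of the dual of the node. The number of
    refuted nodes depends on the assignment, so a program is built for each possible count and their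
    disjunction is taken, which requires a derivation of the fact that some count is correct.
    Numbers are encoded by suffixes of the list of nodes: predecessor is tail, and all names of
    extension variables can be enumerated by list functions. Saturation separates the two halves of
    the argument: for the running time, only the enumeration of candidates and of rule instances has
    to be polynomial, while derivations are merely shown to exist, by propositional entailment
    between a bounded number of formulas. *)

Definition poly (p : nat -> nat) : Prop := exists k, forall n, p n <= n.+2 ^ k.

Lemma poly_le (p q : nat -> nat) : (forall n, p n <= q n) -> poly q -> poly p.
Proof. by move=> le_pq [k qk]; exists k => n; apply: leq_trans (qk n). Qed.

Lemma poly_const c : poly (fun=> c).
Proof.
exists c => n; apply: leq_trans (_ : 2 ^ c <= _); first exact/ltnW/ltn_expl.
by case: c => // c; rewrite leq_exp2r.
Qed.

Lemma poly_id : poly id.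
Proof. by exists 1 => n; lia. Qed.

Lemma polyM p q : poly p -> poly q -> poly (fun n => p n * q n).
Proof.
move=> [j pj] [k qk]; exists (j + k) => n.
by rewrite expnD; apply: leq_mul.
Qed.

(** The base [n.+2] is at least 2, so one more factor absorbs the sum of two powers. *)
Lemma polyD p q : poly p -> poly q -> poly (fun n => p n + q n).
Proof.
move=> [j pj] [k qk]; exists (j + k).+1 => n.
rewrite expnS expnD.
have := pj n; have := qk n.
have: 0 < n.+2 ^ j by rewrite expn_gt0.
have: 0 < n.+2 ^ k by rewrite expn_gt0.
move: (n.+2 ^ j) (n.+2 ^ k) (p n) (q n) => a b c d.
nia.
Qed.

Lemma poly_pow k p : poly p -> poly (fun n => (p n).+2 ^ k).
Proof.
move=> [j pj]; exists ((j + 2) * k) => n.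
rewrite expnM; case: k => [|k]; first by rewrite !expn0.
rewrite leq_exp2r // expnD; have := pj n.
have: 0 < n.+2 ^ j by rewrite expn_gt0.
rewrite expnS expn1; move: (n.+2 ^ j) (p n) => a b; nia.
Qed.

Lemma polyS p : poly p -> poly (fun n => (p n).+1).
Proof.
move=> pp; apply: (poly_le _ (polyD pp (poly_const 1))) => n.
by rewrite addn1.
Qed.

Ltac poly_tac :=
  repeat first [assumption|exact: poly_const|exact: poly_id|apply: polyS|apply: polyD
               |apply: polyM|apply: poly_pow].

(** * Codes of data types and the class of polynomial-time functions *)

Class codable (T : Type) := Codable {
  code : T -> data;
  code_inj : injective code }.

Lemma enc_seq_inj (T : Type) (e : T -> data) : injective e -> injective (enc_seq e).
Proof.
move=> ei; elim=> [|x s IHs] [|y t] //= [] /ei -> /IHs -> //.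
Qed.

Lemma enc_bool_inj : injective enc_bool.
Proof. by do 2!case. Qed.

Lemma bits_pos_inj : injective bits_pos.
Proof.
by elim=> [p IHp|p IHp|] [q|q|] //= [] //; try move/IHp->; first [by case: p {IHp}| by case: q].
Qed.

Lemma bits_nat_inj : injective bits_nat.
Proof.
move=> m n; rewrite /bits_nat => e.
apply: (can_inj bin_of_natK); move: e.
case: (bin_of_nat m) (bin_of_nat n) => [|p] [|q] //.
- by case: q.
- by case: p.
by move/bits_pos_inj->.
Qed.

Lemma enc_nat_inj : injective enc_nat.
Proof. by move=> m n /(enc_seq_inj enc_bool_inj)/bits_nat_inj. Qed.

Lemma enc_form_inj : injective enc_form.
Proof.
by elim=> [||A IHA p B IHB|A IHA B IHB|A IHA B IHB|i|i|i] [||A' p' B'|A' B'|A' B'|i'|i'|i'] //=;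
  first [by case=> /IHA-> /enc_nat_inj-> /IHB->|by case=> /IHA-> /IHB->
        |by case=> /enc_nat_inj->].
Qed.

Definition enc_pair (A B : Type) (eA : A -> data) (eB : B -> data) (x : A * B) :=
  Node (eA x.1) (eB x.2).

Lemma enc_pair_inj (A B : Type) (eA : A -> data) (eB : B -> data) :
  injective eA -> injective eB -> injective (enc_pair eA eB).
Proof. by move=> iA iB [a b] [a' b'] [] /iA-> /iB->. Qed.

#[global] Instance codable_bool : codable bool := Codable enc_bool_inj.
#[global] Instance codable_nat : codable nat := Codable enc_nat_inj.
#[global] Instance codable_form : codable form := Codable enc_form_inj.
#[global] Instance codable_pair A B {cA : codable A} {cB : codable B} :
  codable (A * B) := Codable (enc_pair_inj (@code_inj A cA) (@code_inj B cB)).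
#[global] Instance codable_seq A {cA : codable A} : codable (seq A) :=
  Codable (enc_seq_inj (@code_inj A cA)).
#[global] Instance codable_sig A (t : A -> bool) {cA : codable A} :
  codable {a | t a} := Codable (inj_comp (@code_inj A cA) val_inj).

(** The command must work in every store with the input in variable 0, whatever the other variables
    contain, and it preserves the variables from [b] on. This makes commands composable, with those
    variables as safe storage. *)
Definition PT (A B : Type) {cA : codable A} {cB : codable B} (f : A -> B) : Prop :=
  exists c b k, forall a s, s 0 = code a ->
    exists t s', [/\ exec c s t s', s' 0 = code (f a),
      t <= (dsize (code a)).+2 ^ k & forall y, b <= y -> s' y = s y].

(** Every assigned value is charged its size, so the running time also bounds the size of the
    output. *)
Lemma exec_size c s t s' : exec c s t s' -> forall x, dsize (s' x) <= dsize (s x) + t.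
Proof.
have ec s0 e : dsize (eval s0 e) <= ecost s0 e by case: e => *; apply: leq_addr.
elim=> {c s t s'}; try by move=> *; lia.
- by move=> x e s y; rewrite /update; case: eqP => _; have := ec s e; lia.
- by move=> c1 c2 s1 s2 s3 t1 t2 _ IH1 _ IH2 x; have := IH1 x; have := IH2 x; lia.
- by move=> e c1 c2 s s' t _ _ IH x; have := IH x; lia.
- by move=> e c1 c2 s s' t _ _ IH x; have := IH x; lia.
by move=> e c s1 s2 s3 t1 t2 _ _ IH1 _ IH2 x; have := IH1 x; have := IH2 x; lia.
Qed.

Section Basics.
Context {A B C : Type} {cA : codable A} {cB : codable B} {cC : codable C}.

Lemma PT_size (f : A -> B) : PT f ->
  exists2 p, poly p & forall a, dsize (code (f a)) <= p (dsize (code a)).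
Proof.
move=> [c [b [k H]]]; exists (fun n => n + n.+2 ^ k); first by poly_tac.
move=> a; have [t [s' [ex <- le_t _]]] := H a (init_store (code a)) erefl.
by apply: leq_trans (exec_size ex 0) _; rewrite leq_add2l.
Qed.

Lemma PT_intro (f : A -> B) c b p : poly p ->
  (forall a s, s 0 = code a ->
    exists t s', [/\ exec c s t s', s' 0 = code (f a),
      t <= p (dsize (code a)) & forall y, b <= y -> s' y = s y]) -> PT f.
Proof.
move=> [k pk] H; exists c, b, k => a s /H [t [s' [e1 e2 e3 e4]]].
by exists t, s'; split=> //; apply: leq_trans (pk _).
Qed.

Lemma eq_PT (f g : A -> B) : f =1 g -> PT f -> PT g.
Proof.
move=> fg [c [b [k H]]]; exists c, b, k => a s /H [t [s' [e1 e2 e3 e4]]].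
by exists t, s'; split=> //; rewrite -fg.
Qed.

Lemma PT_recode (f : A -> B) (g : A -> C) :
  (forall a, code (f a) = code (g a)) -> PT f -> PT g.
Proof.
move=> fg [c [b [k H]]]; exists c, b, k => a s /H [t [s' [e1 e2 e3 e4]]].
by exists t, s'; split=> //; rewrite -fg.
Qed.

End Basics.

(** * Expressions, composition, branching and loops *)

Fixpoint only0 (e : expr) : bool :=
  match e with
  | EVar x => x == 0
  | ENil => true
  | ECons e1 e2 | EEq e1 e2 => only0 e1 && only0 e2
  | EHd e1 | ETl e1 => only0 e1
  end.

Lemma dsize_gt0 d : 0 < dsize d.
Proof. by case: d. Qed.

Lemma ecost_poly e : only0 e ->
  exists2 p, poly p & forall s, ecost s e <= p (dsize (s 0)).
Proof.
have ec s0 e0 : dsize (eval s0 e0) <= ecost s0 e0 by case: e0 => *; apply: leq_addr.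
elim: e => [x /eqP->||e1 IH1 e2 IH2 /andP[/IH1[p1 P1 H1] /IH2[p2 P2 H2]]
           |e1 IH1 /IH1[p1 P1 H1]|e1 IH1 /IH1[p1 P1 H1]
           |e1 IH1 e2 IH2 /andP[/IH1[p1 P1 H1] /IH2[p2 P2 H2]]] /=.
- by exists id; poly_tac => s; rewrite addn0.
- by exists (fun=> 1); poly_tac.
- exists (fun n => (2 * (p1 n + p2 n)).+1); first by poly_tac.
  by move=> s /=; have := H1 s; have := H2 s; have := ec s e1; have := ec s e2; lia.
- exists (fun n => 2 * p1 n); first by poly_tac.
  move=> s; have := H1 s; have := ec s e1.
  by case: (eval s e1) => [|a b] /=; lia.
- exists (fun n => 2 * p1 n); first by poly_tac.
  move=> s; have := H1 s; have := ec s e1.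
  by case: (eval s e1) => [|a b] /=; lia.
exists (fun n => 3 + (p1 n + p2 n)); first by poly_tac.
move=> s; have := H1 s; have := H2 s.
by case: eqP => _ /=; lia.
Qed.

Lemma update_in0 s b d e : 0 < b -> s 0 = d -> update s b e 0 = d.
Proof. by rewrite /update; case: b. Qed.

Section Combinators.
Context {A B C : Type} {cA : codable A} {cB : codable B} {cC : codable C}.

Lemma PT_comp (f : A -> B) (g : B -> C) : PT f -> PT g -> PT (fun a => g (f a)).
Proof.
move=> ptf; have [q qp fq] := PT_size ptf; move: ptf.
move=> [c1 [b1 [k1 H1]]] [c2 [b2 [k2 H2]]].
apply: (@PT_intro _ _ _ _ _ (CSeq c1 c2) (maxn b1 b2)
  (fun n => (n.+2 ^ k1 + (q n).+2 ^ k2).+1)); first by poly_tac.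
move=> a s /H1 [t1 [s1 [ex1 s10 le1 fr1]]].
have [t2 [s2 [ex2 s20 le2 fr2]]] := H2 _ _ s10.
exists (t1 + t2).+1, s2; split=> //; first exact: x_seq ex1 ex2.
  rewrite ltnS leq_add //; apply: leq_trans le2 _.
  by case: k2 {H2} => // k2; rewrite leq_exp2r // !ltnS.
by move=> y; rewrite geq_max => /andP[y1 y2]; rewrite fr2 // fr1.
Qed.

Lemma PT_expr e (f : A -> B) : only0 e ->
  (forall s a, s 0 = code a -> eval s e = code (f a)) -> PT f.
Proof.
move=> /ecost_poly[p Pp Hp] ef.
apply: (@PT_intro _ _ _ _ _ (CAssign 0 e) 1 (fun n => (p n).+1)); first by poly_tac.
move=> a s s0; exists (ecost s e).+1, (update s 0 (eval s e)); split=> //.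
- exact: x_assign.
- by rewrite /update /= (ef s a).
- by rewrite ltnS -s0.
by case.
Qed.

(** The expression [e] merely rearranges the input into the code of an argument of [g]. That
    argument need only exist for each [a], so it can be supplied by a case distinction on an element
    of a subtype. *)
Lemma PT_via e (g : B -> C) (f : A -> C) : only0 e -> PT g ->
  (forall a, exists2 b, (forall s, s 0 = code a -> eval s e = code b) & f a = g b) ->
  PT f.
Proof.
move=> /ecost_poly[p Pp Hp] [c [b [k H]]] fg.
apply: (@PT_intro _ _ _ _ _ (CSeq (CAssign 0 e) c) b.+1
  (fun n => ((p n).+1 + (p n).+2 ^ k).+1)); first by poly_tac.
move=> a s s0; have [a' ea ->] := fg a.
have [|t [s' [ex s'0 le_t fr]]] := H a' (update s 0 (eval s e)); first exact: ea.
exists ((ecost s e).+1 + t).+1, s'; split=> //.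
- by apply: x_seq ex; apply: x_assign.
- have le_e : ecost s e <= p (dsize (code a)) by rewrite -s0.
  rewrite ltnS leq_add // (leq_trans le_t) // -(ea s s0).
  have : dsize (eval s e) <= ecost s e by case: (e) => *; apply: leq_addr.
  move=> /leq_trans/(_ le_e) le_p.
  by case: (k) => // k'; rewrite leq_exp2r // !ltnS.
by case=> // y yb; rewrite fr //; apply: ltnW.
Qed.

Lemma PT_pair (f : A -> B) (g : A -> C) : PT f -> PT g -> PT (fun a => (f a, g a)).
Proof.
move=> ptf ptg; have [p1 pp1 sz1] := PT_size ptf; have [p2 pp2 sz2] := PT_size ptg.
case: ptf ptg => [c1 [b1 [k1 H1]]] [c2 [b2 [k2 H2]]].
(* The variables [b] and [b.+1] lie above the scratch space of both commands; they keep the input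
   and the value of [f]. *)
have [b hb1 [hb2 b_gt0]] : exists2 b, b1 <= b & b2 <= b /\ 0 < b by exists (b1 + b2).+1; lia.
apply: (@PT_intro _ _ _ _ _
  (CSeq (CAssign b (EVar 0)) (CSeq c1 (CSeq (CAssign b.+1 (EVar 0))
   (CSeq (CAssign 0 (EVar b)) (CSeq c2 (CAssign 0 (ECons (EVar b.+1) (EVar 0))))))))
  b.+2 (fun n => n.+2 ^ k1 + n.+2 ^ k2 + 4 * (n + p1 n + p2 n) + 100)).
  by poly_tac.
move=> a s s0.
set s1 := update s b (s 0).
have [t2 [s2 [ex2 s20 le2 fr2]]] := H1 a s1 (update_in0 _ b_gt0 s0).
set s3 := update s2 b.+1 (s2 0).
have s3b : s3 b = code a.
  by rewrite /s3 /update ltn_eqF // fr2 ?/s1 /update ?eqxx //; lia.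
set s4 := update s3 0 (s3 b).
have [t5 [s5 [ex5 s50 le5 fr5]]] := H2 a s4 s3b.
have s5b : s5 b.+1 = code (f a).
  rewrite fr5; last by lia.
  by rewrite /s4 /s3 /update /= eqxx.
eexists; exists (update s5 0 (Node (s5 b.+1) (s5 0))); split.
- apply: x_seq; first exact: x_assign.
  apply: x_seq; first exact: ex2.
  apply: x_seq; first exact: x_assign.
  apply: x_seq; first exact: x_assign.
  by apply: x_seq; [exact: ex5|exact: x_assign].
- by rewrite /update /= s5b s50.
- rewrite /= s5b s50 s0; move: s3b; rewrite /s3 => ->; rewrite s20.
  by have := sz1 a; have := sz2 a; lia.
case=> // y yb; rewrite /update /=.
rewrite fr5 ?/s4 /update /=; last by apply: leq_trans yb; lia.
rewrite /s3 /update gtn_eqF // fr2; last by lia.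
by rewrite /s1 /update gtn_eqF //; lia.
Qed.

End Combinators.

Section Branch.
Context {A B : Type} {cA : codable A} {cB : codable B}.

(* Domain restrictions are expressed by subtypes, whose codes are those of the
   ambient type. *)
Lemma PT_if_sig (t : A -> bool) (f : A -> B) : PT t ->
  PT (fun a : {a | t a} => f (sval a)) -> PT (fun a : {a | ~~ t a} => f (sval a)) ->
  PT f.
Proof.
move=> [c0 [b0 [k0 H0]]] [c1 [b1 [k1 H1]]] [c2 [b2 [k2 H2]]].
have [b hb0 [hb1 hb2 b_gt0]] : exists2 b, b0 <= b & [/\ b1 <= b, b2 <= b & 0 < b].
  by exists (b0 + b1 + b2).+1; [lia|split; lia].
apply: (@PT_intro _ _ _ _ _
  (CSeq (CAssign b (EVar 0)) (CSeq c0
   (CIf (EVar 0) (CSeq (CAssign 0 (EVar b)) c1) (CSeq (CAssign 0 (EVar b)) c2))))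
  b.+1 (fun n => n.+2 ^ k0 + n.+2 ^ k1 + n.+2 ^ k2 + 4 * n + 100)).
  by poly_tac.
move=> a s s0.
set s1 := update s b (s 0).
have [t2 [s2 [ex2 s20 le2 fr2]]] := H0 a s1 (update_in0 _ b_gt0 s0).
have s2b : s2 b = code a.
  by rewrite fr2 ?/s1 /update ?eqxx //; lia.
set s3 := update s2 0 (s2 b).
have fin y : b < y -> s3 y = s y.
  case: y => // y yb; rewrite /s3 /update /= fr2; last by lia.
  by rewrite /s1 /update gtn_eqF.
case ta: (t a) s20 => s20.
  have [t4 [s4 [ex4 s40 le4 fr4]]] := H1 (exist _ a ta) s3 s2b.
  eexists; exists s4; split.
  - apply: x_seq; first exact: x_assign.
    apply: x_seq; first exact: ex2.
    apply: x_if_true; first by rewrite /= s20.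
    by apply: x_seq; [exact: x_assign|exact: ex4].
  - exact: s40.
  - by rewrite /= s20 s2b s0 /=; rewrite /= in le4; lia.
  move=> y yb; rewrite fr4 ?fin //.
  by apply: leq_trans (ltnW yb); lia.
have [t4 [s4 [ex4 s40 le4 fr4]]] := H2 (exist _ a (negbT ta)) s3 s2b.
eexists; exists s4; split.
- apply: x_seq; first exact: x_assign.
  apply: x_seq; first exact: ex2.
  apply: x_if_false; first by rewrite /= s20.
  by apply: x_seq; [exact: x_assign|exact: ex4].
- exact: s40.
- by rewrite /= s20 s2b s0 /=; rewrite /= in le4; lia.
move=> y yb; rewrite fr4 ?fin //.
by apply: leq_trans (ltnW yb); lia.
Qed.

Lemma PT_sig (t : A -> bool) (f : A -> B) : PT f -> PT (fun a : {a | t a} => f (sval a)).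
Proof.
move=> [c [b [k H]]]; exists c, b, k => a s s0.
exact: H.
Qed.

Lemma PT_if (t : A -> bool) (f g : A -> B) : PT t -> PT f -> PT g ->
  PT (fun a => if t a then f a else g a).
Proof.
move=> ptt ptf ptg; apply: (PT_if_sig ptt).
  by apply: eq_PT (PT_sig t ptf) => -[a /= ->].
by apply: eq_PT (PT_sig (predC t) ptg) => -[a /= /negbTE ->].
Qed.

End Branch.

Section Loop.
Context {A S : Type} {cA : codable A} {cS : codable S}.

(** The number [N a] of rounds is not computed: the loop runs until [t] fails, which the hypotheses
    place after exactly [N a] rounds. The bound on intermediate states is essential, as iterating a
    polynomial-time step can produce exponential growth. *)
Lemma PT_iter (i0 : A -> S) (t : S -> bool) (g : S -> S) (N : A -> nat) q :
  PT i0 -> PT t -> PT g -> poly q ->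
  (forall a i, i < N a -> t (iter i g (i0 a))) ->
  (forall a, ~~ t (iter (N a) g (i0 a))) ->
  (forall a i, i <= N a -> dsize (code (iter i g (i0 a))) <= q (dsize (code a))) ->
  (forall a, N a <= q (dsize (code a))) ->
  PT (fun a => iter (N a) g (i0 a)).
Proof.
move=> [ci [bi [ki Hi]]] [c0 [b0 [k0 H0]]] [c1 [b1 [k1 H1]]] pq tN tfin szq Nq.
have [b hb0 [hb1 hbi b_gt0]] : exists2 b, b0 <= b & [/\ b1 <= b, bi <= b & 0 < b].
  by exists (b0 + b1 + bi).+1; [lia|split; lia].
pose body := CSeq (CAssign 0 (EVar b)) (CSeq c1 (CSeq (CAssign b (EVar 0)) c0)).
(* [rnd n] bounds the cost of one round on states of size at most [q n]. *)
pose rnd n := (q n).+2 ^ k0 + (q n).+2 ^ k1 + 4 * q n + 100.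
apply: (@PT_intro _ _ _ _ _
  (CSeq ci (CSeq (CAssign b (EVar 0)) (CSeq c0
    (CSeq (CWhile (EVar 0) body) (CAssign 0 (EVar b))))))
  b.+1 (fun n => (q n + 1) * rnd n + n.+2 ^ ki + (q n).+2 ^ k0 + 8 * q n + 100)).
  by rewrite /rnd; poly_tac.
move=> a s s0; set n := dsize (code a).
have powq k m : m <= q n -> m.+2 ^ k <= (q n).+2 ^ k.
  by move=> mq; case: k => // k; rewrite leq_exp2r.
have loop i : i <= N a -> forall s1, s1 b = code (iter (N a - i) g (i0 a)) ->
    s1 0 = code (t (iter (N a - i) g (i0 a))) ->
    exists t1 s2, [/\ exec (CWhile (EVar 0) body) s1 t1 s2,
      s2 b = code (iter (N a) g (i0 a)), t1 <= (i + 1) * rnd n &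
      forall y, b < y -> s2 y = s1 y].
  elim: i => [_|i IHi iN] s1; rewrite ?subn0 => s1b s10.
    exists (ecost s1 (EVar 0)).+1, s1; split=> //.
    - by apply: x_while_false; rewrite /= s10 (negbTE (tfin a)).
    - by rewrite /= s10 (negbTE (tfin a)) /= /rnd; lia.
  set u := iter (N a - i.+1) g (i0 a) in s1b s10.
  have tu : t u by apply: (tN a); lia.
  have du : g u = iter (N a - i) g (i0 a) by rewrite /u -iterS -subSn // subSS.
  have szu : dsize (code u) <= q n by apply: (szq a); lia.
  have szgu : dsize (code (g u)) <= q n by rewrite du; apply: (szq a); lia.
  set s2 := update s1 0 (s1 b).
  have [t3 [s3 [ex3 s30 le3 fr3]]] := H1 u s2 s1b.
  set s4 := update s3 b (s3 0).
  have [t5 [s5 [ex5 s50 le5 fr5]]] := H0 (g u) s4 (update_in0 _ b_gt0 s30).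
  have s5b : s5 b = code (g u).
    by rewrite fr5 ?/s4 /update ?eqxx //; lia.
  rewrite du in s5b s50.
  have [t6 [s6 [ex6 s6b le6 fr6]]] := IHi (ltnW iN) s5 s5b s50.
  eexists; exists s6; split.
  - apply: x_while_true; last exact: ex6; first by rewrite /= s10 tu.
    apply: x_seq; first exact: x_assign.
    apply: x_seq; first exact: ex3.
    by apply: x_seq; [exact: x_assign|exact: ex5].
  - exact: s6b.
  - have le3' : t3 <= (q n).+2 ^ k1.
      exact/(leq_trans le3)/powq.
    have le5' : t5 <= (q n).+2 ^ k0.
      exact/(leq_trans le5)/powq.
    move: le6; rewrite /= s10 tu s1b s30 /=.
    rewrite -/n [i.+1 + 1]addSn [X in _ -> _ <= X]mulSn.
    rewrite {2}/rnd; lia.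
  move=> y yb; rewrite fr6 // fr5; last by apply: leq_trans (ltnW yb); lia.
  rewrite /s4 /update gtn_eqF // fr3; last by apply: leq_trans (ltnW yb); lia.
  by rewrite /s2 /update; case: (y) yb.
have [ti [si [exi si0 lei fri]]] := Hi a s s0.
set s1 := update si b (si 0).
have [t2 [s2 [ex2 s20 le2 fr2]]] := H0 (i0 a) s1 (update_in0 _ b_gt0 si0).
have s2b : s2 b = code (i0 a).
  by rewrite fr2 ?/s1 /update ?eqxx //; lia.
have [||t3 [s3 [ex3 s3b le3 fr3]]] := loop (N a) (leqnn _) s2; rewrite ?subnn //.
eexists; exists (update s3 0 (s3 b)); split.
- apply: x_seq; first exact: exi.
  apply: x_seq; first exact: x_assign.
  apply: x_seq; first exact: ex2.
  by apply: x_seq; [exact: ex3|exact: x_assign].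
- by rewrite /update /= s3b.
- rewrite /= si0 s3b; have := szq a _ (leqnn _); rewrite -/n => szN.
  have sz0 : dsize (code (i0 a)) <= q n by apply: (szq a 0).
  have le3' : t3 <= (q n + 1) * rnd n.
    by apply: leq_trans le3 _; rewrite leq_mul2r leq_add2r Nq orbT.
  have := leq_trans le2 (powq k0 _ sz0).
  by move: lei; rewrite -/n; lia.
case=> // y yb; rewrite /update /= fr3 // fr2; last by lia.
by rewrite /s1 /update gtn_eqF // fri //; lia.
Qed.

End Loop.

Lemma PT_polytime (A B : Type) {cA : codable A} {cB : codable B} (f : A -> B) :
  PT f -> polytime code code f.
Proof.
move=> [c [b [k H]]]; exists c, (3 ^ k) => a.
have [t [s' [ex out le_t _]]] := H a (init_store (code a)) erefl.
exists t, s'; split=> //; apply: leq_trans le_t _.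
apply: leq_trans (leq_addr _ _).
have := dsize_gt0 (@code A cA a); move: (dsize (code a)) => n n0.
(* Trees have positive size, whence [n.+2 <= 3 * n]. The constant [3 ^ k] then serves as the factor
   and as an exponent at least [k]. *)
apply: leq_trans (_ : (3 * n) ^ k <= _).
  by case: k {H} => // k; rewrite leq_exp2r //; lia.
rewrite expnMn leq_mul2l; apply/orP; right.
by apply: leq_pexp2l => //; apply/ltnW/ltn_expl.
Qed.

(** * Sizes of codes and elementary functions *)

Definition dsz (A : Type) {cA : codable A} (a : A) : nat := dsize (code a).

Lemma dsz_gt0 (A : Type) {cA : codable A} (a : A) : 0 < dsz a.
Proof. exact: dsize_gt0. Qed.

Lemma dsz_pair (A B : Type) {cA : codable A} {cB : codable B} (a : A) (b : B) :
  dsz (a, b) = (dsz a + dsz b).+1.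
Proof. by []. Qed.

Lemma dsz_cons (A : Type) {cA : codable A} (a : A) s : dsz (a :: s) = (dsz a + dsz s).+1.
Proof. by []. Qed.

Lemma dsz_nil (A : Type) {cA : codable A} : dsz ([::] : seq A) = 1.
Proof. by []. Qed.

Lemma dsz_cat (A : Type) {cA : codable A} (s t : seq A) :
  (dsz (s ++ t)).+1 = dsz s + dsz t.
Proof.
elim: s => [|a s IHs] //=; rewrite !dsz_cons. lia.
Qed.

Lemma size_dsz (A : Type) {cA : codable A} (s : seq A) : size s < dsz s.
Proof. by elim: s => [|b s IHs] //; rewrite dsz_cons /=; lia. Qed.

Lemma dsz_seq_le (A : Type) {cA : codable A} (s : seq A) m :
  (forall s1 a s2, s = s1 ++ a :: s2 -> dsz a <= m) -> dsz s <= (size s * m.+1).+1.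
Proof.
elim: s => [|a s IHs] // sm; rewrite dsz_cons /=.
have := sm [::] a s erefl; have : dsz s <= (size s * m.+1).+1.
  by apply: IHs => s1 b s2 es; apply: (sm (a :: s1) b s2); rewrite es.
lia.
Qed.

Lemma dsz_split (A : Type) {cA : codable A} s1 (a : A) s2 : dsz a < dsz (s1 ++ a :: s2).
Proof. pose proof (dsz_cat s1 (a :: s2)); pose proof (dsz_gt0 s1).
by rewrite dsz_cons in H; lia. Qed.

Lemma PT_dsz (A B : Type) {cA : codable A} {cB : codable B} (f : A -> B) : PT f ->
  exists k, forall a, dsz (f a) <= (dsz a).+2 ^ k.
Proof.
by move=> /PT_size[p [k pk] fp]; exists k => a; apply: leq_trans (fp a) (pk _).
Qed.

Fixpoint dexpr (d : data) : expr :=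
  if d is Node a b then ECons (dexpr a) (dexpr b) else ENil.

Lemma eval_dexpr s d : eval s (dexpr d) = d.
Proof. by elim: d => //= a -> b ->. Qed.

Lemma only0_dexpr d : only0 (dexpr d).
Proof. by elim: d => //= a -> b ->. Qed.

Section Simple.
Context {X A B C : Type} {cX : codable X} {cA : codable A} {cB : codable B} {cC : codable C}.

Lemma PT_id : PT (@id A).
Proof. by apply: (@PT_expr _ _ _ _ (EVar 0)). Qed.

Lemma PT_const (b : B) : PT (fun _ : A => b).
Proof.
apply: (@PT_expr _ _ _ _ (dexpr (code b))); first exact: only0_dexpr.
by move=> s a _; rewrite eval_dexpr.
Qed.

Lemma PT_fst (f : X -> A * B) : PT f -> PT (fun x => (f x).1).
Proof.
move=> ptf; apply: (PT_comp ptf); apply: (@PT_expr _ _ _ _ (EHd (EVar 0))) => // s [a b] /= ->.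
by [].
Qed.

Lemma PT_snd (f : X -> A * B) : PT f -> PT (fun x => (f x).2).
Proof.
move=> ptf; apply: (PT_comp ptf); apply: (@PT_expr _ _ _ _ (ETl (EVar 0))) => // s [a b] /= ->.
by [].
Qed.

Lemma PT_cons (f : X -> A) (g : X -> seq A) : PT f -> PT g -> PT (fun x => f x :: g x).
Proof. by move=> ptf ptg; apply: PT_recode (PT_pair ptf ptg). Qed.

Lemma PT_comp2 (f : X -> A) (g : X -> B) (h : A -> B -> C) :
  PT (fun y : A * B => h y.1 y.2) -> PT f -> PT g -> PT (fun x => h (f x) (g x)).
Proof. by move=> pth ptf ptg; apply: (PT_comp (PT_pair ptf ptg) pth). Qed.

End Simple.

Lemma PT_comp3 (X A B C D : Type) {cX : codable X} {cA : codable A} {cB : codable B}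
    {cC : codable C} {cD : codable D}
    (f : X -> A) (g : X -> B) (k : X -> C) (h : A -> B -> C -> D) :
  PT (fun y : A * B * C => h y.1.1 y.1.2 y.2) -> PT f -> PT g -> PT k ->
  PT (fun x => h (f x) (g x) (k x)).
Proof.
by move=> pth ptf ptg ptk; apply: (PT_comp (PT_pair (PT_pair ptf ptg) ptk) pth).
Qed.

Section SeqMatch.
Context {X A B : Type} {cX : codable X} {cA : codable A} {cB : codable B}.

(** The code of a nonempty list is already the code of the pair of its head and tail, so the second
    branch needs no conversion. *)
Lemma PT_seq_match (h : X -> seq A -> B) (l : X -> seq A) : PT l ->
  PT (fun x => h x [::]) -> PT (fun y : X * (A * seq A) => h y.1 (y.2.1 :: y.2.2)) ->
  PT (fun x => h x (l x)).
Proof.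
move=> ptl pt0 pt1.
have pth : PT (fun y : X * seq A => h y.1 y.2); last by apply: (PT_comp2 pth) => //; apply: PT_id.
apply: (@PT_if_sig _ _ _ _ (fun y => nilp y.2)).
- apply: (@PT_expr _ _ _ _ (EEq (ETl (EVar 0)) ENil)) => // s [x [|a u]] /= -> //=.
- apply: (@PT_via _ _ _ _ _ _ (EHd (EVar 0)) _ _ _ pt0) => // -[[x [|a u]]] // ?.
  by exists x => // s /= ->.
apply: (@PT_via _ _ _ _ _ _ (EVar 0) _ _ _ pt1) => // -[[x [|a u]]] // ?.
by exists (x, (a, u)) => // s /= ->.
Qed.

End SeqMatch.

(** The machine compares whole trees; injectivity of the code turns this into a test for
    equality. *)
Lemma PT_eq (X : Type) (A : eqType) {cX : codable X} {cA : codable A} (f g : X -> A) :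
  PT f -> PT g -> PT (fun x => f x == g x).
Proof.
move=> ptf ptg; apply: (PT_comp2 (h := fun a b : A => a == b) _ ptf ptg).
apply: (@PT_expr _ _ _ _ (EEq (EHd (EVar 0)) (ETl (EVar 0)))) => // s [a b] /= -> /=.
case: (eqVneq a b) => [->|/eqP nab]; first by rewrite eqxx.
by case: eqP => // e; case: nab; apply: code_inj e.
Qed.

Lemma PT_negb (X : Type) {cX : codable X} (f : X -> bool) : PT f -> PT (fun x => ~~ f x).
Proof. by move=> ptf; apply: PT_if => //; apply: PT_const. Qed.

Lemma PT_orb (X : Type) {cX : codable X} (f g : X -> bool) :
  PT f -> PT g -> PT (fun x => f x || g x).
Proof. by move=> ptf ptg; apply: PT_if => //; apply: PT_const. Qed.

Section Fold.
Context {X A B : Type} {cX : codable X} {cA : codable A} {cB : codable B}.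

Lemma PT_foldl (g : X -> B -> A -> B) (l : X -> seq A) (z : X -> B) q :
  PT (fun y : X * B * A => g y.1.1 y.1.2 y.2) -> PT l -> PT z -> poly q ->
  (forall x s1 s2, l x = s1 ++ s2 -> dsz (foldl (g x) (z x) s1) <= q (dsz x)) ->
  PT (fun x => foldl (g x) (z x) (l x)).
Proof.
move=> ptg ptl ptz pq gq; have [k lk] := PT_dsz ptl.
pose step (s : X * (seq A * B)) :=
  if s.2.1 is a :: u then (s.1, (u, g s.1 s.2.2 a)) else s.
pose i0 x := (x, (l x, z x)).
have step_i x s1 s2 : l x = s1 ++ s2 ->
    iter (size s1) step (i0 x) = (x, (s2, foldl (g x) (z x) s1)).
  elim/last_ind: s1 s2 => [|s1 a IHs] s2 lx; first by rewrite /i0 lx.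
  rewrite size_rcons iterS (IHs (a :: s2)) ?lx ?cat_rcons //.
  by rewrite /step /= foldl_rcons.
apply: (@eq_PT _ _ _ _ (fun x => (iter (size (l x)) step (i0 x)).2.2)).
  by move=> x; rewrite (step_i x (l x) [::]) ?cats0.
apply/PT_snd/PT_snd.
have ptstep : PT step.
  rewrite /step; apply: (PT_seq_match
    (h := fun (s : X * (seq A * B)) v =>
       if v is a :: u then (s.1, (u, g s.1 s.2.2 a)) else s)).
  - exact/PT_fst/PT_snd/PT_id.
  - exact: PT_id.
  have pt1 : PT (fun y : X * (seq A * B) * (A * seq A) => y.1.1).
    exact/PT_fst/PT_fst/PT_id.
  apply: PT_pair => //; apply: PT_pair; first exact/PT_snd/PT_snd/PT_id.
  apply: (PT_comp3 ptg) => //; last exact/PT_fst/PT_snd/PT_id.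
  exact/PT_snd/PT_snd/PT_fst/PT_id.
have spl x i : i <= size (l x) -> iter i step (i0 x) =
    (x, (drop i (l x), foldl (g x) (z x) (take i (l x)))).
  move=> il; rewrite -(step_i x (take i (l x))) ?cat_take_drop //.
  by rewrite size_takel.
apply: (@PT_iter _ _ _ _ i0 (fun s => ~~ nilp s.2.1) step (fun x => size (l x))
  (fun n => n + n.+2 ^ k + q n + 10)) => //.
- apply: PT_pair; first exact: PT_id.
  exact: PT_pair.
- apply: PT_negb; apply: (PT_comp (f := fun s : X * (seq A * B) => s.2.1)).
    exact/PT_fst/PT_snd/PT_id.
  apply: (@PT_expr _ _ _ _ (EEq (EVar 0) ENil)) => // s [|a u] /= -> //=.
- by poly_tac.
- move=> x i il; rewrite spl ?(ltnW il) //= /nilp size_drop subn_eq0 -ltnNge //.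
- by move=> x; rewrite spl // drop_size.
- move=> x i il; rewrite spl // -/(dsz x).
  rewrite -/(dsz (x, (drop i (l x), foldl (g x) (z x) (take i (l x))))) !dsz_pair.
  have := gq x (take i (l x)) (drop i (l x)); rewrite cat_take_drop => /(_ erefl).
  pose proof (dsz_cat (take i (l x)) (drop i (l x))) as e.
  rewrite cat_take_drop in e.
  by have := lk x; pose proof (dsz_gt0 (take i (l x))); lia.
by move=> x; have := lk x; pose proof (size_dsz (l x)); rewrite -/(dsz x); lia.
Qed.

End Fold.

Lemma PT_rev (X A : Type) {cX : codable X} {cA : codable A} (l : X -> seq A) :
  PT l -> PT (fun x => rev (l x)).
Proof.
move=> ptl; apply: (PT_comp ptl).
apply: (@eq_PT _ _ _ _ (fun s : seq A => foldl (fun acc a => a :: acc) [::] s)).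
  move=> s; rewrite /rev; move: [::]; elim: s => //= a s IHs u.
apply: (@PT_foldl (seq A) A (seq A) _ _ _ (fun _ acc a => a :: acc) id (fun=> [::]) id).
- by apply: PT_cons; [exact/PT_snd/PT_id|exact/PT_snd/PT_fst/PT_id].
- exact: PT_id.
- exact: PT_const.
- exact: poly_id.
move=> s s1 s2 -> /=.
have e u : dsz (foldl (fun acc a => a :: acc) u s1) + 1 = dsz s1 + dsz u.
  by elim: s1 u => [|a s1 IHs] u /=; rewrite ?IHs ?dsz_cons; [rewrite addnC|lia].
have := e [::]; rewrite dsz_nil; pose proof (dsz_cat s1 s2); pose proof (dsz_gt0 s2); lia.
Qed.

Section Foldr.
Context {X A B : Type} {cX : codable X} {cA : codable A} {cB : codable B}.

Lemma PT_foldr (g : X -> A -> B -> B) (l : X -> seq A) (z : X -> B) q :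
  PT (fun y : X * B * A => g y.1.1 y.2 y.1.2) -> PT l -> PT z -> poly q ->
  (forall x s1 s2, l x = s1 ++ s2 -> dsz (foldr (g x) (z x) s2) <= q (dsz x)) ->
  PT (fun x => foldr (g x) (z x) (l x)).
Proof.
move=> ptg ptl ptz pq gq.
apply: (@eq_PT _ _ _ _ (fun x => foldl (fun b a => g x a b) (z x) (rev (l x)))).
  by move=> x; rewrite foldl_rev.
apply: (@PT_foldl _ _ _ _ _ _ (fun x b a => g x a b) (fun x => rev (l x)) z q) => //.
  exact: PT_rev.
move=> x s1 s2 ex; rewrite -[s1]revK foldl_rev.
by apply: (gq x (rev s2)); rewrite -rev_cat -ex revK.
Qed.

End Foldr.

Lemma PT_map (X A B : Type) {cX : codable X} {cA : codable A} {cB : codable B}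
    (g : X -> A -> B) (l : X -> seq A) :
  PT (fun y : X * A => g y.1 y.2) -> PT l -> PT (fun x => map (g x) (l x)).
Proof.
move=> ptg ptl; have [k gk] := PT_dsz ptg; have [j lj] := PT_dsz ptl.
apply: (@PT_foldr _ _ _ _ _ _ (fun x a acc => g x a :: acc) _ (fun=> [::])
  (fun n => (n.+2 ^ j * ((n + n.+2 ^ j).+1.+2 ^ k).+1).+1)) => //.
- apply: PT_cons; last exact/PT_snd/PT_fst/PT_id.
  by apply: (PT_comp2 ptg); [exact/PT_fst/PT_fst/PT_id|exact/PT_snd/PT_id].
- exact: PT_const.
- by poly_tac.
move=> x s1 s2 lx; rewrite -/(map (g x) s2).
have le_m a : dsz a < dsz (l x) -> dsz (g x a) <= (dsz x + (dsz x).+2 ^ j).+1.+2 ^ k.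
  move=> al; apply: leq_trans (gk (x, a)) _; case: (k) => // k'.
  by rewrite leq_exp2r // dsz_pair; have := lj x; lia.
apply: leq_trans (dsz_seq_le (m := (dsz x + (dsz x).+2 ^ j).+1.+2 ^ k) _) _.
  move=> t1 b t2 e.
  have [a [u1 [u2 [-> es2]]]] : exists a u1 u2, b = g x a /\ s2 = u1 ++ a :: u2.
    elim: s2 t1 e {lx} => [|a s2 IHs] [|c t1] //= [].
      by move=> <- _; exists a, [::], s2.
    by move=> _ /IHs[a' [u1 [u2 [-> ->]]]]; exists a', (a :: u1), u2.
  by apply: le_m; rewrite lx es2 catA; apply: dsz_split.
rewrite size_map ltnS leq_mul2r; apply/orP; right.
pose proof (size_dsz s2); pose proof (dsz_cat s1 s2); pose proof (dsz_gt0 s1).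
by have := lj x; rewrite lx; lia.
Qed.

Section Lists.
Context {X A : Type} {cX : codable X} {cA : codable A}.

Lemma PT_cat (f g : X -> seq A) : PT f -> PT g -> PT (fun x => f x ++ g x).
Proof.
move=> ptf ptg; have [k fk] := PT_dsz ptf; have [j gj] := PT_dsz ptg.
have catE s t : foldr (fun (a : A) acc => a :: acc) t s = s ++ t.
  by elim: s => //= a s ->.
apply: (@eq_PT _ _ _ _ (fun x => foldr (fun a acc => a :: acc) (g x) (f x))) => //.
apply: (@PT_foldr _ _ _ _ _ _ (fun _ a acc => a :: acc) f g
  (fun n => n.+2 ^ k + n.+2 ^ j)) => //.
- by apply: PT_cons; [exact/PT_snd/PT_id|exact/PT_snd/PT_fst/PT_id].
- by poly_tac.
move=> x s1 s2 fx; rewrite catE.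
pose proof (dsz_cat s2 (g x)); pose proof (dsz_cat s1 s2); pose proof (dsz_gt0 s1).
by have := fk x; have := gj x; rewrite fx; lia.
Qed.

Lemma PT_rcons (f : X -> seq A) (g : X -> A) : PT f -> PT g -> PT (fun x => rcons (f x) (g x)).
Proof.
move=> ptf ptg; apply: (@eq_PT _ _ _ _ (fun x => f x ++ [:: g x])).
  by move=> x; rewrite cats1.
by apply: PT_cat => //; apply: PT_cons => //; apply: PT_const.
Qed.

End Lists.

Section ListFunctions.
Context {X A : Type} {cX : codable X} {cA : codable A}.

Lemma dsz_flatten (ss : seq (seq A)) : dsz (flatten ss) <= dsz ss.
Proof.
elim: ss => [|s ss IHs] //=; rewrite dsz_cons; pose proof (dsz_cat s (flatten ss)); lia.
Qed.

Lemma PT_flatten (f : X -> seq (seq A)) : PT f -> PT (fun x => flatten (f x)).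
Proof.
move=> ptf; have [k fk] := PT_dsz ptf.
apply: (@PT_foldr _ _ _ _ _ _ (fun _ => cat) f (fun=> [::]) (fun n => n.+2 ^ k)) => //.
- by apply: PT_cat; [exact/PT_snd/PT_id|exact/PT_snd/PT_fst/PT_id].
- exact: PT_const.
- by poly_tac.
move=> x s1 s2 fx; rewrite -/(flatten s2); apply: leq_trans (dsz_flatten s2) _.
apply: leq_trans (fk x); rewrite fx.
by pose proof (dsz_cat s1 s2); pose proof (dsz_gt0 s1); lia.
Qed.

Lemma PT_head (z : X -> A) (f : X -> seq A) : PT z -> PT f -> PT (fun x => head (z x) (f x)).
Proof.
move=> ptz ptf; apply: (PT_seq_match (h := fun x => head (z x))) => //=.
exact/PT_fst/PT_snd/PT_id.
Qed.

Lemma PT_has (p : X -> A -> bool) (f : X -> seq A) :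
  PT (fun y : X * A => p y.1 y.2) -> PT f -> PT (fun x => has (p x) (f x)).
Proof.
move=> ptp ptf.
apply: (@PT_foldr _ _ _ _ _ _ (fun x a b => p x a || b) f (fun=> false) (fun=> 3)) => //.
- apply: PT_orb; last exact/PT_snd/PT_fst/PT_id.
  by apply: (PT_comp2 ptp); [exact/PT_fst/PT_fst/PT_id|exact/PT_snd/PT_id].
- exact: PT_const.
- exact: poly_const.
by move=> x s1 s2 _; case: foldr.
Qed.

Lemma PT_all (p : X -> A -> bool) (f : X -> seq A) :
  PT (fun y : X * A => p y.1 y.2) -> PT f -> PT (fun x => all (p x) (f x)).
Proof.
move=> ptp ptf; apply: (@eq_PT _ _ _ _ (fun x => ~~ has (fun a => ~~ p x a) (f x))).
  by move=> x; rewrite -all_predC; apply: eq_all => a /=; rewrite negbK.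
by apply/PT_negb/PT_has => //; apply: PT_negb.
Qed.

End ListFunctions.

Definition flatmap (A B : Type) (f : A -> seq B) (s : seq A) : seq B := flatten (map f s).

Lemma flatmapP (A : eqType) (B : eqType) (f : A -> seq B) (s : seq A) (b : B) :
  reflect (exists2 a, a \in s & b \in f a) (b \in flatmap f s).
Proof. exact: flatten_mapP. Qed.

Lemma PT_flatmap (X A B : Type) {cX : codable X} {cA : codable A} {cB : codable B}
    (g : X -> A -> seq B) (l : X -> seq A) :
  PT (fun y : X * A => g y.1 y.2) -> PT l -> PT (fun x => flatmap (g x) (l x)).
Proof. by move=> ptg ptl; apply/PT_flatten/PT_map. Qed.

Lemma PT_filter (X A : Type) {cX : codable X} {cA : codable A}
    (p : X -> A -> bool) (f : X -> seq A) :
  PT (fun y : X * A => p y.1 y.2) -> PT f -> PT (fun x => filter (p x) (f x)).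
Proof.
move=> ptp ptf.
apply: (@eq_PT _ _ _ _ (fun x => flatmap (fun a => if p x a then [:: a] else [::]) (f x))).
  by move=> x; elim: (f x) => //= a s <-; rewrite /flatmap /=; case: (p x a).
apply: PT_flatmap => //; apply: PT_if => //; last exact: PT_const.
by apply: PT_cons; [exact/PT_snd/PT_id|exact: PT_const].
Qed.

Lemma PT_mem (X : Type) (A : eqType) {cX : codable X} {cA : codable A}
    (g : X -> A) (f : X -> seq A) : PT g -> PT f -> PT (fun x => g x \in f x).
Proof.
move=> ptg ptf; apply: (@eq_PT _ _ _ _ (fun x => has (fun a => a == g x) (f x))).
  by move=> x; rewrite has_pred1.
apply: PT_has => //; apply: PT_eq; first exact/PT_snd/PT_id.
by apply: PT_comp ptg; apply/PT_fst/PT_id.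
Qed.

Fixpoint tails (A : Type) (s : seq A) : seq (seq A) :=
  s :: if s is _ :: s' then tails s' else [::].

Lemma mem_tails (A : eqType) (s t : seq A) :
  reflect (exists u, s = u ++ t) (t \in tails s).
Proof.
elim: s => [|a s IHs]; rewrite /= inE.
  by apply: (iffP eqP) => [->|[[|b u]]] //; exists [::].
apply: (iffP predU1P) => [[->|/IHs[u ->]]|[[|b u] e]]; first by exists [::].
- by exists (a :: u).
- by left.
by right; apply/IHs; exists u; case: e.
Qed.

Lemma PT_tails (X A : Type) {cX : codable X} {cA : codable A} (f : X -> seq A) :
  PT f -> PT (fun x => tails (f x)).
Proof.
move=> ptf; apply: (PT_comp ptf).
have tE s : foldr (fun (a : A) acc => (a :: head [::] acc) :: acc) [:: [::]] s = tails s.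
  by elim: s => //= a s ->; case: s.
apply: (eq_PT tE).
apply: (@PT_foldr (seq A) A (seq (seq A)) _ _ _
  (fun _ a acc => (a :: head [::] acc) :: acc) id (fun=> [:: [::]]) (fun n => (n * n.+1).+1)).
- have pt2 : PT (fun y : seq A * seq (seq A) * A => y.1.2) by exact/PT_snd/PT_fst/PT_id.
  apply: PT_cons => //; apply: PT_cons; first exact/PT_snd/PT_id.
  by apply: PT_head => //; apply: PT_const.
- exact: PT_id.
- exact: PT_const.
- by poly_tac.
move=> s s1 s2 -> /=; rewrite tE.
apply: (@leq_trans (dsz s2 * (dsz s2).+1).+1).
  apply: leq_trans (dsz_seq_le (m := dsz s2) _) _.
    elim: s2 => [|a s2 IHs] t1 b t2 /=; first by case: t1 => [|? []] // [<-].
    case: t1 => [[<- _]|c t1 [_ /IHs bs]] //; rewrite dsz_cons; lia.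
  rewrite ltnS leq_mul2r /=; apply: leq_trans (size_dsz s2).
  by elim: (s2) => //= a s2' /leq_trans->.
by pose proof (dsz_cat s1 s2); pose proof (dsz_gt0 s1); nia.
Qed.

Definition prefixes (A : Type) (s : seq A) : seq (seq A) := map rev (tails (rev s)).

Lemma mem_prefixes (A : eqType) (s t : seq A) :
  reflect (exists u, s = t ++ u) (t \in prefixes s).
Proof.
apply: (iffP mapP) => [[u /mem_tails[v e] ->]|[u e]].
  by exists (rev v); rewrite -rev_cat -e revK.
by exists (rev t); rewrite ?revK //; apply/mem_tails; exists (rev u); rewrite -rev_cat e.
Qed.

Lemma PT_prefixes (X A : Type) {cX : codable X} {cA : codable A} (f : X -> seq A) :
  PT f -> PT (fun x => prefixes (f x)).
Proof.
move=> ptf; apply: PT_map; first exact/PT_rev/PT_snd/PT_id.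
exact/PT_tails/PT_rev.
Qed.

(** * Saturation *)

Definition unsnoc (A : Type) (s : seq A) : seq (seq A * A) :=
  if rev s is a :: r then [:: (rev r, a)] else [::].

Lemma mem_unsnoc (A : eqType) (s : seq A) x :
  (x \in unsnoc s) = (s == rcons x.1 x.2).
Proof.
case: x => r b; rewrite /unsnoc; case/lastP: s => [|s a]; first by case: r.
by rewrite rev_rcons revK inE eqseq_rcons xpair_eqE eq_sym [b == a]eq_sym.
Qed.

Definition swap_at (u v : seq form) : seq (seq form) :=
  if v is a :: b :: w then [:: u ++ b :: a :: w] else [::].

(** Positions are enumerated as pairs of a prefix and a suffix that concatenate to [s], which avoids
    arithmetic on indices. *)
Definition swaps (s : seq form) : seq (seq form) :=
  flatmap (fun u => flatmap (fun v => if u ++ v == s then swap_at u v else [::]) (tails s))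
    (prefixes s).

Lemma swapsP s t :
  reflect (exists u a b w, s = u ++ a :: b :: w /\ t = u ++ b :: a :: w) (t \in swaps s).
Proof.
apply: (iffP (flatmapP _ _ _)) => [[u _ /flatmapP[v _]]|[u [a [b [w [es et]]]]]].
  case: eqP => // <-; case: v => [|a [|b w]] //=; rewrite inE => /eqP->.
  by exists u, a, b, w.
exists u; first by apply/mem_prefixes; exists (a :: b :: w).
apply/flatmapP; exists (a :: b :: w); first by apply/mem_tails; exists u.
by rewrite es eqxx et inE.
Qed.

(** The premise [(G, D)] stands for weakening and, if the principal formula is [One], also for the
    rule that adds 1 on the left. On the right, the same holds with [Zero]. *)
Definition premisesl (D G : seq form) (C : form) : seq (seq sequent) :=
  [:: [:: (G, D)]; [:: (rcons (rcons G C) C, D)]] ++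
  match C with
  | Or A B => [:: [:: (rcons G A, D); (rcons G B, D)]]
  | Dec A p B =>
      [:: [:: (rcons G A, rcons D (pvar p)); (rcons (rcons G (pvar p)) B, D)]]
  | _ => [::]
  end.

Definition premisesr (G D : seq form) (C : form) : seq (seq sequent) :=
  [:: [:: (G, D)]; [:: (G, rcons (rcons D C) C)]] ++
  match C with
  | Or A B => [:: [:: (G, rcons (rcons D A) B)]]
  | Dec A p B =>
      [:: [:: (G, rcons (rcons D A) (pvar p)); (rcons G (pvar p), rcons D B)]]
  | _ => [::]
  end.

Definition axiomatic (S : sequent) : bool :=
  (S \in [seq ([:: A], [:: A]) | A <- S.1]) ||
  ((S == ([:: Zero], [::])) || (S == ([::], [:: One]))).

(** The rules read backwards from the conclusion [S]. The list is finite because cut formulas are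
    drawn from [F]. *)
Definition premises (F : seq form) (S : sequent) : seq (seq sequent) :=
  (if axiomatic S then [:: [::]] else [::]) ++
  ([seq [:: (S.1, rcons S.2 A); (rcons S.1 A, S.2)] | A <- F] ++
  ([seq [:: (G, S.2)] | G <- swaps S.1] ++
  ([seq [:: (S.1, D)] | D <- swaps S.2] ++
  (flatmap (fun x => premisesl S.2 x.1 x.2) (unsnoc S.1) ++
   flatmap (fun x => premisesr S.1 x.1 x.2) (unsnoc S.2))))).

Lemma premises_sound F ps S : ps \in premises F S -> LNDT_rule ps S.
Proof.
case: S => G D; rewrite /premises !mem_cat /=.
case/or4P=> [||/mapP[G' /swapsP[u [a [b [w [-> ->]]]]] ->]|].
- case: ifP => //; rewrite inE => ax /eqP->; move: ax.
  rewrite /axiomatic => /orP[/mapP[A _ ->]|/orP[/eqP->|/eqP->]]; by constructor.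
- by case/mapP=> A _ ->; constructor.
- by constructor.
case/or3P=> [/mapP[D' /swapsP[u [a [b [w [-> ->]]]]] ->]||]; first by constructor.
- case/flatmapP=> -[G' C]; rewrite mem_unsnoc /= => /eqP->; rewrite /premisesl !inE.
  case/or3P=> [/eqP->|/eqP->|]; try by constructor.
  by case: C => // [A p B|A B]; rewrite inE => /eqP->; constructor.
- case/flatmapP=> -[G' C]; rewrite mem_unsnoc /= => /eqP->; rewrite /premisesr !inE.
  case/or3P=> [/eqP->|/eqP->|]; try by constructor.
  by case: C => // [A p B|A B]; rewrite inE => /eqP->; constructor.
Qed.

Lemma premises_complete (F : seq form) ps S : LNDT_rule ps S ->
  (forall A, (S.1, rcons S.2 A) \in ps -> A \in F) -> ps \in premises F S.
Proof.
have inl D G C qs : qs \in premisesl D G C ->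
    qs \in flatmap (fun x => premisesl D x.1 x.2) (unsnoc (rcons G C)).
  by move=> h; apply/flatmapP; exists (G, C); rewrite ?mem_unsnoc.
have inr G D C qs : qs \in premisesr G D C ->
    qs \in flatmap (fun x => premisesr G x.1 x.2) (unsnoc (rcons D C)).
  by move=> h; apply/flatmapP; exists (D, C); rewrite ?mem_unsnoc.
case=> {ps S} /=; rewrite /premises; intros; rewrite !mem_cat.
- by rewrite /axiomatic map_f ?inE.
- by apply/orP; right; rewrite map_f //; move: (H A); rewrite inE eqxx; apply.
all: try by rewrite ?inl ?inr ?orbT // /premisesl /premisesr !inE eqxx ?orbT.
- apply/orP; right; apply/orP; right; apply/orP; left; apply: map_f.
  by apply/swapsP; exists G1, B, A, G2.
- apply/orP; right; apply/orP; right; apply/orP; right; apply/orP; left; apply: map_f.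
  by apply/swapsP; exists D1, B, A, D2.
Qed.

Lemma count_lt (T : eqType) (a b : pred T) (s : seq T) x :
  (forall y, a y -> b y) -> x \in s -> ~~ a x -> b x -> count a s < count b s.
Proof.
move=> ab; elim: s => //= y s IHs; rewrite inE => /predU1P[<- nax bx|xs nax bx].
  by rewrite (negbTE nax) bx ltnS sub_count.
have := IHs xs nax bx; have := ab y; case: (a y) => [->|_] // lt.
by apply: leq_trans lt _; apply: leq_addl.
Qed.

Section Saturation.
Variables (hyps : seq sequent) (F : seq form) (cand : seq sequent).

Definition justified (l : seq sequent) (S : sequent) : bool :=
  (S \in hyps) || has (fun ps => all (fun T => T \in l) ps) (premises F S).

Definition saturate_step (l : seq sequent) : seq sequent := l ++ filter (justified l) cand.

(** The fold uses [cand] as a clock: one round per candidate is enough, since every round before the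
    fixpoint adds a new candidate. *)
Definition saturation : seq sequent := foldl (fun l _ => saturate_step l) [::] cand.

(** Existence of a derivation all of whose sequents are candidates; this is what saturation
    realizes. *)
Inductive prv : sequent -> Prop :=
| prv_hyp S : S \in cand -> S \in hyps -> prv S
| prv_rule ps S : S \in cand -> LNDT_rule ps S -> (forall T, T \in ps -> prv T) -> prv S.

Lemma saturationE : saturation = iter (size cand) saturate_step [::].
Proof.
rewrite /saturation; move: [::]; elim: (cand) => //= S s IHs l.
by rewrite IHs -iterSr.
Qed.

(** The sequents added in one round are justified by the list before that round, so they form a
    derivation in whatever order they are appended. *)
Lemma saturation_derivation (K : pred form) (hyp : sequent -> Prop) :
  all (sequent_over K) cand -> (forall S, S \in hyps -> hyp S) ->
  derivation K hyp LNDT_rule saturation.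
Proof.
move=> Kc hypP; rewrite saturationE; elim: (size cand) => [|n IHn]; first by case.
rewrite iterS; move: (iter _ _ _) IHn => l IHl l1 S l2 e.
have [Sl|Sl] := ltnP (size l1) (size l).
  have el : l = l1 ++ S :: take (size l - (size l1).+1) l2.
    have := congr1 (take (size l)) e; rewrite /saturate_step take_size_cat //.
    by rewrite take_cat ltnNge (ltnW Sl) /= -(subnSK Sl).
  exact: IHl el.
have el1 : l1 = l ++ take (size l1 - size l) (filter (justified l) cand).
  have := congr1 (take (size l1)) e; rewrite take_size_cat // /saturate_step.
  by rewrite take_cat ltnNge Sl => /esym.
have : S \in filter (justified l) cand.
  move: e; rewrite /saturate_step el1 -catA => /eqP; rewrite eqseq_cat // eqxx /=.
  by move/eqP->; rewrite mem_cat inE eqxx orbT.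
rewrite mem_filter => /andP[just Sc]; split; first exact: (allP Kc).
case/orP: just => [/hypP|/hasP[ps /premises_sound R /allP ps_l]]; [by left|right].
by exists ps => // T /ps_l; rewrite el1 mem_cat => ->.
Qed.

(** A round that adds nothing new is followed only by such rounds, and any other round increases the
    number of derived candidates. That number cannot exceed [size cand], so the list is stable by
    then. *)
Lemma saturation_closed S : S \in cand -> justified saturation S -> S \in saturation.
Proof.
pose lv n := iter n saturate_step [::].
have sub m n : m <= n -> {subset lv m <= lv n}.
  elim: n => [|n IHn]; first by rewrite leqn0 => /eqP->.
  rewrite leq_eqVlt => /predU1P[->|/IHn h] // T /h; rewrite /lv iterS mem_cat => ->//.
pose dn n := count (fun T => T \in lv n) cand.
have next n T : T \in cand -> justified (lv n) T -> T \in lv n.+1.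
  by move=> Tc jT; rewrite /lv iterS mem_cat mem_filter jT Tc orbT.
have stable n : {subset lv n.+1 <= lv n} -> {subset lv n.+2 <= lv n.+1}.
  move=> st T; rewrite {1}/lv iterS mem_cat => /orP[//|]; rewrite mem_filter => /andP[jT Tc].
  apply: next => //; case/orP: jT => [Th|/hasP[ps ps1 /allP ps2]]; first by rewrite /justified Th.
  apply/orP; right; apply/hasP; exists ps => //; apply/allP => U /ps2; exact: st.
have grow n : {subset lv n.+1 <= lv n} \/ n < dn n.+1.
  elim: n => [|n [st|IHn]]; last first.
  - have [st|nst] := boolP (all (fun T => T \in lv n.+1) (lv n.+2)); first by left; apply/allP.
    right; apply: leq_ltn_trans IHn _.
    have /allPn[T T2 T1] := nst.
    have Tc : T \in cand.
      move: T2; rewrite /lv iterS mem_cat mem_filter -/(lv n.+1) (negbTE T1) /=.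
      by case/andP.
    apply: count_lt (Tc) _ _ => [U|//|//]; exact: sub.
  - by left; apply: stable.
  have [st|nst] := boolP (nilp (lv 1)); [left|right].
    by move=> T; rewrite (nilP st).
  rewrite -has_count; apply/hasP; case E: (lv 1) nst => [|T l] // _.
  have Tl : T \in lv 1 by rewrite E mem_head.
  exists T => //; last by rewrite -E.
  by move: Tl; rewrite /lv /= mem_filter => /andP[].
have fin n : {subset lv n.+1 <= lv n} -> forall m, n <= m -> {subset lv m.+1 <= lv m}.
  move=> st; elim=> [|m IHm]; first by rewrite leqn0 => /eqP<-.
  by rewrite leq_eqVlt => /predU1P[<-|/IHm/stable].
rewrite saturationE -/(lv (size cand)) => Sc jS.
have [st|] := grow (size cand); first by apply/st/next.
by rewrite ltnNge count_size.
Qed.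

Lemma prv_cand S : prv S -> S \in cand.
Proof. by case. Qed.

Lemma saturation_complete S :
  (forall T A, T \in cand -> A \in T.2 -> A \in F) -> prv S -> S \in saturation.
Proof.
move=> candF; elim=> {S} [S Sc Sh|ps S Sc R prems IHps].
  by apply: saturation_closed => //; rewrite /justified Sh.
apply: saturation_closed => //; apply/orP; right; apply/hasP; exists ps.
  by apply: premises_complete => // A /prems/prv_cand/candF; apply; rewrite mem_rcons mem_head.
by apply/allP => T /IHps.
Qed.

End Saturation.

(** * Sequents in context *)

Fixpoint words (T : Type) (w : nat) (F : seq T) : seq (seq T) :=
  if w is w'.+1 then [::] :: flatmap (fun A => map (cons A) (words w' F)) F else [:: [::]].

Lemma mem_words (T : eqType) w (F s : seq T) :
  (s \in words w F) = (size s <= w) && all (fun A => A \in F) s.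
Proof.
elim: w s => [|w IHw] [|A s] //=.
rewrite inE /=; apply/flatmapP/and3P => [[B BF /mapP[t]]|[sw AF sF]].
  by rewrite IHw => /andP[tw tF] [-> ->].
by exists A => //; apply: map_f; rewrite IHw -ltnS sw.
Qed.

Definition candidates_of (W : seq (seq form)) (S : sequent) : seq sequent :=
  flatmap (fun G => flatmap (fun D => flatmap (fun u =>
    map (fun v => (G ++ u, D ++ v)) W) W) (prefixes S.2)) (prefixes S.1).

Definition candidates (w : nat) (F : seq form) (lines : seq sequent) : seq sequent :=
  flatmap (candidates_of (words w F)) lines.

Section Calculus.
Variables (hyps : seq sequent) (F : seq form) (lines : seq sequent) (w : nat).

Local Notation prv := (prv hyps (candidates (w + w) F lines)).

Definition context (G D : seq form) : Prop :=
  exists2 S, S \in lines & G \in prefixes S.1 /\ D \in prefixes S.2.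

Lemma context_cand (G D u v : seq form) : context G D -> all (fun A => A \in F) u ->
  all (fun A => A \in F) v -> size u <= w + w -> size v <= w + w ->
  (G ++ u, D ++ v) \in candidates (w + w) F lines.
Proof.
move=> [S Sl [GS DS]] uF vF uw vw; apply/flatmapP; exists S => //.
apply/flatmapP; exists G => //; apply/flatmapP; exists D => //.
apply/flatmapP; exists u; first by rewrite mem_words uw.
by apply: map_f; rewrite mem_words vw.
Qed.

Lemma context_prefix (G D : seq form) (A : form) : context (rcons G A) D -> context G D.
Proof.
move=> [S Sl [/mem_prefixes[u GS] DS]]; exists S => //; split=> //.
by apply/mem_prefixes; exists (A :: u); rewrite GS cat_rcons.
Qed.

Lemma context_prefixr (G D : seq form) (A : form) : context G (rcons D A) -> context G D.
Proof.
move=> [S Sl [GS /mem_prefixes[u DS]]]; exists S => //; split=> //.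
by apply/mem_prefixes; exists (A :: u); rewrite DS cat_rcons.
Qed.

(* The context [G], [D] is inert: the structural rules act on the words [u] and [v]
   at its right end. *)
Definition pv (G D u v : seq form) : Prop := prv (G ++ u, D ++ v).

Local Notation inF := (all (fun A => A \in F)).

(** * Structural rules at the right end of a context *)

Section InContext.
Variables (G D : seq form).
Hypothesis GD : context G D.

Lemma pv_rule1 (u v u' v' : seq form) : inF u' -> inF v' -> size u' <= w + w -> size v' <= w + w ->
  LNDT_rule [:: (G ++ u, D ++ v)] (G ++ u', D ++ v') -> pv G D u v -> pv G D u' v'.
Proof.
move=> uF vF uw vw R p; apply: prv_rule R _; first exact: context_cand.
by move=> T; rewrite inE => /eqP->.
Qed.

Lemma pv_movel (x y z : seq form) (A : form) (v : seq form) : inF (x ++ A :: y ++ z) -> inF v ->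
  size (x ++ A :: y ++ z) <= w + w -> size v <= w + w ->
  pv G D (x ++ A :: y ++ z) v <-> pv G D (x ++ y ++ A :: z) v.
Proof.
move=> uF vF uw vw; elim: y x uF uw => [|B y IHy] x uF uw //.
have perm : perm_eq (x ++ A :: B :: y ++ z) (x ++ B :: A :: y ++ z).
  by rewrite perm_cat2l -[A :: B :: _]/([:: A; B] ++ _) -[B :: A :: _]/([:: B; A] ++ _)
     perm_cat2r -[[:: A; B]]/([:: A] ++ [:: B]) perm_catC.
have e : x ++ B :: A :: y ++ z = rcons x B ++ A :: y ++ z by rewrite cat_rcons.
have uF' : inF (x ++ B :: A :: y ++ z) by rewrite -(perm_all _ perm).
have uw' : size (x ++ B :: A :: y ++ z) <= w + w by rewrite -(perm_size perm).
have := IHy (rcons x B); rewrite !cat_rcons => /(_ uF' uw') <-.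
by split; apply: pv_rule1 => //; rewrite !catA; constructor.
Qed.

Lemma pv_mover (x y z : seq form) (A : form) (u : seq form) : inF (x ++ A :: y ++ z) -> inF u ->
  size (x ++ A :: y ++ z) <= w + w -> size u <= w + w ->
  pv G D u (x ++ A :: y ++ z) <-> pv G D u (x ++ y ++ A :: z).
Proof.
move=> vF uF vw uw; elim: y x vF vw => [|B y IHy] x vF vw //.
have perm : perm_eq (x ++ A :: B :: y ++ z) (x ++ B :: A :: y ++ z).
  by rewrite perm_cat2l -[A :: B :: _]/([:: A; B] ++ _) -[B :: A :: _]/([:: B; A] ++ _)
     perm_cat2r -[[:: A; B]]/([:: A] ++ [:: B]) perm_catC.
have vF' : inF (x ++ B :: A :: y ++ z) by rewrite -(perm_all _ perm).
have vw' : size (x ++ B :: A :: y ++ z) <= w + w by rewrite -(perm_size perm).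
have := IHy (rcons x B); rewrite !cat_rcons => /(_ vF' vw') <-.
by split; apply: pv_rule1 => //; rewrite !catA; constructor.
Qed.

Lemma pv_perml (x u u' v : seq form) : inF (x ++ u) -> inF v -> size (x ++ u) <= w + w ->
  size v <= w + w -> perm_eq u u' -> pv G D (x ++ u) v -> pv G D (x ++ u') v.
Proof.
move=> + vF + vw; elim: u' x u => [|A u' IHu] x u uF uw.
  by move/perm_nilP->.
move=> pu; have: A \in u by rewrite (perm_mem pu) mem_head.
move=> Au; case/splitPr: Au uF uw pu => y z uF uw pu.
have perm : perm_eq (x ++ y ++ A :: z) (x ++ A :: y ++ z).
  by rewrite perm_cat2l -[A :: z]cat1s -[A :: y ++ z]cat1s perm_catCA.
have uF' : inF (x ++ A :: y ++ z) by rewrite -(perm_all _ perm).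
have uw' : size (x ++ A :: y ++ z) <= w + w by rewrite -(perm_size perm).
move/pv_movel => /(_ uF' vF uw' vw); rewrite -!cat_rcons; apply: IHu.
- by rewrite cat_rcons.
- by rewrite cat_rcons.
move: pu; rewrite perm_sym -[A :: z]cat1s => /perm_trans/(_ (introT permPl (perm_catCA _ _ _))).
by rewrite /= perm_cons perm_sym.
Qed.

Lemma pv_weakl (t u v : seq form) : inF (u ++ t) -> inF v -> size (u ++ t) <= w + w ->
  size v <= w + w -> pv G D u v -> pv G D (u ++ t) v.
Proof.
move=> + vF + vw; elim/last_ind: t => [|t A IHt] uF uw p; first by rewrite cats0.
have [uF' uw'] : inF (u ++ t) /\ size (u ++ t) <= w + w.
  move: uF uw; rewrite !all_cat all_rcons !size_cat size_rcons.
  by rewrite addnS => /and3P[-> _ ->] /ltnW.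
have := IHt uF' uw' p; apply: pv_rule1 => //.
by rewrite -!rcons_cat; constructor.
Qed.

Lemma pv_contrl (t u v : seq form) : inF u -> inF v -> size (u ++ t) <= w + w ->
  size v <= w + w -> {subset t <= u} -> pv G D (u ++ t) v -> pv G D u v.
Proof.
move=> uF vF + vw; elim/last_ind: t => [|t A IHt] uw tu p; first by rewrite cats0 in p.
have tu' : {subset t <= u} by move=> B Bt; apply: tu; rewrite mem_rcons inE Bt orbT.
have uw' : size (u ++ t) <= w + w.
  by move: uw; rewrite !size_cat size_rcons addnS => /ltnW.
have tF : inF t by apply/allP => B /tu'/(allP uF).
have /(allP uF) AF : A \in u by apply: tu; rewrite mem_rcons mem_head.
have: A \in u by apply: tu; rewrite mem_rcons mem_head.
move=> Au; apply: IHt => //; move: p uF uw uw' {tu tu'}; case/splitPr: Au => y z p uF uw uw'.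
have p1 : perm_eq ((y ++ A :: z) ++ t) (rcons (y ++ z ++ t) A).
  by apply/permP => a; rewrite -cats1 !count_cat /=; lia.
have p2 : perm_eq ((y ++ A :: z) ++ rcons t A) (rcons (rcons (y ++ z ++ t) A) A).
  by apply/permP => a; rewrite -!cats1 !count_cat /=; lia.
have uF2 : inF ((y ++ A :: z) ++ rcons t A) by rewrite all_cat uF all_rcons AF tF.
have uF1 : inF ((y ++ A :: z) ++ t) by rewrite all_cat uF tF.
apply: (@pv_perml [::] (rcons (y ++ z ++ t) A)) => //=.
- by rewrite -(perm_all _ p1).
- by rewrite -(perm_size p1).
- by rewrite perm_sym.
have : pv G D (rcons (rcons (y ++ z ++ t) A) A) v.
  exact: (@pv_perml [::] _ _ v uF2 vF uw vw p2 p).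
apply: pv_rule1 => //; rewrite -?(perm_all _ p1) -?(perm_size p1) //.
by rewrite -!rcons_cat; constructor.
Qed.

(** The detour through the concatenation of [u] and [u'], by weakening and then contraction, needs
    room for [w + w] formulas. This is why the candidates are twice as wide as the entailments they
    serve. *)
Lemma pv_subl (u u' v : seq form) : inF u -> inF u' -> inF v -> size u <= w -> size u' <= w ->
  size v <= w + w -> {subset u <= u'} -> pv G D u v -> pv G D u' v.
Proof.
move=> uF uF' vF uw uw' vw uu' p; apply: (@pv_contrl u) => //.
  by rewrite size_cat leq_add.
apply: (@pv_perml [::] (u ++ u')) => //=; rewrite ?all_cat ?uF ?size_cat ?leq_add //.
  by rewrite perm_catC.
by apply: pv_weakl; rewrite ?all_cat ?uF ?size_cat ?leq_add.
Qed.

Lemma pv_permr (x u u' v : seq form) : inF (x ++ u) -> inF v -> size (x ++ u) <= w + w ->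
  size v <= w + w -> perm_eq u u' -> pv G D v (x ++ u) -> pv G D v (x ++ u').
Proof.
move=> + vF + vw; elim: u' x u => [|A u' IHu] x u uF uw.
  by move/perm_nilP->.
move=> pu; have: A \in u by rewrite (perm_mem pu) mem_head.
move=> Au; case/splitPr: Au uF uw pu => y z uF uw pu.
have perm : perm_eq (x ++ y ++ A :: z) (x ++ A :: y ++ z).
  by rewrite perm_cat2l -[A :: z]cat1s -[A :: y ++ z]cat1s perm_catCA.
have uF' : inF (x ++ A :: y ++ z) by rewrite -(perm_all _ perm).
have uw' : size (x ++ A :: y ++ z) <= w + w by rewrite -(perm_size perm).
move/pv_mover => /(_ uF' vF uw' vw); rewrite -!cat_rcons; apply: IHu.
- by rewrite cat_rcons.
- by rewrite cat_rcons.
move: pu; rewrite perm_sym -[A :: z]cat1s => /perm_trans/(_ (introT permPl (perm_catCA _ _ _))).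
by rewrite /= perm_cons perm_sym.
Qed.

Lemma pv_weakr (t u v : seq form) : inF (u ++ t) -> inF v -> size (u ++ t) <= w + w ->
  size v <= w + w -> pv G D v u -> pv G D v (u ++ t).
Proof.
move=> + vF + vw; elim/last_ind: t => [|t A IHt] uF uw p; first by rewrite cats0.
have [uF' uw'] : inF (u ++ t) /\ size (u ++ t) <= w + w.
  move: uF uw; rewrite !all_cat all_rcons !size_cat size_rcons.
  by rewrite addnS => /and3P[-> _ ->] /ltnW.
have := IHt uF' uw' p; apply: pv_rule1 => //.
by rewrite -!rcons_cat; constructor.
Qed.

Lemma pv_contrr (t u v : seq form) : inF u -> inF v -> size (u ++ t) <= w + w ->
  size v <= w + w -> {subset t <= u} -> pv G D v (u ++ t) -> pv G D v u.
Proof.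
move=> uF vF + vw; elim/last_ind: t => [|t A IHt] uw tu p; first by rewrite cats0 in p.
have tu' : {subset t <= u} by move=> B Bt; apply: tu; rewrite mem_rcons inE Bt orbT.
have uw' : size (u ++ t) <= w + w.
  by move: uw; rewrite !size_cat size_rcons addnS => /ltnW.
have tF : inF t by apply/allP => B /tu'/(allP uF).
have /(allP uF) AF : A \in u by apply: tu; rewrite mem_rcons mem_head.
have: A \in u by apply: tu; rewrite mem_rcons mem_head.
move=> Au; apply: IHt => //; move: p uF uw uw' {tu tu'}; case/splitPr: Au => y z p uF uw uw'.
have p1 : perm_eq ((y ++ A :: z) ++ t) (rcons (y ++ z ++ t) A).
  by apply/permP => a; rewrite -cats1 !count_cat /=; lia.
have p2 : perm_eq ((y ++ A :: z) ++ rcons t A) (rcons (rcons (y ++ z ++ t) A) A).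
  by apply/permP => a; rewrite -!cats1 !count_cat /=; lia.
have uF2 : inF ((y ++ A :: z) ++ rcons t A) by rewrite all_cat uF all_rcons AF tF.
have uF1 : inF ((y ++ A :: z) ++ t) by rewrite all_cat uF tF.
apply: (@pv_permr [::] (rcons (y ++ z ++ t) A)) => //=.
- by rewrite -(perm_all _ p1).
- by rewrite -(perm_size p1).
- by rewrite perm_sym.
have : pv G D v (rcons (rcons (y ++ z ++ t) A) A).
  exact: (@pv_permr [::] _ _ v uF2 vF uw vw p2 p).
apply: pv_rule1 => //; rewrite -?(perm_all _ p1) -?(perm_size p1) //.
by rewrite -!rcons_cat; constructor.
Qed.

Lemma pv_subr (u u' v : seq form) : inF u -> inF u' -> inF v -> size u <= w -> size u' <= w ->
  size v <= w + w -> {subset u <= u'} -> pv G D v u -> pv G D v u'.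
Proof.
move=> uF uF' vF uw uw' vw uu' p; apply: (@pv_contrr u) => //.
  by rewrite size_cat leq_add.
apply: (@pv_permr [::] (u ++ u')) => //=; rewrite ?all_cat ?uF ?size_cat ?leq_add //.
  by rewrite perm_catC.
by apply: pv_weakr; rewrite ?all_cat ?uF ?size_cat ?leq_add.
Qed.

End InContext.

Definition ent (G D u v : seq form) : Prop :=
  [/\ inF u, inF v, size u <= w, size v <= w & pv G D u v].

Section EntInContext.
Variables (G D : seq form).
Hypothesis GD : context G D.

Lemma ent_sub (u v u' v' : seq form) : ent G D u v -> {subset u <= u'} -> {subset v <= v'} ->
  inF u' -> inF v' -> size u' <= w -> size v' <= w -> ent G D u' v'.
Proof.
move=> [uF vF uw vw p] uu' vv' uF' vF' uw' vw'; split=> //.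
apply: (@pv_subr _ _ GD v v' u') => //; first exact: leq_trans uw' (leq_addr _ _).
by apply: (@pv_subl _ _ GD u u' v) => //; exact: leq_trans vw (leq_addr _ _).
Qed.

Lemma ent_rule2 (u v u1 v1 u2 v2 : seq form) :
  inF u -> inF v -> size u <= w -> size v <= w ->
  LNDT_rule [:: (G ++ u1, D ++ v1); (G ++ u2, D ++ v2)] (G ++ u, D ++ v) ->
  ent G D u1 v1 -> ent G D u2 v2 -> ent G D u v.
Proof.
move=> uF vF uw vw R [_ _ _ _ p1] [_ _ _ _ p2]; split=> //; apply: prv_rule R _.
  by apply: context_cand => //; exact: leq_trans (leq_addr _ _).
by move=> T; rewrite !inE => /orP[/eqP->|/eqP->].
Qed.

Lemma ent_cut (A : form) (u v : seq form) : A \in F -> size u < w -> size v < w ->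
  inF u -> inF v -> ent G D (A :: u) v -> ent G D u (A :: v) -> ent G D u v.
Proof.
move=> AF uw vw uF vF p1 p2.
apply: (@ent_rule2 u v u (rcons v A) (rcons u A) v) => //; try exact: ltnW.
- by rewrite -!rcons_cat; constructor.
- apply: ent_sub p2 _ _ _ _ _ _ => //; rewrite ?all_rcons ?AF ?size_rcons //; try exact: ltnW.
  by move=> B; rewrite mem_rcons.
- apply: ent_sub p1 _ _ _ _ _ _ => //; rewrite ?all_rcons ?AF ?size_rcons //; try exact: ltnW.
  by move=> B; rewrite mem_rcons.
Qed.

End EntInContext.

Hypothesis linesF : forall S, S \in lines -> inF S.1 && inF S.2.
Hypothesis w_ge : 8 <= w.

(** The facts about the counting program are derived once, without context. They carry over to any
    context because its formulas can be weakened in one at a time and exchanged to the front of the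
    word. *)
Lemma ent_lift (G D u v : seq form) : context G D -> ent [::] [::] u v -> ent G D u v.
Proof.
move=> + [uF vF uw vw p].
have szu A : size (u ++ [:: A]) <= w + w by rewrite size_cat /=; lia.
have szv A : size (v ++ [:: A]) <= w + w by rewrite size_cat /=; lia.
have w2 : w <= w + w by rewrite leq_addr.
elim/last_ind: D => [|D A IHD] GD; last first.
  have GD' := context_prefixr GD; have [_ _ _ _ {}p] := IHD GD'.
  have AF : A \in F.
    have [S Sl [_ /mem_prefixes[x e]]] := GD; have /andP[_ /allP] := linesF Sl.
    by apply; rewrite e mem_cat mem_rcons mem_head.
  split=> //; rewrite /pv cat_rcons.
  have p1 := @pv_weakr _ _ GD' [:: A] v u; rewrite !all_cat /= vF AF in p1.
  have := p1 isT uF (szv A) (leq_trans uw w2) p.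
  have := @pv_mover _ _ GD' [::] v [::] A u; rewrite cats0 /= vF AF => h.
  by apply: (proj2 (h _ _ _ _)) => //=; [lia|exact: leq_trans w2].
elim/last_ind: G GD => [|G A IHG] GD //.
have GD' := context_prefix GD; have [_ _ _ _ {}p] := IHG GD'.
have AF : A \in F.
  have [S Sl [/mem_prefixes[x e] _]] := GD; have /andP[/allP + _] := linesF Sl.
  by apply; rewrite e mem_cat mem_rcons mem_head.
split=> //; rewrite /pv cat_rcons.
have p1 := @pv_weakl _ _ GD' [:: A] u v; rewrite !all_cat /= uF AF in p1.
have := p1 isT vF (szu A) (leq_trans vw w2) p.
have := @pv_movel _ _ GD' [::] u [::] A v; rewrite cats0 /= uF AF => h.
by apply: (proj2 (h _ _ _ _)) => //=; [lia|exact: leq_trans w2].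
Qed.

Lemma context_nil (G D : seq form) : context G D -> context [::] [::].
Proof.
move=> [S Sl _]; exists S => //.
by split; apply/mem_prefixes; [exists S.1|exists S.2].
Qed.

Lemma ent_hyp (u v : seq form) : context [::] [::] -> (u, v) \in hyps -> inF u -> inF v ->
  size u <= w -> size v <= w -> ent [::] [::] u v.
Proof.
move=> GD h uF vF uw vw; split=> //; apply: prv_hyp => //.
by apply: (@context_cand [::] [::]) => //; exact: leq_trans (leq_addr _ _).
Qed.

Lemma ent_axiom (u v : seq form) : context [::] [::] -> LNDT_rule [::] (u, v) -> inF u -> inF v ->
  size u <= w -> size v <= w -> ent [::] [::] u v.
Proof.
move=> GD R uF vF uw vw; split=> //; apply: prv_rule R _ => //.
by apply: (@context_cand [::] [::]) => //; exact: leq_trans (leq_addr _ _).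
Qed.

Lemma ent_id (G D : seq form) (A : form) (u v : seq form) : context G D -> A \in u -> A \in v -> inF u -> inF v ->
  size u <= w -> size v <= w -> ent G D u v.
Proof.
move=> GD Au Av uF vF uw vw.
have AF : A \in F by apply: (allP uF).
have AA : ent G D [:: A] [:: A].
  apply: ent_lift => //; apply: ent_axiom; rewrite ?(context_nil GD) //=; rewrite ?AF //; try lia.
  - exact: context_nil GD.
  - by constructor.
by apply: ent_sub AA _ _ _ _ _ _ => // B; rewrite inE => /eqP->.
Qed.

(** * Propositional entailment from derived sequents *)

Inductive known (G D : seq form) : seq (seq form * seq form) -> Prop :=
| known_nil : known G D [::]
| known_cons u v Ks : ent G D u v -> known G D Ks -> known G D ((u, v) :: Ks).

Lemma known_mem G D Ks K : known G D Ks -> K \in Ks -> ent G D K.1 K.2.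
Proof. by elim=> // u v Ks' p _ IH; rewrite inE => /predU1P[->|/IH]. Qed.

Definition atoms (Ks : seq (seq form * seq form)) : seq form :=
  flatmap (fun K => K.1 ++ K.2) Ks.

(* Cutting on all formulas that occur reduces a propositional consequence to sequents
   that contain an instance of identity or one of the known sequents. *)
Lemma ent_sem (G D : seq form) Ks (u v : seq form) : context G D -> known G D Ks -> inF u -> inF v ->
  size (atoms Ks) + size u + size v < w ->
  (forall val : pred form,
    all (fun K => all val K.1 ==> has val K.2) Ks -> all val u -> has val v) ->
  ent G D u v.
Proof.
move=> GD KP uF vF sz sem.
have aF : inF (atoms Ks).
  apply/allP => A /flatmapP[K /(known_mem KP)[K1 K2 _ _ _]].
  by rewrite mem_cat => /orP[]; apply/allP.
(* [T] and [N] hold the formulas assumed true and false so far, [r] the atoms still to be cut on. *)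
have split (r T N : seq form) : inF r -> inF T -> inF N -> {subset u <= T} -> {subset v <= N} ->
    (forall A, A \in atoms Ks -> [|| A \in T, A \in N | A \in r]) ->
    size T + size N + size r < w -> ent G D T N.
  elim: r T N => [|A r IHr] T N /=.
    move=> _ TF NF uT vN atTN szTN.
    have [/hasP[A AT AN]|dis] := boolP (has (fun A => A \in N) T).
      by apply: (ent_id GD AT AN) => //; lia.
    (* All atoms are decided, and [T] is read as a valuation. If it satisfies the known sequents,
       [sem] contradicts the disjointness of [T] and [N]; otherwise a falsified known sequent
       weakens to the goal. *)
    have [Ksat|/allPn[K KKs]] := boolP (all (fun K => all (fun A => A \in T) K.1 ==>
        has (fun A => A \in T) K.2) Ks).
      have /hasP[A Av AT] : has (fun A => A \in T) v by apply: sem => //; apply/allP.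
      by case/hasP: dis; exists A => //; apply: vN.
    rewrite negb_imply => /andP[/allP K1 K2]; have Kp := known_mem KP KKs.
    apply: (ent_sub GD Kp) => //; try lia.
    move=> A AK; have := atTN A; rewrite orbF => /(_ _)/orP[].
    - by apply/flatmapP; exists K => //; rewrite mem_cat AK orbT.
    - by move=> AT; case/hasP: K2; exists A.
    by [].
  case/andP=> AF rF TF NF uT vN atTN szTN.
  apply: (@ent_cut _ _ GD A) => //; try lia.
    apply: IHr => //=; rewrite ?AF //; last by lia.
      by move=> B /uT; rewrite inE orbC => ->.
    by move=> B /atTN; rewrite !inE => /or4P[] ->; rewrite ?orbT.
  apply: IHr => //=; rewrite ?AF //; last by lia.
    by move=> B /vN; rewrite inE orbC => ->.
  by move=> B /atTN; rewrite !inE => /or4P[] ->; rewrite ?orbT.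
apply: (split (atoms Ks)) => //; last by lia.
by move=> A ->; rewrite !orbT.
Qed.

(** * The logical rules as sequents *)

Section Connectives.
Hypothesis GD : context [::] [::].

Local Ltac ent_side := rewrite ?inE ?eqxx ?orbT //=;
  repeat match goal with H : is_true (_ \in F) |- _ => rewrite H {H} end => //; try lia.

Local Ltac ent_ident A := apply: (@ent_id _ _ A) => //; ent_side.

Lemma ent_zero : Zero \in F -> ent [::] [::] [:: Zero] [::].
Proof. by move=> AF; apply: (ent_axiom GD r_zerol); ent_side. Qed.

Lemma ent_one : One \in F -> ent [::] [::] [::] [:: One].
Proof. by move=> AF; apply: (ent_axiom GD r_oner); ent_side. Qed.

Lemma ent_or (A : form) (B : form) : A \in F -> B \in F -> Or A B \in F ->
  [/\ ent [::] [::] [:: Or A B] [:: A; B], ent [::] [::] [:: A] [:: Or A B]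
    & ent [::] [::] [:: B] [:: Or A B]].
Proof.
move=> AF BF CF.
have orr C : C \in [:: A; B] -> ent [::] [::] [:: C] [:: Or A B].
  move=> CAB; have CF' : C \in F by move: CAB; rewrite !inE => /orP[/eqP->|/eqP->].
  have [_ _ _ _ p] : ent [::] [::] [:: C] [:: A; B].
    by apply: (@ent_id _ _ C) => //; ent_side.
  split; [by ent_side..|].
  apply: pv_rule1 p => //; try by ent_side.
  exact: (@r_orr [:: C] [::] A B).
split; try by apply: orr; ent_side.
apply: (@ent_rule2 _ _ GD _ _ [:: A] [:: A; B] [:: B] [:: A; B]); try by ent_side.
- exact: (@r_orl [::] [:: A; B] A B).
- ent_ident A.
- ent_ident B.
Qed.

Lemma ent_dec (A : form) p (B : form) : A \in F -> B \in F -> pvar p \in F -> Dec A p B \in F ->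
  [/\ ent [::] [::] [:: Dec A p B; pvar p] [:: B],
      ent [::] [::] [:: Dec A p B] [:: A; pvar p],
      ent [::] [::] [:: pvar p; B] [:: Dec A p B]
    & ent [::] [::] [:: A] [:: pvar p; Dec A p B]].
Proof.
move=> AF BF pF CF; split.
- have h : ent [::] [::] [:: pvar p; Dec A p B] [:: B].
    apply: (@ent_rule2 _ _ GD _ _ [:: pvar p; A] [:: B; pvar p]
      [:: pvar p; pvar p; B] [:: B]); try by ent_side.
    + exact: (@r_decl [:: pvar p] [:: B] A p B).
    + ent_ident (pvar p).
    + ent_ident B.
  apply: (ent_sub GD h) => //; try by ent_side.
  by move=> C; rewrite !inE orbC.
- apply: (@ent_rule2 _ _ GD _ _ [:: A] [:: A; pvar p; pvar p]
    [:: pvar p; B] [:: A; pvar p]); try by ent_side.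
  + exact: (@r_decl [::] [:: A; pvar p] A p B).
  + ent_ident A.
  + ent_ident (pvar p).
- apply: (@ent_rule2 _ _ GD _ _ [:: pvar p; B] [:: A; pvar p]
    [:: pvar p; B; pvar p] [:: B]); try by ent_side.
  + exact: (@r_decr [:: pvar p; B] [::] A p B).
  + ent_ident (pvar p).
  + ent_ident B.
apply: (@ent_rule2 _ _ GD _ _ [:: A] [:: pvar p; A; pvar p]
  [:: A; pvar p] [:: pvar p; B]); try by ent_side.
- exact: (@r_decr [:: A] [:: pvar p] A p B).
- ent_ident A.
- ent_ident (pvar p).
Qed.

End Connectives.
End Calculus.

(** * Inductive counting *)

(* Let [L] list the relevant formulas, each before the ones it is built from, and call
   [P] refuted if its dual is true. Suffixes of [L] play the role of numbers, through
   their sizes. The extension variables stand for: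
   - [NC k c]: exactly [c] members of [k] are refuted;
   - [NT k c A B m a]: [NC k c], and at least [a] members of [m] other than [A], [B]
     are refuted;
   - [NW P n]: [P] is refuted and [n] holds;
   - [ND k c]: [NC k c'] for some [c' <= c];
   - [NH P c]: [NT L c' P P L c'] for some [c' <= c], so that [NH P L] amounts to [P];
   - [NX i]: the extension variable [x_i]. *)
Inductive name : Type :=
| NC of seq form & seq form
| NT of seq form & seq form & form & form & seq form & seq form
| NW of form & name
| ND of seq form & seq form
| NH of form & seq form
| NX of nat.

Definition name_eq_dec : comparable name.
Proof.
move=> m n; rewrite /decidable; decide equality; try exact: form_eq_dec;
  try exact: PeanoNat.Nat.eq_dec; decide equality; exact: form_eq_dec.
Defined.

HB.instance Definition _ := hasDecEq.Build name (compareP name_eq_dec).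

Fixpoint subs (A : form) : seq form :=
  A :: match A with
       | Dec B _ C | Or B C | And B C => subs B ++ subs C
       | _ => [::]
       end.

Fixpoint number_from (T : Type) (i : nat) (s : seq T) : seq (nat * T) :=
  if s is a :: s' then (i, a) :: number_from i.+1 s' else [::].

Definition lookup (K : eqType) (V : Type) (d : V) (s : seq (K * V)) (k : K) : V :=
  head d [seq x.2 | x <- s & x.1 == k].

(* Unfolds [u_i <-> U_i] to the equivalent [U_i /\ U_i]; a variable without an axiom is
   read as [0]. *)
Definition view (ua : seq (nat * form)) (P : form) : form :=
  if P is Uvar i then lookup Zero [seq (x.1, And x.2 x.2) | x <- ua] i else P.

Definition ev (nm : seq (name * nat)) (n : name) : form := Evar (lookup 0 nm n).

(** Decisions between co-eNDT formulas are also translated structurally, for the sake of the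
    decision rules; [star_complement] reconciles this with the counting program. [Evar] does not
    belong to the formulas being translated and receives a default value. *)
Fixpoint star (nm : seq (name * nat)) (L : seq form) (P : form) : form :=
  match P with
  | Zero => Zero
  | One => One
  | Dec A p B => Dec (star nm L A) p (star nm L B)
  | Or A B => Or (star nm L A) (star nm L B)
  | And _ _ | Uvar _ => ev nm (NH P L)
  | Xvar i => ev nm (NX i)
  | Evar _ => Zero
  end.

(** * Right-hand sides of the extension axioms *)

Section Definitions.
Variables (ua xa : seq (nat * form)) (L : seq form) (nm : seq (name * nat)).

Local Notation e := (ev nm).

(** This is the dual of [P] with [n] plugged in at the accepting leaves: 0 becomes [n], 1 becomes 0,
    and a conjunction becomes a disjunction. It expresses a conjunction with [n] in a language
    without conjunction. The remaining shapes, which are not co-eNDT, simply count as never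
    refuted. *)
Definition rhs_W (P : form) (n : name) : form :=
  match view ua P with
  | Zero => e n
  | Dec A p B => Dec (e (NW A n)) p (e (NW B n))
  | And A B => Or (e (NW A n)) (e (NW B n))
  | _ => Zero
  end.

(** The counting step. If exactly [c] members of [k] are refuted and that many can be guessed while
    avoiding [A] and [B], then neither [A] nor [B] is refuted. A conjunction needs both constituents
    unrefuted, hence two excluded formulas; a decision needs one per branch, which is listed
    twice. *)
Definition unrefuted (P : form) (k c : seq form) : form :=
  match view ua P with
  | Zero => Zero
  | Dec A p B => Dec (e (NT k c A A k c)) p (e (NT k c B B k c))
  | And A B => e (NT k c A B k c)
  | _ => e (NC k c)
  end.

Definition rhs_C (k c : seq form) : form :=
  if k is P :: k' then
    Or (unrefuted P k' c) (if c is _ :: c' then e (NW P (NC k' c')) else Zero)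
  else if c is [::] then One else Zero.

(** The program scans [m] and guesses which members to count. A refuted member may be passed over,
    so only a lower bound is certified. A successful scan ends in [NC k c], which certifies the
    total. *)
Definition rhs_T (k c : seq form) (A B : form) (m a : seq form) : form :=
  if m is P :: m' then
    if (P == A) || (P == B) then e (NT k c A B m' a)
    else Or (e (NT k c A B m' a))
            (if a is _ :: a' then e (NW P (NT k c A B m' a')) else Zero)
  else if a is [::] then e (NC k c) else Zero.

Definition rhs_D (k c : seq form) : form :=
  if c is _ :: c' then Or (e (ND k c')) (e (NC k c)) else e (NC k c).

Definition rhs_H (P : form) (c : seq form) : form :=
  if c is _ :: c' then Or (e (NH P c')) (e (NT L c P P L c)) else e (NT L c P P L c).

Definition rhs (n : name) : form :=
  match n with
  | NC k c => rhs_C k c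
  | NT k c A B m a => rhs_T k c A B m a
  | NW P n => rhs_W P n
  | ND k c => rhs_D k c
  | NH P c => rhs_H P c
  | NX i => star nm L (lookup Zero xa i)
  end.

End Definitions.

(** The position of a name in the final list becomes the index of its extension variable, so a name
    must come after those in its right-hand side. Hence the reversals: later members of [L] and
    shorter suffixes come first. *)
Definition with_W (L : seq form) (n : name) : seq name := n :: [seq NW P n | P <- rev L].

Definition names_T (L k c : seq form) (A B : form) : seq name :=
  flatmap (fun m => flatmap (fun a => with_W L (NT k c A B m a)) (tails L)) (rev (tails L)).

Definition names_k (L k : seq form) : seq name :=
  flatmap (fun c => with_W L (NC k c)) (tails L) ++
  flatmap (fun c => flatmap (fun A => flatmap (fun B => names_T L k c A B) L) L) (tails L).

Definition names_DH (L : seq form) : seq name :=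
  flatmap (fun k => map (ND k) (rev (tails L))) (tails L) ++
  flatmap (fun P => map (NH P) (rev (tails L))) L.

Definition names (L : seq form) (xa : seq (nat * form)) : seq name :=
  flatmap (names_k L) (rev (tails L)) ++ (names_DH L ++ [seq NX x.1 | x <- xa]).

Section Membership.
Variables (L : seq form) (xa : seq (nat * form)).

Local Notation suffix k := (k \in tails L).

Lemma names_main k : suffix k -> {subset names_k L k <= names L xa}.
Proof.
move=> kL n nk; rewrite /names mem_cat; apply/orP; left; apply/flatmapP.
by exists k; rewrite ?mem_rev.
Qed.

Lemma with_W_self n : n \in with_W L n.
Proof. exact: mem_head. Qed.

Lemma with_W_W P n : P \in L -> NW P n \in with_W L n.
Proof. by move=> PL; rewrite inE map_f ?orbT // mem_rev. Qed.

Lemma names_with_C k c : suffix k -> suffix c -> {subset with_W L (NC k c) <= names L xa}.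
Proof.
move=> kL cL n nk; apply: (names_main kL); rewrite mem_cat; apply/orP; left.
by apply/flatmapP; exists c.
Qed.

Lemma names_with_T k c A B m a : suffix k -> suffix c -> A \in L -> B \in L ->
  suffix m -> suffix a -> {subset with_W L (NT k c A B m a) <= names L xa}.
Proof.
move=> kL cL AL BL mL aL n nk; apply: (names_main kL); rewrite mem_cat; apply/orP; right.
apply/flatmapP; exists c => //; apply/flatmapP; exists A => //; apply/flatmapP; exists B => //.
by apply/flatmapP; exists m; rewrite ?mem_rev //; apply/flatmapP; exists a.
Qed.

Lemma names_D k c : suffix k -> suffix c -> ND k c \in names L xa.
Proof.
move=> kL cL; rewrite /names /names_DH !mem_cat.
apply/orP; right; apply/orP; left; apply/orP; left; apply/flatmapP; exists k => //.
by apply: map_f; rewrite mem_rev.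
Qed.

Lemma names_H P c : P \in L -> suffix c -> NH P c \in names L xa.
Proof.
move=> PL cL; rewrite /names /names_DH !mem_cat.
apply/orP; right; apply/orP; left; apply/orP; right; apply/flatmapP; exists P => //.
by apply: map_f; rewrite mem_rev.
Qed.

End Membership.

(** * Provability of the counting argument *)

Section Counting.
Variables (ua xa : seq (nat * form)) (L : seq form) (nm : seq (name * nat)).
Variables (hyps : seq sequent) (F : seq form) (lines : seq sequent) (w : nat).

Local Notation inF := (all (fun A => A \in F)).
Local Notation e := (ev nm).
Local Notation rhs := (rhs ua xa L nm).
Local Notation names := (names L xa).
Local Notation view := (view ua).
Local Notation suffix k := (k \in tails L).
Local Notation "u |= v" := (ent hyps F lines w [::] [::] u v)
  (at level 70, no associativity).

Hypothesis linesF : forall S, S \in lines -> inF S.1 && inF S.2.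
(** Each use of [ent_sem] below involves fewer than 60 formula occurrences, independently of the
    length of [L]. *)
Hypothesis w_ge : 60 <= w.
Hypothesis ctx : context lines [::] [::].
Hypothesis F_zero : Zero \in F.
Hypothesis F_one : One \in F.
Hypothesis F_or : forall A B, Or A B \in F -> A \in F /\ B \in F.
Hypothesis F_dec : forall A p B, Dec A p B \in F -> [/\ A \in F, B \in F & pvar p \in F].
Hypothesis F_ev : forall n, e n \in F.
Hypothesis F_rhs : forall n, n \in names -> rhs n \in F.
Hypothesis hypsP : forall n, n \in names ->
  ([:: e n], [:: rhs n]) \in hyps /\ ([:: rhs n], [:: e n]) \in hyps.
(** The topological order: each occurrence in [L] has its constituents among the members after it,
    which supports the inductions on suffixes. *)
Hypothesis view_closed : forall u P k, L = u ++ P :: k ->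
  match view P with
  | Dec A _ B | And A B => A \in k /\ B \in k
  | _ => True
  end.

Let w8 : 8 <= w.
Proof. exact: leq_trans w_ge. Qed.

Ltac inF_tac := rewrite /= ?F_ev ?F_zero ?F_one;
  repeat match goal with H : is_true (_ \in F) |- _ => rewrite H end; done.

Ltac sem_tac ks := apply: (ent_sem linesF w8 ctx ks);
  [inF_tac|inF_tac|by rewrite /atoms /flatmap /=; apply: leq_trans w_ge
  |by move=> val /=; repeat (case: (val _) => //=)].

Local Notation "[ 'kn' x ; .. ; y ]" :=
  (known_cons x .. (known_cons y (known_nil _ _ _ _ _ _)) ..).

(** * Refutation of a node and its composition with a name *)

Lemma def_eq n : n \in names -> [:: e n] |= [:: rhs n] /\ [:: rhs n] |= [:: e n].
Proof.
move=> nn; have [h1 h2] := hypsP nn; have rF := F_rhs nn.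
by split; apply: (ent_hyp ctx) => //; try inF_tac; exact: leq_trans w8.
Qed.

Lemma def_zero n : n \in names -> rhs n = Zero -> [:: e n] |= [::].
Proof.
move=> nn E; have [+ _] := def_eq nn; rewrite E => h.
have z := ent_zero hyps w8 ctx F_zero.
sem_tac [kn h; z].
Qed.

Lemma def_one n : n \in names -> rhs n = One -> [::] |= [:: e n].
Proof.
move=> nn E; have [_ +] := def_eq nn; rewrite E => h.
have z := ent_one hyps w8 ctx F_one.
sem_tac [kn h; z].
Qed.

Lemma def_or n A B : n \in names -> rhs n = Or A B ->
  [/\ A \in F, B \in F, [:: e n] |= [:: A; B], [:: A] |= [:: e n] & [:: B] |= [:: e n]].
Proof.
move=> nn E; have := F_rhs nn; have [] := def_eq nn; rewrite E => h1 h2 CF.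
have [AF BF] := F_or CF; have [o1 o2 o3] := ent_or hyps linesF w8 ctx AF BF CF.
split=> //.
- sem_tac [kn h1; o1].
- sem_tac [kn h2; o2].
- sem_tac [kn h2; o3].
Qed.

Lemma def_dec n A p B : n \in names -> rhs n = Dec A p B ->
  [/\ pvar p \in F, [:: e n; pvar p] |= [:: B], [:: e n] |= [:: A; pvar p],
    [:: pvar p; B] |= [:: e n] & [:: A] |= [:: pvar p; e n]].
Proof.
move=> nn E; have := F_rhs nn; have [] := def_eq nn; rewrite E => h1 h2 CF.
have [AF BF pF] := F_dec CF; have [d1 d2 d3 d4] := ent_dec hyps linesF w8 ctx AF BF pF CF.
split=> //.
- sem_tac [kn h1; d1].
- sem_tac [kn h1; d2].
- sem_tac [kn h2; d3].
- sem_tac [kn h2; d4].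
Qed.

Lemma suffix_behead P k : suffix (P :: k) -> suffix k.
Proof. by move=> /mem_tails[u e]; apply/mem_tails; exists (rcons u P); rewrite cat_rcons. Qed.

Lemma suffix_mem k P : suffix k -> P \in k -> P \in L.
Proof. by move=> /mem_tails[u ->] Pk; rewrite mem_cat Pk orbT. Qed.

Lemma suffix_nil : suffix [::].
Proof. by apply/mem_tails; exists L; rewrite cats0. Qed.

Lemma suffix_self : suffix L.
Proof. by apply/mem_tails; exists [::]. Qed.

Hint Resolve suffix_nil suffix_self : core.

Definition main_name (n : name) : Prop := {subset with_W L n <= names}.

Lemma main_name_in n : main_name n -> n \in names.
Proof. by apply; apply: with_W_self. Qed.

Lemma main_name_W n P : main_name n -> P \in L -> NW P n \in names.
Proof. by move=> mn PL; apply/mn/with_W_W. Qed.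

Lemma main_C k c : suffix k -> suffix c -> main_name (NC k c).
Proof. exact: names_with_C. Qed.

Lemma main_T k c A B m a : suffix k -> suffix c -> A \in L -> B \in L -> suffix m ->
  suffix a -> main_name (NT k c A B m a).
Proof. exact: names_with_T. Qed.

(** The name [NC [::] [::]] is defined as 1, so plugging it in yields the dual of [P] itself. *)
Definition refuted (P : form) : form := e (NW P (NC [::] [::])).

Lemma truth : [::] |= [:: e (NC [::] [::])].
Proof. by apply: def_one => //; apply/main_name_in/main_C. Qed.

(** Together the three sequents say that [NW P n] is the conjunction of [refuted P] and [n]. Both
    sides unfold in the same way along [view P], whose constituents lie in a shorter suffix. *)
Lemma W_facts k : suffix k -> forall P n, P \in k -> main_name n ->
  [/\ [:: e (NW P n)] |= [:: e n], [:: e (NW P n)] |= [:: refuted P]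
    & [:: refuted P; e n] |= [:: e (NW P n)]].
Proof.
elim: k => // P k IHk PkL Q n; rewrite inE => /predU1P[->{Q}|]; last first.
  by move=> Qk; apply: IHk => //; apply: suffix_behead PkL.
move=> mn; have kL := suffix_behead PkL; have PL := suffix_mem PkL (mem_head _ _).
have m0 : main_name (NC [::] [::]) by apply: main_C.
have nW := main_name_W mn PL; have nV := main_name_W m0 PL.
have /mem_tails[u eL] := PkL; have := view_closed eL.
have := truth; rewrite /refuted => tr.
case E: (view P) => [||A p B|A B|A B|i|i|i].
- move=> _; have [] := def_eq nW; have [] := def_eq nV.
  rewrite /= /rhs_W E => g1 g2 h1 h2; split=> //.
  + sem_tac [kn g2; tr].
  + sem_tac [kn h2].
- move=> _; have h := def_zero nW; have g := def_zero nV.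
  rewrite /= /rhs_W E in h g; move: (h erefl) (g erefl) => {}h {}g.
  by split; [sem_tac [kn h]|sem_tac [kn h]|sem_tac [kn g]].
- case=> Ak Bk; have [|pF a1 a2 a3 a4] := @def_dec _ (e (NW A n)) p (e (NW B n)) nW.
    by rewrite /= /rhs_W E.
  have [|_ b1 b2 b3 b4] := @def_dec _ (refuted A) p (refuted B) nV.
    by rewrite /= /rhs_W E.
  have [A1 A2 A3] := IHk kL A n Ak mn; have [B1 B2 B3] := IHk kL B n Bk mn.
  rewrite /refuted in b1 b2 b3 b4 A2 A3 B2 B3.
  split.
  + sem_tac [kn a1; a2; A1; B1].
  + sem_tac [kn a1; a2; A2; B2; b3; b4].
  + sem_tac [kn b1; b2; A3; B3; a3; a4].
- move=> _; have h := def_zero nW; have g := def_zero nV.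
  rewrite /= /rhs_W E in h g; move: (h erefl) (g erefl) => {}h {}g.
  by split; [sem_tac [kn h]|sem_tac [kn h]|sem_tac [kn g]].
- case=> Ak Bk; have [|_ _ a1 a2 a3] := @def_or _ (e (NW A n)) (e (NW B n)) nW.
    by rewrite /= /rhs_W E.
  have [|_ _ b1 b2 b3] := @def_or _ (refuted A) (refuted B) nV.
    by rewrite /= /rhs_W E.
  have [A1 A2 A3] := IHk kL A n Ak mn; have [B1 B2 B3] := IHk kL B n Bk mn.
  rewrite /refuted in b1 b2 b3 A2 A3 B2 B3.
  split.
  + sem_tac [kn a1; A1; B1].
  + sem_tac [kn a1; A2; B2; b2; b3].
  + sem_tac [kn b1; A3; B3; a2; a3].
all: move=> _; have h := def_zero nW; have g := def_zero nV;
  rewrite /= /rhs_W E in h g; move: (h erefl) (g erefl) => {}h {}g;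
  by split; [sem_tac [kn h]|sem_tac [kn h]|sem_tac [kn g]].
Qed.

Lemma F_refuted P : refuted P \in F.
Proof. exact: F_ev. Qed.

(** How the exact count changes when [P] is put in front of [k]: it grows by one if [P] is refuted
    and is unchanged otherwise. The first three sequents read this from [P :: k] down to [k], and
    the last provides a count for [P :: k]. *)
Definition count_step (P : form) (k : seq form) : Prop :=
  [/\ forall x c, suffix (x :: c) -> [:: e (NC (P :: k) (x :: c)); refuted P] |= [:: e (NC k c)],
      [:: e (NC (P :: k) [::]); refuted P] |= [::],
      forall c, suffix c -> [:: e (NC (P :: k) c)] |= [:: e (NC k c); refuted P]
    & forall x c, suffix (x :: c) ->
        [:: e (NC k c)] |= [:: e (NC (P :: k) c); e (NC (P :: k) (x :: c))]].

(** * Guessing refuted members while avoiding two formulas *)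

Section Threshold.
Variables (k c : seq form) (A B : form).
Hypotheses (kL : suffix k) (cL : suffix c) (AL : A \in L) (BL : B \in L).
(** Only the members of [k] are covered, so that the results on thresholds over [k] can be used to
    establish the step for a further member in front of [k]. *)
Hypothesis steps : forall u P m, k = u ++ P :: m -> count_step P m.

Local Notation t m a := (NT k c A B m a).

Lemma suffix_trans u m : k = u ++ m -> suffix m.
Proof. by case/mem_tails: kL => v -> ->; apply/mem_tails; exists (v ++ u); rewrite catA. Qed.

Lemma T_nil : [:: e (t [::] [::])] |= [:: e (NC k c)] /\ [:: e (NC k c)] |= [:: e (t [::] [::])].
Proof. by have := @def_eq (t [::] [::]); apply; apply/main_name_in/main_T. Qed.

Lemma T_nil_cons x a : suffix (x :: a) -> [:: e (t [::] (x :: a))] |= [::].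
Proof. by move=> aL; apply: def_zero => //; apply/main_name_in/main_T. Qed.

Section Cons.
Variables (P : form) (m : seq form).
Hypothesis PmL : suffix (P :: m).

Let mL := suffix_behead PmL.

Lemma T_cons_mono a : suffix a -> [:: e (t m a)] |= [:: e (t (P :: m) a)].
Proof.
move=> aL; have tn : t (P :: m) a \in names by apply/main_name_in/main_T.
case E: ((P == A) || (P == B)).
  by have [_] := def_eq tn; rewrite /= E.
have [|_ _ _ h _] // := @def_or _ (e (t m a))
  (if a is _ :: a' then e (NW P (t m a')) else Zero) tn.
by rewrite /= E.
Qed.

Lemma T_cons_excluded a : suffix a -> (P == A) || (P == B) ->
  [:: e (t (P :: m) a)] |= [:: e (t m a)].
Proof.
move=> aL E; have tn : t (P :: m) a \in names by apply/main_name_in/main_T.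
by have [] := def_eq tn; rewrite /= E.
Qed.

Lemma T_cons_zero : [:: e (t (P :: m) [::])] |= [:: e (t m [::])].
Proof.
case E: ((P == A) || (P == B)); first exact: T_cons_excluded.
have tn : t (P :: m) [::] \in names by apply/main_name_in/main_T.
have [|_ _ h _ _] // := @def_or _ (e (t m [::])) Zero tn; first by rewrite /= E.
have z := ent_zero hyps w8 ctx F_zero.
sem_tac [kn h; z].
Qed.

Lemma T_cons_inv x a : suffix (x :: a) ->
  [:: e (t (P :: m) (x :: a))] |= [:: e (t m (x :: a)); e (NW P (t m a))].
Proof.
move=> aL; case E: ((P == A) || (P == B)).
  have h := T_cons_excluded aL E; sem_tac [kn h].
have tn : t (P :: m) (x :: a) \in names by apply/main_name_in/main_T.
have [|_ _ h _ _] // := @def_or _ (e (t m (x :: a))) (e (NW P (t m a))) tn.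
by rewrite /= E.
Qed.

Lemma T_cons_succ x a : suffix (x :: a) -> ~~ ((P == A) || (P == B)) ->
  [:: e (NW P (t m a))] |= [:: e (t (P :: m) (x :: a))].
Proof.
move=> aL /negbTE E.
have tn : t (P :: m) (x :: a) \in names by apply/main_name_in/main_T.
have [|_ _ _ _ h] // := @def_or _ (e (t m (x :: a))) (e (NW P (t m a))) tn.
by rewrite /= E.
Qed.

Lemma T_cons_W a : suffix a ->
  [/\ [:: e (NW P (t m a))] |= [:: e (t m a)], [:: e (NW P (t m a))] |= [:: refuted P]
    & [:: refuted P; e (t m a)] |= [:: e (NW P (t m a))]].
Proof. by move=> aL; apply: (W_facts PmL); rewrite ?mem_head //; apply: main_T. Qed.

End Cons.

Lemma T_count m a : suffix m -> suffix a -> [:: e (t m a)] |= [:: e (NC k c)].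
Proof.
elim: m a => [|P m IHm] [|x a] mL aL; try have mL' := suffix_behead mL.
- by case: T_nil.
- have h := T_nil_cons aL; sem_tac [kn h].
- have h := T_cons_zero mL; have h1 := IHm _ mL' aL; sem_tac [kn h; h1].
have aL' := suffix_behead aL.
have h := T_cons_inv mL aL; have h1 := IHm _ mL' aL; have h2 := IHm _ mL' aL'.
have [g _ _] := T_cons_W mL aL'.
sem_tac [kn h; h1; h2; g].
Qed.

(** More members cannot be guessed than are refuted. At each [P] the guess and the exact count are
    both unfolded; if the guess counts [P], then [P] is refuted and the count drops as well, so the
    inequality persists. *)
Lemma T_bound u m a d : k = u ++ m -> suffix a -> suffix d -> size d < size a ->
  [:: e (t m a); e (NC m d)] |= [::].
Proof.
elim: m u a d => [|P m IHm] u [|x a] d ek aL dL // da.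
  have h := T_nil_cons aL; sem_tac [kn h].
have PmL := suffix_trans ek; have mL := suffix_behead PmL; have aL' := suffix_behead aL.
have ek' : k = rcons u P ++ m by rewrite cat_rcons.
have [D1 D1' D2 _] := steps ek; have d2 := D2 d dL.
have ti := T_cons_inv PmL aL; have [_ w2 _] := T_cons_W PmL aL'; have [w1 _ _] := T_cons_W PmL aL'.
have i1 := IHm _ (x :: a) d ek' aL dL da.
have PF := F_refuted P.
case: d dL da d2 i1 => [|y d] dL da d2 i1.
  sem_tac [kn ti; D1'; d2; i1; w2].
have dL' := suffix_behead dL; have d1 := D1 y d dL.
have i2 := IHm _ (x :: a) d ek' aL dL' (ltnW da).
have i3 := IHm _ a d ek' aL' dL' da.
sem_tac [kn ti; d1; d2; i1; w1; w2; i2; i3].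
Qed.

(** A refuted member that must be avoided leaves too few others. At its position the guess skips [C]
    while the exact count drops by one, and the strict inequality needed by [T_bound] arises. *)
Lemma T_exclude u m a d C : k = u ++ m -> suffix a -> suffix d -> size d <= size a ->
  C \in [:: A; B] -> C \in m -> [:: e (t m a); e (NC m d); refuted C] |= [::].
Proof.
move=> + + + + CAB; have CF := F_refuted C.
elim: m u a d => [|P m IHm] u a d // ek aL dL da Cm.
have PmL := suffix_trans ek; have mL := suffix_behead PmL.
have ek' : k = rcons u P ++ m by rewrite cat_rcons.
have [D1 D1' D2 _] := steps ek; have d2 := D2 d dL; have PF := F_refuted P.
case: (eqVneq C P) => [eCP|nCP].
  have ex : (P == A) || (P == B) by move: CAB; rewrite !inE eCP.
  have te := T_cons_excluded PmL aL ex.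
  rewrite eCP; case: d dL da d2 => [|y d] dL da d2.
    sem_tac [kn D1'].
  have dL' := suffix_behead dL; have d1 := D1 y d dL.
  have b := T_bound ek' aL dL' da.
  sem_tac [kn te; d1; b].
have {}Cm : C \in m by move: Cm; rewrite inE (negbTE nCP).
have i1 := IHm _ a d ek' aL dL da Cm.
case: a aL da i1 => [|x a] aL da i1.
  case: d dL da d2 i1 => // dL _ d2 i1; have tz := T_cons_zero PmL.
  sem_tac [kn tz; D1'; d2; i1].
have aL' := suffix_behead aL; have ti := T_cons_inv PmL aL.
have [w1 w2 _] := T_cons_W PmL aL'.
case: d dL da d2 i1 => [|y d] dL da d2 i1.
  sem_tac [kn ti; D1'; d2; i1; w2].
have dL' := suffix_behead dL; have d1 := D1 y d dL.
have i2 := T_bound ek' aL dL' da.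
have i3 := IHm _ a d ek' aL' dL' da Cm.
sem_tac [kn ti; d1; d2; i1; w1; w2; i2; i3].
Qed.

(** If neither excluded formula is refuted, the guess that counts every refuted member of [m]
    succeeds. *)
Lemma T_reach u m d : k = u ++ m -> suffix d ->
  [:: e (NC k c); e (NC m d)] |= [:: e (t m d); refuted A; refuted B].
Proof.
have AF := F_refuted A; have BF := F_refuted B.
elim: m u d => [|P m IHm] u d ek dL.
  case: d dL => [|x d] dL; first by case: T_nil => _ h; sem_tac [kn h].
  have h : [:: e (NC [::] (x :: d))] |= [::].
    by apply: def_zero => //; apply/main_name_in/main_C.
  sem_tac [kn h].
have PmL := suffix_trans ek; have mL := suffix_behead PmL.
have ek' : k = rcons u P ++ m by rewrite cat_rcons.
have [D1 D1' D2 _] := steps ek; have d2 := D2 d dL; have PF := F_refuted P.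
have tm := T_cons_mono PmL dL; have i1 := IHm _ d ek' dL.
case: d dL d2 tm i1 => [|y d] dL d2 tm i1.
  sem_tac [kn D1'; d2; tm; i1].
have dL' := suffix_behead dL; have d1 := D1 y d dL; have i2 := IHm _ d ek' dL'.
case E: ((P == A) || (P == B)).
  case/orP: E => /eqP e1; rewrite e1 in d1 d2 tm *.
    sem_tac [kn d1; d2; tm; i1].
  sem_tac [kn d1; d2; tm; i1].
have ts := T_cons_succ PmL dL (negbT E); have [_ _ w3] := T_cons_W PmL dL'.
sem_tac [kn d1; d2; tm; i1; i2; ts; w3].
Qed.

Lemma T_complement : A \in k -> B \in k ->
  [/\ [:: e (t k c); refuted A] |= [::], [:: e (t k c); refuted B] |= [::]
    & [:: e (NC k c)] |= [:: e (t k c); refuted A; refuted B]].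
Proof.
move=> Ak Bk; have tc := T_count kL cL; have AF := F_refuted A; have BF := F_refuted B.
have x1 := @T_exclude [::] k c c A erefl cL cL (leqnn _) (mem_head _ _) Ak.
have BAB : B \in [:: A; B] by rewrite !inE eqxx orbT.
have x2 := @T_exclude [::] k c c B erefl cL cL (leqnn _) BAB Bk.
have r := @T_reach [::] k c erefl cL.
by split; [sem_tac [kn tc; x1]|sem_tac [kn tc; x2]|sem_tac [kn r]].
Qed.

End Threshold.

(** Under the exact count of [k], [unrefuted] is the complement of [refuted P]: its thresholds
    complement the refutations of the constituents of [P], which lie in [k]. *)
Lemma unrefuted_facts P k c : suffix (P :: k) -> suffix c ->
  (forall u Q m, k = u ++ Q :: m -> count_step Q m) -> unrefuted ua nm P k c \in F ->
  [/\ [:: unrefuted ua nm P k c; refuted P] |= [::],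
      [:: unrefuted ua nm P k c] |= [:: e (NC k c)]
    & [:: e (NC k c)] |= [:: unrefuted ua nm P k c; refuted P]].
Proof.
move=> PkL cL steps; have kL := suffix_behead PkL; have PL := suffix_mem PkL (mem_head _ _).
have /mem_tails[u eL] := PkL; have := view_closed eL.
have m0 : main_name (NC [::] [::]) by apply: main_C.
have nV := main_name_W m0 PL; have PF := F_refuted P.
have := truth; rewrite /unrefuted => tr.
(* The shapes whose dual is 0: nothing has to be guessed, and [unrefuted] is the exact count. *)
have zero : (rhs (NW P (NC [::] [::])) = Zero) -> e (NC k c) \in F ->
  [/\ [:: e (NC k c); refuted P] |= [::], [:: e (NC k c)] |= [:: e (NC k c)]
    & [:: e (NC k c)] |= [:: e (NC k c); refuted P]].
  move=> h _; have {}h : [:: refuted P] |= [::] by apply: def_zero nV h.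
  by split; [sem_tac [kn h]|sem_tac [kn h]|sem_tac [kn h]].
case E: (view P) => [||A p B|A B|A B|i|i|i]; try by move=> _; apply: zero; rewrite /= /rhs_W E.
- move=> _ _; have [_] := def_eq nV; rewrite /= /rhs_W E -/(refuted P) => g.
  have z := ent_zero hyps w8 ctx F_zero.
  by split; [sem_tac [kn z]|sem_tac [kn z]|sem_tac [kn g; tr]].
- case=> Ak Bk UF; have AL := suffix_mem kL Ak; have BL := suffix_mem kL Bk.
  have [|pF b1 b2 b3 b4] := @def_dec _ (refuted A) p (refuted B) nV.
    by rewrite /= /rhs_W E.
  have [A1 _ A3] := T_complement kL cL AL AL steps Ak Ak.
  have [B1 _ B3] := T_complement kL cL BL BL steps Bk Bk.
  have tA := @T_count k c A A kL cL AL AL k c kL cL.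
  have tB := @T_count k c B B kL cL BL BL k c kL cL.
  have [TAF TBF _] := F_dec UF; have [d1 d2 d3 d4] := ent_dec hyps linesF w8 ctx TAF TBF pF UF.
  have AF := F_refuted A; have BF := F_refuted B.
  rewrite -/(refuted P) in b1 b2 b3 b4.
  split.
  + sem_tac [kn b1; b2; A1; B1; d1; d2].
  + sem_tac [kn d1; d2; tA; tB].
  + sem_tac [kn b3; b4; A3; B3; d3; d4].
- case=> Ak Bk UF; have AL := suffix_mem kL Ak; have BL := suffix_mem kL Bk.
  have [|_ _ b1 b2 b3] := @def_or _ (refuted A) (refuted B) nV.
    by rewrite /= /rhs_W E.
  have [A1 B1 AB] := T_complement kL cL AL BL steps Ak Bk.
  have tA := @T_count k c A B kL cL AL BL k c kL cL.
  have AF := F_refuted A; have BF := F_refuted B.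
  rewrite -/(refuted P) in b1 b2 b3.
  by split; [sem_tac [kn b1; A1; B1]|sem_tac [kn tA]|sem_tac [kn AB; b2; b3]].
Qed.

(** The step for [Q] over [n] follows from the definition of [NC] and from [unrefuted_facts], which
    in turn needs the steps for all members of [n]. The induction therefore treats all members of a
    suffix at once. *)
Lemma count_step_suffix P k : suffix (P :: k) -> count_step P k.
Proof.
have steps m : suffix m -> forall u Q n, m = u ++ Q :: n -> count_step Q n.
  elim: m => [|R m IHm] mL [|S u] Q n //; last first.
    by case=> _; apply: IHm; apply: suffix_behead mL.
  move=> [eRQ emn]; move: mL IHm; rewrite {}eRQ {}emn => {R m} QnL IHn.
  have nL := suffix_behead QnL; have {IHn} steps := IHn nL.
  have QL := suffix_mem QnL (mem_head _ _); have QF := F_refuted Q.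
  have defC c : suffix c -> NC (Q :: n) c \in names by move=> cL; apply/main_name_in/main_C.
  have z := ent_zero hyps w8 ctx F_zero.
  have W c : suffix c -> _ := fun cL => W_facts QnL (mem_head Q n) (main_C nL cL).
  split=> [x c xcL||[|x c] cL|x c xcL].
  - have cL := suffix_behead xcL.
    have [|UF _ h _ _] // := @def_or _ (unrefuted ua nm Q n (x :: c)) (e (NW Q (NC n c))) (defC _ xcL).
    have [u1 _ _] := unrefuted_facts QnL xcL steps UF; have [w1 _ _] := W c cL.
    sem_tac [kn h; u1; w1].
  - have [|UF _ h _ _] // := @def_or _ (unrefuted ua nm Q n [::]) Zero (defC _ suffix_nil).
    have [u1 _ _] := unrefuted_facts QnL suffix_nil steps UF.
    sem_tac [kn h; u1; z].
  - have [|UF _ h _ _] // := @def_or _ (unrefuted ua nm Q n [::]) Zero (defC _ suffix_nil).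
    have [_ u2 _] := unrefuted_facts QnL suffix_nil steps UF.
    sem_tac [kn h; u2; z].
  - have [|UF _ h _ _] // := @def_or _ (unrefuted ua nm Q n (x :: c)) (e (NW Q (NC n c))) (defC _ cL).
    have [_ u2 _] := unrefuted_facts QnL cL steps UF.
    have [_ w2 _] := W c (suffix_behead cL).
    sem_tac [kn h; u2; w2].
  have cL := suffix_behead xcL.
  have [|UF _ _ h _] := @def_or _ (unrefuted ua nm Q n c)
    (if c is _ :: c' then e (NW Q (NC n c')) else Zero) (defC _ cL); first by [].
  have [|_ _ _ _ g] // := @def_or _ (unrefuted ua nm Q n (x :: c)) (e (NW Q (NC n c))) (defC _ xcL).
  have [_ _ u3] := unrefuted_facts QnL cL steps UF; have [_ _ w3] := W c cL.
  sem_tac [kn h; g; u3; w3].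
by move=> PkL; apply: (steps _ PkL [::]).
Qed.

(** * Disjunction over the possible counts *)

Lemma D_succ k x c : suffix k -> suffix (x :: c) ->
  [/\ [:: e (ND k (x :: c))] |= [:: e (ND k c); e (NC k (x :: c))],
      [:: e (ND k c)] |= [:: e (ND k (x :: c))]
    & [:: e (NC k (x :: c))] |= [:: e (ND k (x :: c))]].
Proof.
move=> kL xcL; have nD := names_D xa kL xcL.
by have [|_ _ h1 h2 h3] // := @def_or _ (e (ND k c)) (e (NC k (x :: c))) nD.
Qed.

Lemma D_zero k : suffix k ->
  [:: e (ND k [::])] |= [:: e (NC k [::])] /\ [:: e (NC k [::])] |= [:: e (ND k [::])].
Proof. by move=> kL; apply: (@def_eq (ND k [::])); apply: names_D. Qed.

(** A suffix, read as a number, bounds its own count. One more member raises the count by at most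
    one, and [move_up] transfers the disjunction accordingly. *)
Lemma D_total k : suffix k -> [::] |= [:: e (ND k k)].
Proof.
elim: k => [|P k IHk] kL.
  have [_ h] := D_zero kL; have tr := truth; sem_tac [kn h; tr].
have kL' := suffix_behead kL; have i := IHk kL'.
have [_ _ _ X] := count_step_suffix kL.
have move_up c x : suffix (x :: c) -> [:: e (ND k c)] |= [:: e (ND (P :: k) (x :: c))].
  elim: c x => [|y c IHc] x xcL; have X1 := X _ _ xcL.
    have [z _] := D_zero kL'; have [_ z'] := D_zero kL; have [_ d2 d3] := D_succ kL xcL.
    sem_tac [kn X1; z; z'; d2; d3].
  have ycL := suffix_behead xcL; have i1 := IHc y ycL.
  have [d1 _ _] := D_succ kL' ycL; have [_ _ d3] := D_succ kL ycL.
  have [_ e2 e3] := D_succ kL xcL.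
  sem_tac [kn X1; i1; d1; d3; e2; e3].
have m := move_up _ _ kL.
sem_tac [kn i; m].
Qed.

(** For each fixed count [c] the threshold over all of [L] excludes the refutation of [P], and it
    complements that refutation if [c] is exact. The disjunction over [c] keeps the exclusion, and
    [D_total] provides an exact count. *)
Lemma complement P : P \in L ->
  [:: e (NH P L); refuted P] |= [::] /\ [::] |= [:: e (NH P L); refuted P].
Proof.
move=> PL; have PF := F_refuted P.
have T c : suffix c ->
    [:: e (NT L c P P L c); refuted P] |= [::] /\
    [:: e (NC L c)] |= [:: e (NT L c P P L c); refuted P].
  move=> cL; have steps u Q m : L = u ++ Q :: m -> count_step Q m.
    by move=> eL; apply: count_step_suffix; apply/mem_tails; exists u.
  have [t1 _ t3] := T_complement suffix_self cL PL PL steps PL PL.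
  by split=> //; sem_tac [kn t3].
have H c : suffix c -> [:: e (NH P c); refuted P] |= [::] /\
    [:: e (ND L c)] |= [:: e (NH P c); refuted P].
  elim: c => [|x c IHc] cL; have nH := names_H xa PL cL; have [t1 t2] := T _ cL.
    have [h1 h2] := def_eq nH; rewrite /= in h1 h2; have [z _] := D_zero suffix_self.
    by split; [sem_tac [kn h1; t1]|sem_tac [kn h2; t2; z]].
  have [i1 i2] := IHc (suffix_behead cL); have [d1 _ _] := D_succ suffix_self cL.
  have [|_ _ h1 h2 h3] // := @def_or _ (e (NH P c)) (e (NT L (x :: c) P P L (x :: c))) nH.
  by split; [sem_tac [kn h1; t1; i1]|sem_tac [kn h2; h3; t2; i2; d1]].
have [h1 h2] := H L suffix_self; have d := D_total suffix_self.
by split=> //; sem_tac [kn h2; d].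
Qed.

(** * The sequents for conjunctions and for the variables of co-eNDT axioms *)

Hypothesis F_star : forall P, P \in L -> star nm L P \in F.
Hypothesis subs_closed : forall P, P \in L -> {subset subs P <= L}.

Lemma mem_subs_self P : P \in subs P.
Proof. by case: P => *; apply: mem_head. Qed.

(** Extends [complement] to formulas translated structurally: a decision and its dual test the same
    variable, so complementarity passes from the branches to the decision. *)
Lemma star_complement P : P \in L -> is_coeNDT P ->
  [:: star nm L P; refuted P] |= [::] /\ [::] |= [:: star nm L P; refuted P].
Proof.
elim: P => [||A IHA p B IHB|A _ B _|A _ B _|i|i|i] //= PL; try by move=> _; apply: complement.
- move=> _; have m0 : main_name (NC [::] [::]) by apply: main_C.
  have [_] := def_eq (main_name_W m0 PL); rewrite /= /rhs_W /= -/(refuted Zero) => g.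
  have z := ent_zero hyps w8 ctx F_zero; have tr := truth; have PF := F_refuted Zero.
  by split; [sem_tac [kn z]|sem_tac [kn g; tr]].
- move=> _; have m0 : main_name (NC [::] [::]) by apply: main_C.
  have g : [:: refuted One] |= [::] by apply: def_zero (main_name_W m0 PL) _.
  have o := ent_one hyps w8 ctx F_one; have PF := F_refuted One.
  by split; [sem_tac [kn g]|sem_tac [kn o]].
case/andP=> cA cB.
have AL : A \in L by apply: (subs_closed PL); rewrite /= inE mem_cat mem_subs_self orbT.
have BL : B \in L by apply: (subs_closed PL); rewrite /= inE mem_cat mem_subs_self !orbT.
have [a1 a2] := IHA AL cA; have [b1 b2] := IHB BL cB.
have m0 : main_name (NC [::] [::]) by apply: main_C.
have [|pF r1 r2 r3 r4] // := @def_dec _ (refuted A) p (refuted B) (main_name_W m0 PL).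
have /= PF := F_star PL; have [AF BF _] := F_dec PF.
have [d1 d2 d3 d4] := ent_dec hyps linesF w8 ctx AF BF pF PF.
rewrite -/(refuted (Dec A p B)) in r1 r2 r3 r4.
have := F_refuted A; have := F_refuted B; have := F_refuted (Dec A p B) => RF RBF RAF.
split.
- sem_tac [kn a1; b1; r1; r2; d1; d2].
- sem_tac [kn a2; b2; r3; r4; d3; d4].
Qed.

(** The refutation of a conjunction is defined as the disjunction of the two refutations. Taking
    complements gives the three sequents. *)
Lemma star_and P Q : And P Q \in L -> is_coeNDT P -> is_coeNDT Q ->
  [/\ [:: star nm L (And P Q)] |= [:: star nm L P],
      [:: star nm L (And P Q)] |= [:: star nm L Q]
    & [:: star nm L P; star nm L Q] |= [:: star nm L (And P Q)]].
Proof.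
move=> PQL cP cQ.
have PL : P \in L by apply: (subs_closed PQL); rewrite /= inE mem_cat mem_subs_self orbT.
have QL : Q \in L by apply: (subs_closed PQL); rewrite /= inE mem_cat mem_subs_self !orbT.
have [p1 p2] := star_complement PL cP; have [q1 q2] := star_complement QL cQ.
have [c1 c2] := complement PQL.
have m0 : main_name (NC [::] [::]) by apply: main_C.
have [|_ _ r1 r2 r3] // := @def_or _ (refuted P) (refuted Q) (main_name_W m0 PQL).
rewrite -/(refuted (And P Q)) in r1 r2 r3.
have := F_refuted P; have := F_refuted Q; have := F_refuted (And P Q) => RF RQF RPF.
have PF := F_star PL; have QF := F_star QL; rewrite [star _ _ (And _ _)]/=.
split.
- sem_tac [kn c1; p2; r2].
- sem_tac [kn c1; q2; r3].
- sem_tac [kn c2; r1; p1; q1].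
Qed.

(** Viewing the variable as [And U U] makes its refutation a disjunction of two copies of that of
    [U]; complements then agree as well. *)
Lemma star_Uvar i U : Uvar i \in L -> U \in L -> is_coeNDT U -> view (Uvar i) = And U U ->
  [:: star nm L (Uvar i)] |= [:: star nm L U] /\ [:: star nm L U] |= [:: star nm L (Uvar i)].
Proof.
move=> iL UL cU vi; have [p1 p2] := star_complement UL cU.
have [c1 c2] := complement iL.
have m0 : main_name (NC [::] [::]) by apply: main_C.
have [|_ _ r1 r2 _] := @def_or _ (refuted U) (refuted U) (main_name_W m0 iL).
  by rewrite [rhs _]/(rhs_W _ _ _ _) /rhs_W vi.
rewrite -/(refuted (Uvar i)) in r1 r2.
have := F_refuted U; have := F_refuted (Uvar i) => RF RUF.
have UF := F_star UL; rewrite [star _ _ (Uvar _)]/=.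
by split; [sem_tac [kn c1; p2; r2]|sem_tac [kn c2; r1; p1]].
Qed.

End Counting.

(** * The translation *)

Definition line_forms (ls : seq sequent) : seq form := flatmap (fun S => S.1 ++ S.2) ls.

(** [subs] lists a formula before its subformulas, and the axioms come by decreasing index, so [U_i]
    stands after every occurrence of [u_i]. A formula may occur several times; occurrences are then
    counted with multiplicity. *)
Definition nodes (ua : seq (nat * form)) (xs : seq form) (ls : seq sequent) : seq form :=
  flatmap subs (line_forms ls ++ xs) ++ flatmap (fun x => Uvar x.1 :: subs x.2) (rev ua).

Definition table (ns : seq name) : seq (name * nat) :=
  [seq (x.2, x.1) | x <- number_from 0 ns].

Definition star_sequent (nm : seq (name * nat)) (L : seq form) (S : sequent) : sequent :=
  (map (star nm L) S.1, map (star nm L) S.2).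

Definition pvar_of (A : form) : seq form := if A is Dec _ p _ then [:: pvar p] else [::].

(** The decision rules have [pvar p] as a side formula, which need not be a subformula of the
    decision. *)
Definition formulas (B : seq form) : seq form :=
  flatmap subs B ++ flatmap pvar_of (flatmap subs B).

Section Assembly.
Variables (ua xa : seq (nat * form)) (L : seq form).

Definition the_names := names L xa.
Definition the_table := table the_names.
Definition the_axioms := map (rhs ua xa L the_table) the_names.
(** [Evar 0] is what [ev] returns for a name outside the table, so [ev] always yields a formula of
    the list. *)
Definition the_formulas :=
  formulas ([:: Zero; One; Evar 0] ++ (map (ev the_table) the_names ++
    (the_axioms ++ map (star the_table L) L))).
Definition the_hyps : seq sequent :=
  flatmap (fun n => [:: ([:: ev the_table n], [:: rhs ua xa L the_table n]);
                        ([:: rhs ua xa L the_table n], [:: ev the_table n])]) the_names.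

(** Saturation leaves the end sequent at an unspecified place, so it is repeated at the end. The
    width 60 suffices for every entailment used; it is doubled to make room for structural
    rearrangement. *)
Definition the_lines (ls : seq sequent) : seq sequent :=
  let F := the_formulas in
  let lines := map (star_sequent the_table L) ls in
  rcons (saturation the_hyps F (candidates (60 + 60) F lines)) (last ([::], [::]) lines).

End Assembly.

Definition translate (pi : eLEADT_pf) : eLNDT_pf :=
  let ua := number_from 0 (u_axs pi) in
  let xa := number_from 0 (x_axs pi) in
  let L := nodes ua (x_axs pi) (ea_lines pi) in
  ELNDTPf (the_axioms ua xa L) (the_lines ua xa L (ea_lines pi)).

(** * Lookup tables *)

Lemma number_from_map (T U : Type) (h : T -> U) i (s : seq T) :
  [seq (x.1, h x.2) | x <- number_from i s] = number_from i (map h s).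
Proof. by elim: s i => //= a s IHs i; rewrite IHs. Qed.

Lemma number_from_rcons (T : Type) i (s : seq T) a :
  number_from i (rcons s a) = rcons (number_from i s) (i + size s, a).
Proof.
by elim: s i => [|b s IHs] i //=; rewrite ?addn0 // IHs addSnnS.
Qed.

Lemma lookup_number_from (T : Type) (d : T) i (s : seq T) j :
  lookup d (number_from i s) (i + j) = nth d s j.
Proof.
elim: s i j => [|a s IHs] i [|j] //=; rewrite /lookup /=; first by rewrite addn0 eqxx.
by rewrite -{1}[i]addn0 eqn_add2l /= addnS -addSn; apply: IHs.
Qed.

(** Stated for an initial part [ns] of the list, so that a name occurring before position [i]
    visibly receives a number below [i]. *)
Lemma lookup_table (ns rest : seq name) n : n \in ns ->
  lookup 0 (table (ns ++ rest)) n = index n ns.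
Proof.
suff h i : n \in ns ->
    lookup 0 [seq (x.2, x.1) | x <- number_from i (ns ++ rest)] n = i + index n ns.
  by move=> nn; rewrite /table h.
elim: ns i => //= m ns IHns i; rewrite /lookup /= inE eq_sym.
case: (eqVneq m n) => [->|_] /=; first by rewrite addn0.
by move/(IHns i.+1); rewrite /lookup addSnnS.
Qed.

Lemma lookup_table0 (ns : seq name) n : n \notin ns -> lookup 0 (table ns) n = 0.
Proof.
suff h i : n \notin ns -> lookup 0 [seq (x.2, x.1) | x <- number_from i ns] n = 0.
  exact: h.
elim: ns i => //= m ns IHns i; rewrite inE negb_or eq_sym => /andP[nmn nns].
by rewrite /lookup /= (negbTE nmn); apply: IHns.
Qed.

(** * Closure of the list of nodes *)

Lemma subs_trans A B : B \in subs A -> {subset subs B <= subs A}.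
Proof.
elim: A => [||A1 IH1 p A2 IH2|A1 IH1 A2 IH2|A1 IH1 A2 IH2|i|i|i] /=; rewrite inE;
  try by (rewrite orbF => /eqP-> C; rewrite inE) || by move/eqP-> => C; rewrite inE.
all: case/predU1P=> [->//|]; rewrite mem_cat => /orP[/IH1|/IH2] h C /h hC.
all: by rewrite inE mem_cat hC ?orbT.
Qed.

Section Nodes.
Variables (us xs : seq form) (ls : seq sequent).
Hypothesis usP : coeNDT_axioms us.

Local Notation ua := (number_from 0 us).
Local Notation L := (nodes ua xs ls).

Lemma view_Uvar i : view ua (Uvar i) = nth Zero [seq And U U | U <- us] i.
Proof. by rewrite /view (number_from_map (fun U => And U U)) -[i in LHS]add0n lookup_number_from. Qed.

Definition view_kids (P : form) : seq form :=
  match view ua P with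
  | Dec A _ B | And A B => [:: A; B]
  | _ => [::]
  end.

Fixpoint kids_after (s : seq form) : bool :=
  if s is P :: k then all (fun A => A \in k) (view_kids P) && kids_after k else true.

Lemma kids_after_subs A t : kids_after t ->
  (forall i, i \in uvars A -> i < size us -> nth Zero us i \in t) -> kids_after (subs A ++ t).
Proof.
elim: A t => [||A IHA p B IHB|A IHA B IHB|A IHA B IHB|i|i|i] t tK tU //=.
4: rewrite tK andbT /view_kids view_Uvar.
4: have [iU|iU] := ltnP i (size us); last by rewrite nth_default ?size_map.
4: by rewrite (nth_map Zero) //= tU //= inE.
all: rewrite -catA IHA ?IHB ?andbT //; try by move=> i iA; apply: tU; rewrite /= mem_cat iA orbT.
all: try by move=> i iA iU; rewrite mem_cat tU ?orbT // /= mem_cat iA.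
all: by rewrite /view_kids /= !mem_cat ?mem_subs_self ?orbT.
Qed.

(** The block of axiom [j] is put in front of those with smaller indices, which already contain all
    [U_i] that its variables unfold to. *)
Lemma u_nodes j : j <= size us ->
  let t := flatmap (fun x => Uvar x.1 :: subs x.2) (rev (number_from 0 (take j us))) in
  kids_after t /\ forall i, i < j -> nth Zero us i \in t /\ Uvar i \in t.
Proof.
elim: j => [|j IHj] ju; first by rewrite take0.
have {IHj} /= := IHj (ltnW ju).
rewrite (take_nth Zero ju) number_from_rcons rev_rcons add0n size_takel ?(ltnW ju) //.
set t := flatmap _ _; case=> tK tU /=.
have e : flatmap (fun x => Uvar x.1 :: subs x.2)
    ((j, nth Zero us j) :: rev (number_from 0 (take j us))) =
  Uvar j :: subs (nth Zero us j) ++ t by [].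
rewrite e; split.
  have [cU lt_u] := usP ju.
  have sK : kids_after (subs (nth Zero us j) ++ t).
    apply: kids_after_subs => // i iU _; have [] // := tU i.
    by apply: (allP lt_u).
  rewrite /= sK andbT /view_kids view_Uvar (nth_map Zero) //=.
  by rewrite mem_cat mem_subs_self.
move=> i; rewrite ltnS leq_eqVlt => /predU1P[->|/tU[Ui ui]].
  by rewrite !inE eqxx !mem_cat mem_subs_self !orbT.
by rewrite !inE !mem_cat Ui ui !orbT.
Qed.

Lemma nodes_Uvar i : i < size us -> nth Zero us i \in L /\ Uvar i \in L.
Proof.
move=> iu; have [_] := u_nodes (leqnn _); rewrite take_size => /(_ i iu)[h1 h2].
by rewrite !mem_cat h1 h2 !orbT.
Qed.

Lemma nodes_forms A : A \in line_forms ls ++ xs -> A \in L.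
Proof.
move=> Al; rewrite mem_cat; apply/orP; left; apply/flatmapP.
by exists A => //; apply: mem_subs_self.
Qed.

Lemma nodes_view_closed u P k : L = u ++ P :: k ->
  match view ua P with
  | Dec A _ B | And A B => A \in k /\ B \in k
  | _ => True
  end.
Proof.
have LK : kids_after L.
  rewrite /nodes; have [tK tU] := u_nodes (leqnn _); rewrite take_size in tK tU.
  elim: (line_forms ls ++ xs) => [//|A Fs IHF]; rewrite [flatmap _ (_ :: _)]/= -catA.
  apply: kids_after_subs => // i _ iu; have [h _] := tU i iu.
  by rewrite mem_cat h orbT.
move=> e; move: LK; rewrite e; elim: u {e} => [|Q u IHu] /= /andP[h1 h2]; last exact: IHu.
by move: h1; rewrite /view_kids; case: (view ua P) => //= [A p B|A B] /and3P[].
Qed.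

Lemma nodes_subs_closed P : P \in L -> {subset subs P <= L}.
Proof.
move=> PL A AP; move: PL; rewrite /nodes !mem_cat => /orP[] /flatmapP[x xl].
  move=> Px; apply/orP; left; apply/flatmapP; exists x => //.
  exact: subs_trans Px _ AP.
rewrite inE => /predU1P[eP|Px].
  move: AP; rewrite eP inE => /eqP->; apply/orP; right; apply/flatmapP; exists x => //.
  exact: mem_head.
apply/orP; right; apply/flatmapP; exists x => //; rewrite inE.
by rewrite (subs_trans Px AP) orbT.
Qed.

End Nodes.

(** * Order of the extension axioms *)

Lemma tails_next (T : eqType) (s : seq T) x P k y :
  tails s = x ++ (P :: k) :: y -> k \in y.
Proof.
elim: s x => [|a s IHs] [|z x] //=; first by case: x.
- by case=> _ -> <-; case: (k) => *; apply: mem_head.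
by case=> _ /IHs.
Qed.

Section Order.
Variables (R : name -> seq name).

Definition ordered (B s : seq name) : Prop :=
  forall s1 n s2, s = s1 ++ n :: s2 -> {subset R n <= B ++ s1}.

Lemma ordered_nil B : ordered B [::].
Proof. by case. Qed.

Lemma ordered_cons B n s : {subset R n <= B} -> ordered (rcons B n) s -> ordered B (n :: s).
Proof.
move=> Rn os [|m s1] n' s2 [<-]; first by rewrite cats0.
by move=> e m' /(os _ _ _ e); rewrite cat_rcons.
Qed.

Lemma ordered_cat B s t : ordered B s -> ordered (B ++ s) t -> ordered B (s ++ t).
Proof.
elim: s B => [|n s IHs] B os ot; first by rewrite cats0 in ot.
apply: ordered_cons; first by have := os [::] n s erefl; rewrite cats0.
apply: IHs; last by rewrite cat_rcons.
by move=> s1 m s2 e x /(os (n :: s1) m s2 (congr1 (cons n) e)); rewrite cat_rcons.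
Qed.

Lemma ordered_flatmap (T : Type) (f : T -> seq name) B r :
  (forall r1 a r2, r = r1 ++ a :: r2 -> ordered (B ++ flatmap f r1) (f a)) ->
  ordered B (flatmap f r).
Proof.
elim: r B => [|a r IHr] B h; first exact: ordered_nil.
apply: (@ordered_cat B (f a)); first by have := h [::] a r erefl; rewrite cats0.
apply: IHr => r1 b r2 e; have := h (a :: r1) b r2 (congr1 (cons a) e).
by rewrite catA.
Qed.

Lemma ordered_map (T : Type) (f : T -> name) B r :
  (forall r1 a r2, r = r1 ++ a :: r2 -> {subset R (f a) <= B ++ map f r1}) ->
  ordered B (map f r).
Proof.
move=> h; elim: r B h => [|a r IHr] B h; first exact: ordered_nil.
apply: ordered_cons; first by have := h [::] a r erefl; rewrite cats0.
apply: IHr => r1 b r2 e; have := h (a :: r1) b r2 (congr1 (cons a) e).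
by rewrite cat_rcons.
Qed.

End Order.

(** * Dependencies of the extension variables *)

Fixpoint star_deps (L : seq form) (P : form) : seq name :=
  match P with
  | Dec A _ B | Or A B => star_deps L A ++ star_deps L B
  | And _ _ | Uvar _ => [:: NH P L]
  | Xvar i => [:: NX i]
  | _ => [::]
  end.

Section Dependencies.
Variables (ua : seq (nat * form)) (xs : seq form) (L : seq form).
Local Notation xa := (number_from 0 xs).
Local Notation suffix k := (k \in tails L).

Definition unrefuted_deps (P : form) (k c : seq form) : seq name :=
  match view ua P with
  | Zero => [::]
  | Dec A p B => [:: NT k c A A k c; NT k c B B k c]
  | And A B => [:: NT k c A B k c]
  | _ => [:: NC k c]
  end.

(** An upper bound on the names in the right-hand side, independent of the tests made there. *)
Definition deps (n : name) : seq name :=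
  match n with
  | NC k c => if k is P :: k' then unrefuted_deps P k' c ++
                (if c is _ :: c' then [:: NW P (NC k' c')] else [::]) else [::]
  | NT k c A B m a =>
      if m is P :: m' then NT k c A B m' a ::
        (if a is _ :: a' then [:: NW P (NT k c A B m' a')] else [::])
      else [:: NC k c]
  | NW P n => match view ua P with
              | Dec A _ B | And A B => [:: n; NW A n; NW B n]
              | _ => [:: n]
              end
  | ND k c => NC k c :: if c is _ :: c' then [:: ND k c'] else [::]
  | NH P c => NT L c P P L c :: if c is _ :: c' then [:: NH P c'] else [::]
  | NX i => star_deps L (lookup Zero xa i)
  end.

Lemma evars_star nm P : evars (star nm L P) = map (lookup 0 nm) (star_deps L P).
Proof. by elim: P => //= [A -> p B ->|A -> B ->]; rewrite map_cat. Qed.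

Lemma evars_rhs nm n : {subset evars (rhs ua xa L nm n) <= map (lookup 0 nm) (deps n)}.
Proof.
case: n => [[|P k] c|k c A B [|P m] a|P n|k c|P c|i] //=.
- by case: c.
- rewrite /unrefuted /unrefuted_deps; case: (view ua P) => [||A p B|A B|A B|i|i|i];
  by case: c => [|x c] /= j; rewrite ?inE.
- by case: a => [|x a] j.
- by case: ifP => _; case: a => [|x a] j /=; rewrite !inE => // ->.
- rewrite /rhs_W; case: (view ua P) => [||A p B|A B|A B|i|i|i] //= j; rewrite ?inE //.
  + by move->; rewrite orbT.
  + by move->; rewrite orbT.
- by case: c => [|x c] /= j; rewrite ?inE // orbC.
- by case: c => [|x c] /= j; rewrite ?inE // orbC.
by rewrite evars_star.
Qed.

Hypothesis view_closed : forall u P k, L = u ++ P :: k ->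
  match view ua P with
  | Dec A _ B | And A B => A \in k /\ B \in k
  | _ => True
  end.
Hypothesis xsP : eEADT_axioms xs.
Hypothesis xsL : forall P, P \in xs -> {subset subs P <= L}.

Lemma ordered_with_W B n : {subset deps n <= B} -> ordered deps B (with_W L n).
Proof.
move=> nB; apply: ordered_cons => //; apply: ordered_map => r1 P r2 e m.
have eL : L = rev r2 ++ P :: rev r1 by rewrite -[L]revK e rev_cat rev_cons cat_rcons.
have nin : n \in rcons B n ++ [seq NW Q n | Q <- r1] by rewrite mem_cat mem_rcons mem_head.
have Win Q : Q \in rev r1 -> NW Q n \in rcons B n ++ [seq NW Q n | Q <- r1].
  by rewrite mem_rev => Qr; rewrite mem_cat map_f ?orbT.
have := view_closed eL; rewrite /=; case: (view ua P) => [||A p C|A C|A C|i|i|i] h;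
  rewrite !inE; try by move/eqP->.
- by case: h => hA hC /or3P[] /eqP-> //; apply: Win.
- by case: h => hA hC /or3P[] /eqP-> //; apply: Win.
Qed.

Lemma suffix_kids P k : suffix (P :: k) ->
  match view ua P with
  | Dec A _ B | And A B => A \in L /\ B \in L
  | _ => True
  end.
Proof.
move=> /mem_tails[u eL]; have := view_closed eL.
have kL A : A \in k -> A \in L by rewrite eL mem_cat inE => ->; rewrite !orbT.
by case: (view ua P) => // [A p B|A B] [/kL + /kL].
Qed.

(** Exact counts over [k] refer to names over the tail of [k], which come from [B]. Thresholds over
    [k] refer to these counts and to thresholds with a shorter [m]. *)
Lemma ordered_names_k B k : suffix k ->
  (forall P k', k = P :: k' -> {subset names_k L k' <= B}) ->
  ordered deps B (names_k L k).
Proof.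
move=> kL kB; apply: ordered_cat.
  apply: ordered_flatmap => r1 c r2 e; apply: ordered_with_W => m.
  have cL : suffix c by rewrite e mem_cat mem_head orbT.
  rewrite mem_cat => mC; apply/orP; left; case: k kL kB mC => // P k kL kB.
  have {kB} kB := kB P k erefl; have := suffix_kids kL; have kL' := suffix_behead kL.
  have Tin A C : A \in L -> C \in L -> NT k c A C k c \in B.
    move=> AL CL; apply: kB; rewrite mem_cat; apply/orP; right.
    apply/flatmapP; exists c => //; apply/flatmapP; exists A => //.
    apply/flatmapP; exists C => //; apply/flatmapP; exists k; rewrite ?mem_rev //.
    by apply/flatmapP; exists c; rewrite ?with_W_self.
  have Cin c' : suffix c' -> {subset with_W L (NC k c') <= B}.
    move=> c'L x xw; apply: kB; rewrite mem_cat; apply/orP; left.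
    by apply/flatmapP; exists c'.
  rewrite /= mem_cat => h /orP[].
    rewrite /unrefuted_deps; case: (view ua P) h => [||A p C|A C|A C|i|i|i] h;
      rewrite ?inE //; try by move/eqP->; apply: (Cin c); rewrite ?with_W_self.
    + by case: h => AL CL /orP[] /eqP->; apply: Tin.
    + by case: h => AL CL /eqP->; apply: Tin.
  case: (c) cL Cin => // x c' cL Cin; rewrite inE => /eqP->.
  apply: (Cin c'); first exact: suffix_behead cL.
  apply: with_W_W; case/mem_tails: kL => u ->; by rewrite mem_cat mem_head orbT.
set B1 := B ++ _.
have B1C c : suffix c -> NC k c \in B1.
  by move=> cL; rewrite mem_cat; apply/orP; right; apply/flatmapP; exists c; rewrite ?with_W_self.
apply: ordered_flatmap => r1 c r2 /(congr1 (fun s => c \in s)); rewrite mem_cat mem_head orbT => cL.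
apply: ordered_flatmap => r3 A r4 _; apply: ordered_flatmap => r5 C r6 _.
set B2 := _ ++ flatmap _ r5.
have B2C : NC k c \in B2 by do 3!(rewrite mem_cat; apply/orP; left); apply: B1C.
apply: ordered_flatmap => r7 m r8 em; apply: ordered_flatmap => r9 a r10 ea.
apply: ordered_with_W => n.
have aL : suffix a by rewrite ea mem_cat mem_head orbT.
case: m em => [|P m] em; first by rewrite inE => /eqP->; do 2!(rewrite mem_cat; apply/orP; left).
have eT : tails L = rev r8 ++ (P :: m) :: rev r7.
  by rewrite -[tails L]revK em rev_cat rev_cons cat_rcons.
have := tails_next eT; rewrite mem_rev => mr7.
have PmL : suffix (P :: m) by rewrite eT mem_cat mem_head orbT.
have PL : P \in L by case/mem_tails: PmL => u ->; rewrite mem_cat mem_head orbT.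
set B3 := (B2 ++ flatmap _ r7) ++ flatmap _ r9.
have Tin a' : suffix a' -> {subset with_W L (NT k c A C m a') <= B3}.
  move=> a'L x xw; rewrite mem_cat; apply/orP; left; rewrite mem_cat; apply/orP; right.
  by apply/flatmapP; exists m => //; apply/flatmapP; exists a'.
rewrite inE => /predU1P[->|]; first by apply: (Tin a); rewrite ?with_W_self.
case: (a) aL => // x a' aL; rewrite inE => /eqP->.
by apply: (Tin a'); [exact: suffix_behead aL|apply: with_W_W].
Qed.

Lemma ordered_names : ordered deps [::] (names L xa).
Proof.
have main k : suffix k -> {subset names_k L k <= flatmap (names_k L) (rev (tails L))}.
  by move=> kL n nk; apply/flatmapP; exists k; rewrite ?mem_rev.
apply: ordered_cat.
  apply: ordered_flatmap => r1 k r2 e; apply: ordered_names_k.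
    by rewrite -mem_rev e mem_cat mem_head orbT.
  move=> P k' ek n nk; have eT : tails L = rev r2 ++ (P :: k') :: rev r1.
    by rewrite -[tails L]revK e rev_cat rev_cons cat_rcons ek.
  have := tails_next eT; rewrite mem_rev => kr.
  by apply/flatmapP; exists k'.
set B := [::] ++ _.
have Lself : suffix L by apply/mem_tails; exists [::].
have BC k c : suffix k -> suffix c -> NC k c \in B.
  move=> kL cL; apply: (main k kL); rewrite mem_cat; apply/orP; left.
  by apply/flatmapP; exists c; rewrite ?with_W_self.
have BT P c : P \in L -> suffix c -> NT L c P P L c \in B.
  move=> PL cL; apply: (main L Lself); rewrite mem_cat; apply/orP; right.
  apply/flatmapP; exists c => //; apply/flatmapP; exists P => //.
  apply/flatmapP; exists P => //; apply/flatmapP; exists L; rewrite ?mem_rev //.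
  by apply/flatmapP; exists c; rewrite ?with_W_self.
have next r1 P c r2 : rev (tails L) = r1 ++ (P :: c) :: r2 -> c \in r1.
  move=> e; have eT : tails L = rev r2 ++ (P :: c) :: rev r1.
    by rewrite -[tails L]revK e rev_cat rev_cons cat_rcons.
  by have := tails_next eT; rewrite mem_rev.
apply: ordered_cat.
  apply: ordered_cat.
    apply: ordered_flatmap => r1 k r2 e; apply: ordered_map => r3 c r4 ec n.
    have kL : suffix k by rewrite e mem_cat mem_head orbT.
    have cL : suffix c by rewrite -mem_rev ec mem_cat mem_head orbT.
    rewrite inE => /predU1P[->|]; first by do 2!(rewrite mem_cat; apply/orP; left); apply: BC.
    case: c ec cL => // x c ec cL; rewrite inE => /eqP->.
    by rewrite mem_cat map_f ?orbT // (next _ _ _ _ ec).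
  apply: ordered_flatmap => r1 P r2 e; apply: ordered_map => r3 c r4 ec n.
  have PL : P \in L by rewrite e mem_cat mem_head orbT.
  have cL : suffix c by rewrite -mem_rev ec mem_cat mem_head orbT.
  rewrite inE => /predU1P[->|]; first by do 3!(rewrite mem_cat; apply/orP; left); apply: BT.
  case: c ec cL => // x c ec cL; rewrite inE => /eqP->.
  by rewrite mem_cat map_f ?orbT // (next _ _ _ _ ec).
set B' := B ++ _.
have BH P : P \in L -> NH P L \in B'.
  move=> PL; rewrite !mem_cat; apply/orP; right; apply/orP; right; apply/flatmapP.
  by exists P => //; apply: map_f; rewrite mem_rev.
have -> : [seq NX x.1 | x <- xa] = [seq NX i | i <- iota 0 (size xs)].
  by elim: (xs) 0 => //= X s IHs i; rewrite IHs.
apply: ordered_map => r1 i r2 e n.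
have szr : size r1 < size xs.
  by have := congr1 size e; rewrite size_iota size_cat /= => ->; rewrite addnS ltnS leq_addr.
have ei : i = size r1.
  have := congr1 (fun s => nth 0 s (size r1)) e; rewrite nth_iota // nth_cat ltnn subnn /=.
  by move<-.
have er : r1 = iota 0 i.
  have := congr1 (take (size r1)) e; rewrite take_size_cat // take_iota => <-.
  by rewrite ei; congr iota; lia.
have ixs : i < size xs by rewrite ei.
rewrite /= -[i in lookup _ _ i]add0n lookup_number_from; have [_ lt_x] := xsP ixs.
have : {subset subs (nth Zero xs i) <= L} by apply/xsL/mem_nth.
(* Conjunctions and [u] variables of the axiom lead to [NH] names, placed before; its [x] variables
   have smaller indices. *)
move: lt_x; elim: (nth Zero xs i) => [||A IHA p C IHC|A IHA C IHC|A _ C _|j|j|j] //=.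
- rewrite all_cat mem_cat => /andP[lA lC] sL /orP[/(IHA lA)|/(IHC lC)]; apply.
    by move=> x xA; apply: sL; rewrite inE mem_cat xA orbT.
  by move=> x xA; apply: sL; rewrite inE mem_cat xA !orbT.
- rewrite all_cat mem_cat => /andP[lA lC] sL /orP[/(IHA lA)|/(IHC lC)]; apply.
    by move=> x xA; apply: sL; rewrite inE mem_cat xA orbT.
  by move=> x xA; apply: sL; rewrite inE mem_cat xA !orbT.
- by move=> _ sL; rewrite inE => /eqP->; rewrite mem_cat BH // sL ?mem_head.
- by move=> _ sL; rewrite inE => /eqP->; rewrite mem_cat BH // sL ?mem_head.
by rewrite andbT => ji _; rewrite inE => /eqP->; rewrite mem_cat map_f ?orbT // er mem_iota.
Qed.

Lemma is_eNDT_star nm P : is_eNDT (star nm L P).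
Proof. by elim: P => //= [A -> p B ->|A -> B ->]. Qed.

Lemma is_eNDT_rhs nm n : is_eNDT (rhs ua xa L nm n).
Proof.
case: n => [[|P k] c|k c A B [|P m] a|P n|k c|P c|i] /=; try by case: c.
- by rewrite /unrefuted; case: (view ua P) => *; case: c.
- by case: a.
- by case: ifP => _ //; case: a.
- by rewrite /rhs_W; case: (view ua P).
exact: is_eNDT_star.
Qed.

Lemma the_axioms_eNDT : eNDT_axioms (the_axioms ua xa L).
Proof.
move=> i; rewrite size_map => ni; set n0 := NX 0.
rewrite (nth_map n0) //; split; first exact: is_eNDT_rhs.
apply/allP => j /evars_rhs/mapP[m mdeps ->].
have := ordered_names; rewrite -/(the_names xa L) => od.
have e : the_names xa L = take i (the_names xa L) ++ nth n0 (the_names xa L) i ::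
    drop i.+1 (the_names xa L) by rewrite -drop_nth // cat_take_drop.
have /= mi := od _ _ _ e _ mdeps.
rewrite /the_table e lookup_table //.
by apply: leq_trans (_ : size (take i (the_names xa L)) <= i); rewrite ?index_mem ?size_take_min ?geq_minl.
Qed.

End Dependencies.

(** * Correctness of the translation *)

Section Formulas.
Variable B : seq form.
Hypotheses (B0 : Zero \in B) (B1 : One \in B).
Local Notation F := (formulas B).

Lemma mem_formulas A : A \in B -> A \in F.
Proof.
move=> AB; rewrite mem_cat; apply/orP; left; apply/flatmapP.
by exists A => //; apply: mem_subs_self.
Qed.

Lemma formulas_subs A C : C \in flatmap subs B -> A \in subs C -> A \in F.
Proof.
move=> /flatmapP[E EB CE] AC; rewrite mem_cat; apply/orP; left; apply/flatmapP.
by exists E => //; apply: subs_trans CE _ AC.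
Qed.

Lemma formulas_or A C : Or A C \in F -> A \in F /\ C \in F.
Proof.
rewrite {1}mem_cat => /orP[h|/flatmapP[E _]]; last by case: E => // ? ? ?; rewrite inE.
by split; apply: (formulas_subs h); rewrite /= inE mem_cat mem_subs_self ?orbT.
Qed.

(** A decision [pvar p] added by the closure has constituents 0 and 1, so [B] is required to contain
    both. *)
Lemma formulas_dec A p C : Dec A p C \in F -> [/\ A \in F, C \in F & pvar p \in F].
Proof.
rewrite {1}mem_cat => /orP[h|].
  split; try by apply: (formulas_subs h); rewrite /= inE mem_cat mem_subs_self ?orbT.
  by rewrite mem_cat; apply/orP; right; apply/flatmapP; exists (Dec A p C); rewrite //= inE.
move=> h; have hF : Dec A p C \in F by rewrite mem_cat h orbT.
case/flatmapP: h => -[] // X q Y _; rewrite inE => /eqP[eA ep eC].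
by rewrite eA eC; split; try exact: mem_formulas; rewrite eA eC in hF.
Qed.

Lemma formulas_all (K : pred form) : (forall A, A \in B -> all K (subs A)) ->
  (forall p, K (pvar p)) -> all K F.
Proof.
move=> KB Kp; rewrite all_cat; apply/andP; split; apply/allP => A /flatmapP[C CB].
  by move=> AC; apply: (allP (KB C CB)).
by case: C CB => // ? p ? _; rewrite inE => /eqP->.
Qed.

End Formulas.

Lemma is_eNDT_subs A : is_eNDT A -> all is_eNDT (subs A).
Proof.
elim: A => [||A IHA p B IHB|A IHA B IHB|A IHA B IHB|i|i|i] //= /andP[cA cB];
by rewrite cA cB all_cat IHA ?IHB.
Qed.

Lemma star_NDT nm L A : is_NDT A -> star nm L A = A.
Proof.
by elim: A => [||A IHA p B IHB|A IHA B IHB|A IHA B IHB|i|i|i] //= /andP[/IHA-> /IHB->].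
Qed.

Lemma star_rule nm L ps S : LNDT_rule ps S ->
  LNDT_rule (map (star_sequent nm L) ps) (star_sequent nm L S).
Proof.
by case=> {ps S} * /=; rewrite /star_sequent /= ?map_rcons ?map_cat /=; constructor.
Qed.

(** * Simulation of the lines of a proof *)

Section Simulation.
Variables (us xs : seq form) (ls : seq sequent).
Hypothesis usP : coeNDT_axioms us.
Hypothesis xsP : eEADT_axioms xs.
Hypothesis lsP : derivation is_eEADT
  (fun T => extension_hyp Uvar us T \/ extension_hyp Xvar xs T) LEADT_rule ls.
Hypothesis ls_neq0 : ls != [::].

Local Notation ua := (number_from 0 us).
Local Notation xa := (number_from 0 xs).
Local Notation L := (nodes ua xs ls).
Local Notation nm := (the_table xa L).
Local Notation F := (the_formulas ua xa L).
Local Notation hyps := (the_hyps ua xa L).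
Local Notation lines := (map (star_sequent nm L) ls).
Local Notation cand := (candidates (60 + 60) F lines).

Lemma F_ev n : ev nm n \in F.
Proof.
apply: mem_formulas; have [nn|nn] := boolP (n \in the_names xa L).
  by rewrite !mem_cat (map_f (ev nm) nn) !orbT.
by rewrite /ev lookup_table0.
Qed.

Lemma F_rhs n : n \in the_names xa L -> rhs ua xa L nm n \in F.
Proof.
by move=> nn; apply: mem_formulas; rewrite !mem_cat (map_f (rhs ua xa L nm) nn) !orbT.
Qed.

Lemma F_star P : P \in L -> star nm L P \in F.
Proof.
by move=> PL; apply: mem_formulas; rewrite !mem_cat (map_f (star nm L) PL) !orbT.
Qed.

Lemma mem_lines S A : S \in ls -> A \in S.1 ++ S.2 -> A \in L.
Proof.
move=> Sl AS; apply: nodes_forms; rewrite mem_cat; apply/orP; left.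
by apply/flatmapP; exists S.
Qed.

Lemma linesF S : S \in lines -> all (fun A => A \in F) S.1 && all (fun A => A \in F) S.2.
Proof.
case/mapP=> T Tl ->; apply/andP; split; apply/allP => _ /mapP[A AT ->];
by apply/F_star/(mem_lines Tl); rewrite mem_cat AT ?orbT.
Qed.

Lemma ctx0 : context lines [::] [::].
Proof.
have [S Sl] : exists S, S \in ls by case: ls ls_neq0 => // S l _; exists S; apply: mem_head.
exists (star_sequent nm L S); first exact: map_f.
by split; apply/mem_prefixes; eexists; rewrite cat0s.
Qed.

Lemma hyps_in n : n \in the_names xa L ->
  ([:: ev nm n], [:: rhs ua xa L nm n]) \in hyps /\ ([:: rhs ua xa L nm n], [:: ev nm n]) \in hyps.
Proof. by move=> nn; split; apply/flatmapP; exists n; rewrite // !inE eqxx ?orbT. Qed.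

Lemma cand_line S : S \in lines -> S \in cand.
Proof.
move=> Sl; have c : context lines S.1 S.2.
  by exists S => //; split; apply/mem_prefixes; exists [::]; rewrite cats0.
by have := @context_cand F lines 60 S.1 S.2 [::] [::] c; rewrite !cats0 -surjective_pairing; apply.
Qed.

Lemma candF T : T \in cand -> all (fun A => A \in F) T.1 && all (fun A => A \in F) T.2.
Proof.
case/flatmapP=> S /linesF/andP[S1 S2] /flatmapP[G /mem_prefixes[G' eG]].
case/flatmapP=> D /mem_prefixes[D' eD] /flatmapP[u uw /mapP[v vw ->]] /=.
move: uw vw; rewrite !mem_words => /andP[_ uF] /andP[_ vF].
by move: S1 S2; rewrite eG eD !all_cat uF vF => /andP[-> _] /andP[-> _].
Qed.

Let w60 : 60 <= 60 := isT.
Let w8 : 8 <= 60 := isT.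

Local Notation "u |= v" := (ent hyps F lines 60 [::] [::] u v) (at level 70, no associativity).

Lemma F_zero : Zero \in F.
Proof. exact: mem_formulas. Qed.

Lemma F_one : One \in F.
Proof. exact: mem_formulas. Qed.

Lemma F_or A B : Or A B \in F -> A \in F /\ B \in F.
Proof. exact: formulas_or. Qed.

Lemma F_dec A p B : Dec A p B \in F -> [/\ A \in F, B \in F & pvar p \in F].
Proof. exact: formulas_dec. Qed.

Lemma simulate_and P Q : And P Q \in L -> is_coeNDT P -> is_coeNDT Q ->
  [/\ [:: star nm L (And P Q)] |= [:: star nm L P],
      [:: star nm L (And P Q)] |= [:: star nm L Q]
    & [:: star nm L P; star nm L Q] |= [:: star nm L (And P Q)]].
Proof.
apply: (@star_and ua xa L nm hyps F lines 60 linesF w60 ctx0 F_zero F_one F_or F_dec F_ev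
  F_rhs hyps_in (nodes_view_closed usP) F_star (@nodes_subs_closed us xs ls)).
Qed.

Lemma simulate_Uvar i : i < size us ->
  [:: star nm L (Uvar i)] |= [:: star nm L (nth Zero us i)] /\
  [:: star nm L (nth Zero us i)] |= [:: star nm L (Uvar i)].
Proof.
move=> iu; have [UL iL] := nodes_Uvar xs ls usP iu; have [cU _] := usP iu.
apply: (@star_Uvar ua xa L nm hyps F lines 60 linesF w60 ctx0 F_zero F_one F_or F_dec F_ev
  F_rhs hyps_in (nodes_view_closed usP) F_star (@nodes_subs_closed us xs ls)) => //.
by rewrite view_Uvar (nth_map Zero).
Qed.

Lemma ent_prv u v : u |= v -> prv hyps cand (u, v).
Proof. by case. Qed.

Lemma simulate_line S : S \in ls -> prv hyps cand (star_sequent nm L S).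
Proof.
suff h l1 l2 : ls = l1 ++ l2 -> forall T, T \in l1 -> prv hyps cand (star_sequent nm L T).
  by move=> Sl; apply: (h ls [::]); rewrite ?cats0.
elim/last_ind: l1 l2 => [|l1 T IHl] l2 els U //; rewrite mem_rcons inE.
rewrite cat_rcons in els; case/predU1P=> [->{U}|]; last exact: IHl els U.
have {}IHl := IHl _ els; have Tls : T \in ls by rewrite els mem_cat mem_head orbT.
have Tc : star_sequent nm L T \in cand by apply/cand_line/map_f.
have [overT [[|]|[ps psl R]]] := lsP els.
- case=> i iu; have [u1 u2] := simulate_Uvar iu.
  by case=> ->; apply: ent_prv.
(* The right-hand side of [NX i] is by definition the translation of [X_i], so the translated axiom
   is itself a hypothesis. *)
- case=> i ix eT; apply: prv_hyp => //.
  have iX : NX i \in the_names xa L.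
    rewrite /the_names /names !mem_cat; apply/orP; right; apply/orP; right.
    have -> : [seq NX x.1 | x <- xa] = [seq NX j | j <- iota 0 (size xs)].
      by elim: (xs) 0 => //= X s IHs j; rewrite IHs.
    by apply: map_f; rewrite mem_iota.
  have [h1 h2] := hyps_in iX; rewrite /= -[i in lookup _ _ i]add0n lookup_number_from in h1 h2.
  by case: eT => ->.
case: R psl Tls Tc overT {els} => [{}ps {}T R|G D P Q|G D P Q] psl Tls Tc overT.
- apply: prv_rule Tc (star_rule nm L R) _ => _ /mapP[U /psl Ul ->]; exact: IHl.
- have PQL : And P Q \in L by apply: (mem_lines Tls); rewrite /= mem_cat mem_rcons mem_head.
  have /andP[cP cQ] : is_coeNDT P && is_coeNDT Q.
    move: overT; rewrite /sequent_over /= all_rcons => /andP[/andP[+ _] _].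
    by rewrite /= orbF.
  have [r1 r2 _] := simulate_and PQL cP cQ.
  have PL : P \in L by apply: (nodes_subs_closed PQL); rewrite /= inE mem_cat mem_subs_self orbT.
  have QL : Q \in L by apply: (nodes_subs_closed PQL); rewrite /= inE mem_cat mem_subs_self !orbT.
  have PF := F_star PL; have QF := F_star QL; have RF := F_star PQL.
  have c : context lines (map (star nm L) G) (map (star nm L) D).
    exists (star_sequent nm L (rcons G (And P Q), D)); first exact: map_f.
    rewrite /= map_rcons; split; apply/mem_prefixes; last by exists [::]; rewrite cats0.
    by eexists; rewrite -cats1.
  have prem : ent hyps F lines 60 (map (star nm L) G) (map (star nm L) D)
      [:: star nm L P; star nm L Q] [::].
    split; rewrite //= ?PF ?QF //.
    have := IHl _ (psl _ (mem_head _ _)).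
    by rewrite /star_sequent /= !map_rcons /pv cats0 -!cats1 -catA.
  (* With the sequents of [star_and] moved into the context of the line, the conjunction rule
     becomes a propositional consequence. *)
  have {}r1 := ent_lift linesF w8 c r1; have {}r2 := ent_lift linesF w8 c r2.
  have : ent hyps F lines 60 (map (star nm L) G) (map (star nm L) D)
      [:: star nm L (And P Q)] [::].
    apply: (ent_sem linesF w8 c (known_cons prem (known_cons r1 (known_cons r2
      (known_nil _ _ _ _ _ _))))) => //; first by rewrite all_seq1.
    by move=> val; rewrite ![all _ _]/= ![has _ _]/=; repeat (case: (val _) => //=).
  by case=> _ _ _ _; rewrite /pv /star_sequent /= map_rcons cats0 cats1.
have PQL : And P Q \in L.
  by apply: (mem_lines Tls); rewrite /= mem_cat mem_rcons mem_head orbT.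
have /andP[cP cQ] : is_coeNDT P && is_coeNDT Q.
  move: overT; rewrite /sequent_over /= all_rcons => /and3P[_ + _].
  by rewrite /= orbF.
have [_ _ r3] := simulate_and PQL cP cQ.
have PL : P \in L by apply: (nodes_subs_closed PQL); rewrite /= inE mem_cat mem_subs_self orbT.
have QL : Q \in L by apply: (nodes_subs_closed PQL); rewrite /= inE mem_cat mem_subs_self !orbT.
have PF := F_star PL; have QF := F_star QL; have RF := F_star PQL.
have c : context lines (map (star nm L) G) (map (star nm L) D).
  exists (star_sequent nm L (G, rcons D (And P Q))); first exact: map_f.
  rewrite /= map_rcons; split; apply/mem_prefixes; first by exists [::]; rewrite cats0.
  by eexists; rewrite -cats1.
have prem C : star nm L C \in F -> (G, rcons D C) \in [:: (G, rcons D P); (G, rcons D Q)] ->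
    ent hyps F lines 60 (map (star nm L) G) (map (star nm L) D) [::] [:: star nm L C].
  move=> CF Cps; split; rewrite //= ?CF //.
  by have := IHl _ (psl _ Cps); rewrite /star_sequent /= map_rcons /pv cats0 cats1.
have p1 := prem P PF (mem_head _ _); have p2 : _ := prem Q QF _.
rewrite !inE eqxx orbT in p2; have {}p2 := p2 isT.
have {}r3 := ent_lift linesF w8 c r3.
have : ent hyps F lines 60 (map (star nm L) G) (map (star nm L) D)
    [::] [:: star nm L (And P Q)].
  apply: (ent_sem linesF w8 c (known_cons p1 (known_cons p2 (known_cons r3
    (known_nil _ _ _ _ _ _))))) => //; first by rewrite all_seq1.
  by move=> val; rewrite ![all _ _]/= ![has _ _]/=; repeat (case: (val _) => //=).
by case=> _ _ _ _; rewrite /pv /star_sequent /= map_rcons cats0 cats1.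
Qed.

Lemma F_eNDT : all is_eNDT F.
Proof.
apply: formulas_all => // A; rewrite !mem_cat => h; apply: is_eNDT_subs.
case/or4P: h => [||/mapP[n _ ->]|/mapP[P _ ->]].
- by rewrite !inE => /or3P[] /eqP->.
- by case/mapP=> n _ ->.
- exact: is_eNDT_rhs.
exact: is_eNDT_star.
Qed.

Lemma hyps_sound S : S \in hyps -> extension_hyp Evar (the_axioms ua xa L) S.
Proof.
case/flatmapP=> n nn h; exists (index n (the_names xa L)); first by rewrite size_map index_mem.
have e : ev nm n = Evar (index n (the_names xa L)).
  by rewrite /ev /the_table -[X in table X]cats0 lookup_table.
rewrite (nth_map n) ?index_mem // nth_index //.
by move: h; rewrite !inE e => /orP[] /eqP->; [left|right].
Qed.

Lemma simulation S : ends_with ls S -> sequent_over is_NDT S ->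
  eLNDT_proves (ELNDTPf (the_axioms ua xa L) (the_lines ua xa L ls)) S.
Proof.
move=> [l els] /andP[S1 S2].
have eS : star_sequent nm L S = S.
  rewrite /star_sequent [RHS]surjective_pairing; congr (_, _); apply: map_id_in => A AS.
    by apply: star_NDT; apply: (allP S1).
  by apply: star_NDT; apply: (allP S2).
have Sl : S \in ls by rewrite els mem_rcons mem_head.
have elast : last ([::], [::]) lines = S by rewrite {3}els map_rcons last_rcons.
have sat : S \in saturation hyps F cand.
  rewrite -{1}eS; apply: saturation_complete (simulate_line Sl) => T A /candF/andP[_ /allP].
  by apply.
have candE : all (sequent_over is_eNDT) cand.
  apply/allP => T /candF/andP[/allP T1 /allP T2].
  by apply/andP; split; apply/allP => A; [move/T1|move/T2] => /(allP F_eNDT).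
have der := saturation_derivation (F := F) candE hyps_sound.
split.
- apply: (the_axioms_eNDT (nodes_view_closed usP) xsP) => P Px; apply: nodes_subs_closed.
  by apply: nodes_forms; rewrite mem_cat Px orbT.
(* The appended line repeats a sequent of the saturation and inherits its justification. *)
- rewrite /= /the_lines elast => l1 T l2 e; case/lastP: l2 e => [|l2 T'].
    rewrite cats1 => /rcons_inj[<- <-]; case/splitPr: sat (der) => m1 m2 der'.
    have [over [h|[ps pss R]]] := der' m1 S m2 erefl; split=> //; [by left|right].
    by exists ps => // U /pss Um; rewrite mem_cat Um.
  by rewrite -rcons_cons -rcons_cat => /rcons_inj[/der].
by exists (saturation hyps F cand); rewrite /= /the_lines elast.
Qed.

End Simulation.

Lemma translate_correct (pi : eLEADT_pf) (Sigma Pi : seq form) :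
  all is_NDT Sigma -> all is_NDT Pi ->
  eLEADT_proves pi (Sigma, Pi) -> eLNDT_proves (translate pi) (Sigma, Pi).
Proof.
case: pi => us xs ls NS NP [/= usP xsP lsP ends]; apply: simulation => //=.
  by case: ends => l ->; case: l.
by rewrite /sequent_over NS NP.
Qed.

(** * Polynomial time: formulas, names and tables *)

Lemma tag_inj : injective Defs.tag.
Proof. by elim=> [|m IHm] [|n] //= [/IHm->]. Qed.

(** One tag value is split off at a time, and each branch is considered on the subtype of objects
    with that tag, where the shape of the code is known. *)
Lemma PT_switch n (A B : Type) {cA : codable A} {cB : codable B} (tg : A -> nat) e (h : A -> B) :
  only0 e -> (forall s a, s 0 = code a -> eval s e = Defs.tag (tg a)) -> (forall a, tg a < n) ->
  (forall i, i < n -> PT (fun a : {a | tg a == i} => h (sval a))) -> PT h.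
Proof.
elim: n A cA tg h => [|n IHn] A cA tg h e0 eE tgn pth.
  by apply: (@PT_expr _ _ _ _ ENil) => // s a; move: (tgn a); rewrite ltn0.
apply: (@PT_if_sig _ _ _ _ (fun a => tg a == n)); last 1 first.
- apply: (IHn _ _ (fun a => tg (sval a)) _ e0 (fun s a => eE s (sval a))) => [[a na]|i ni] /=.
    by rewrite ltn_neqAle na -ltnS tgn.
  apply: (@PT_via _ _ _ _ _ _ (EVar 0) _ _ _ (pth i (ltnW ni))) => // -[[a na] ai].
  by exists (exist _ a ai).
- apply: (@PT_expr _ _ _ _ (EEq e (dexpr (Defs.tag n)))); first by rewrite /= e0 only0_dexpr.
  move=> s a s0 /=; rewrite (eE s a s0) eval_dexpr.
  by case: eqP => [/tag_inj->|h']; [rewrite eqxx|case: eqP => // e'; case: h'; rewrite e'].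
exact: pth.
Qed.

Section FormMatch.
Context {X B : Type} {cX : codable X} {cB : codable B}.

Definition form_ctor (A : form) : nat :=
  match A with
  | Zero => 0 | One => 1 | Dec _ _ _ => 2 | Or _ _ => 3 | And _ _ => 4
  | Evar _ => 5 | Uvar _ => 6 | Xvar _ => 7
  end.

Lemma PT_form_match (h : X -> form -> B) (f : X -> form) : PT f ->
  PT (fun x => h x Zero) -> PT (fun x => h x One) ->
  PT (fun y : X * (form * nat * form) => h y.1 (Dec y.2.1.1 y.2.1.2 y.2.2)) ->
  PT (fun y : X * (form * form) => h y.1 (Or y.2.1 y.2.2)) ->
  PT (fun y : X * (form * form) => h y.1 (And y.2.1 y.2.2)) ->
  PT (fun y : X * nat => h y.1 (Evar y.2)) ->
  PT (fun y : X * nat => h y.1 (Uvar y.2)) ->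
  PT (fun y : X * nat => h y.1 (Xvar y.2)) ->
  PT (fun x => h x (f x)).
Proof.
move=> ptf pt0 pt1 pt2 pt3 pt4 pt5 pt6 pt7.
have pth : PT (fun y : X * form => h y.1 y.2); last by apply: (PT_comp2 pth) => //; apply: PT_id.
pose hd := EHd (EVar 0); pose rest := ETl (ETl (EVar 0)).
apply: (@PT_switch 8 _ _ _ _ (fun y : X * form => form_ctor y.2) (EHd (ETl (EVar 0)))) => //.
- by move=> s [x A] /= ->; case: A.
- by case=> x [].
do 8?[case=> [_|]]; last by [].
- apply: (@PT_via _ _ _ _ _ _ hd _ _ _ pt0) => // -[[x []]] //= ?.
  by exists x => // s /= ->.
- apply: (@PT_via _ _ _ _ _ _ hd _ _ _ pt1) => // -[[x []]] //= ?.
  by exists x => // s /= ->.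
- apply: (@PT_via _ _ _ _ _ _ (ECons hd (ECons (ECons (EHd rest) (EHd (ETl rest)))
    (EHd (ETl (ETl rest))))) _ _ _ pt2) => // -[[x []]] //= A p C ?.
  by exists (x, (A, p, C)) => // s /= ->.
- apply: (@PT_via _ _ _ _ _ _ (ECons hd (ECons (EHd rest) (EHd (ETl rest)))) _ _ _ pt3) => // -[[x []]] //= A C ?.
  by exists (x, (A, C)) => // s /= ->.
- apply: (@PT_via _ _ _ _ _ _ (ECons hd (ECons (EHd rest) (EHd (ETl rest)))) _ _ _ pt4) => // -[[x []]] //= A C ?.
  by exists (x, (A, C)) => // s /= ->.
- apply: (@PT_via _ _ _ _ _ _ (ECons hd (EHd rest)) _ _ _ pt5) => // -[[x []]] //= i ?.
  by exists (x, i) => // s /= ->.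
- apply: (@PT_via _ _ _ _ _ _ (ECons hd (EHd rest)) _ _ _ pt6) => // -[[x []]] //= i ?.
  by exists (x, i) => // s /= ->.
apply: (@PT_via _ _ _ _ _ _ (ECons hd (EHd rest)) _ _ _ pt7) => // -[[x []]] //= i ?.
by exists (x, i) => // s /= ->.
Qed.

End FormMatch.

(** * Codes of names and constructors as polynomial-time functions *)

Fixpoint enc_name (n : name) : data :=
  match n with
  | NC k c => Node (Defs.tag 0) (code (k, c))
  | NT k c A B m a => Node (Defs.tag 1) (code (k, c, A, B, m, a))
  | NW P n => Node (Defs.tag 2) (Node (code P) (enc_name n))
  | ND k c => Node (Defs.tag 3) (code (k, c))
  | NH P c => Node (Defs.tag 4) (code (P, c))
  | NX i => Node (Defs.tag 5) (code i)
  end.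

Lemma enc_name_inj : injective enc_name.
Proof.
have sinj := enc_seq_inj enc_form_inj.
elim=> [k c|k c A B m a|P n IHn|k c|P c|i] [k' c'|k' c' A' B' m' a'|P' n'|k' c'|P' c'|i'] // e.
- by case: e => /sinj-> /sinj->.
- by case: e => /sinj-> /sinj-> /enc_form_inj-> /enc_form_inj-> /sinj-> /sinj->.
- by case: e => /enc_form_inj-> /IHn->.
- by case: e => /sinj-> /sinj->.
- by case: e => /enc_form_inj-> /sinj->.
by case: e => /enc_nat_inj->.
Qed.

#[global] Instance codable_name : codable name := Codable enc_name_inj.

Section NameMatch.
Context {X B : Type} {cX : codable X} {cB : codable B}.

Definition name_ctor (n : name) : nat :=
  match n with
  | NC _ _ => 0 | NT _ _ _ _ _ _ => 1 | NW _ _ => 2 | ND _ _ => 3 | NH _ _ => 4 | NX _ => 5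
  end.

Lemma PT_name_match (h : X -> name -> B) (f : X -> name) : PT f ->
  PT (fun y : X * (seq form * seq form) => h y.1 (NC y.2.1 y.2.2)) ->
  PT (fun y : X * (seq form * seq form * form * form * seq form * seq form) =>
    h y.1 (NT y.2.1.1.1.1.1 y.2.1.1.1.1.2 y.2.1.1.1.2 y.2.1.1.2 y.2.1.2 y.2.2)) ->
  PT (fun y : X * (form * name) => h y.1 (NW y.2.1 y.2.2)) ->
  PT (fun y : X * (seq form * seq form) => h y.1 (ND y.2.1 y.2.2)) ->
  PT (fun y : X * (form * seq form) => h y.1 (NH y.2.1 y.2.2)) ->
  PT (fun y : X * nat => h y.1 (NX y.2)) ->
  PT (fun x => h x (f x)).
Proof.
move=> ptf pt0 pt1 pt2 pt3 pt4 pt5.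
have pth : PT (fun y : X * name => h y.1 y.2); last by apply: (PT_comp2 pth) => //; apply: PT_id.
pose ex := ECons (EHd (EVar 0)) (ETl (ETl (EVar 0))).
apply: (@PT_switch 6 _ _ _ _ (fun y : X * name => name_ctor y.2) (EHd (ETl (EVar 0)))) => //.
- by move=> s [x n] /= ->; case: n.
- by case=> x [].
do 6?[case=> [_|]]; last by [].
- apply: (@PT_via _ _ _ _ _ _ ex _ _ _ pt0) => // -[[x []]] //= k c ?.
  by exists (x, (k, c)) => // s /= ->.
- apply: (@PT_via _ _ _ _ _ _ ex _ _ _ pt1) => // -[[x []]] //= k c A C m a ?.
  by exists (x, (k, c, A, C, m, a)) => // s /= ->.
- apply: (@PT_via _ _ _ _ _ _ ex _ _ _ pt2) => // -[[x []]] //= P n ?.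
  by exists (x, (P, n)) => // s /= ->.
- apply: (@PT_via _ _ _ _ _ _ ex _ _ _ pt3) => // -[[x []]] //= k c ?.
  by exists (x, (k, c)) => // s /= ->.
- apply: (@PT_via _ _ _ _ _ _ ex _ _ _ pt4) => // -[[x []]] //= P c ?.
  by exists (x, (P, c)) => // s /= ->.
apply: (@PT_via _ _ _ _ _ _ ex _ _ _ pt5) => // -[[x []]] //= i ?.
by exists (x, i) => // s /= ->.
Qed.

End NameMatch.

Section Constructors.
Context {X : Type} {cX : codable X}.

Lemma PT_Dec (f : X -> form) (g : X -> nat) (h : X -> form) : PT f -> PT g -> PT h ->
  PT (fun x => Dec (f x) (g x) (h x)).
Proof.
apply: PT_comp3; apply: (@PT_expr _ _ _ _ (ECons (dexpr (Defs.tag 2)) (ECons (EHd (EHd (EVar 0)))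
  (ECons (ETl (EHd (EVar 0))) (ECons (ETl (EVar 0)) ENil))))) => // s a /= -> //.
Qed.

Lemma PT_Or (f g : X -> form) : PT f -> PT g -> PT (fun x => Or (f x) (g x)).
Proof.
apply: PT_comp2; apply: (@PT_expr _ _ _ _ (ECons (dexpr (Defs.tag 3)) (ECons (EHd (EVar 0))
  (ECons (ETl (EVar 0)) ENil)))) => // s a /= -> //.
Qed.

Lemma PT_And (f g : X -> form) : PT f -> PT g -> PT (fun x => And (f x) (g x)).
Proof.
apply: PT_comp2; apply: (@PT_expr _ _ _ _ (ECons (dexpr (Defs.tag 4)) (ECons (EHd (EVar 0))
  (ECons (ETl (EVar 0)) ENil)))) => // s a /= -> //.
Qed.

Lemma PT_Evar (f : X -> nat) : PT f -> PT (fun x => Evar (f x)).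
Proof.
move=> ptf; apply: (PT_comp ptf); apply: (@PT_expr _ _ _ _ (ECons (dexpr (Defs.tag 5))
  (ECons (EVar 0) ENil))) => // s a /= -> //.
Qed.

Lemma PT_Uvar (f : X -> nat) : PT f -> PT (fun x => Uvar (f x)).
Proof.
move=> ptf; apply: (PT_comp ptf); apply: (@PT_expr _ _ _ _ (ECons (dexpr (Defs.tag 6))
  (ECons (EVar 0) ENil))) => // s a /= -> //.
Qed.

Lemma PT_Xvar (f : X -> nat) : PT f -> PT (fun x => Xvar (f x)).
Proof.
move=> ptf; apply: (PT_comp ptf); apply: (@PT_expr _ _ _ _ (ECons (dexpr (Defs.tag 7))
  (ECons (EVar 0) ENil))) => // s a /= -> //.
Qed.

Lemma PT_pvar (f : X -> nat) : PT f -> PT (fun x => pvar (f x)).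
Proof. by move=> ptf; apply: PT_Dec => //; apply: PT_const. Qed.

Lemma PT_NC (f g : X -> seq form) : PT f -> PT g -> PT (fun x => NC (f x) (g x)).
Proof.
by apply: PT_comp2; apply: (@PT_expr _ _ _ _ (ECons (dexpr (Defs.tag 0)) (EVar 0))) => // s a /= ->.
Qed.

Lemma PT_ND (f g : X -> seq form) : PT f -> PT g -> PT (fun x => ND (f x) (g x)).
Proof.
by apply: PT_comp2; apply: (@PT_expr _ _ _ _ (ECons (dexpr (Defs.tag 3)) (EVar 0))) => // s a /= ->.
Qed.

Lemma PT_NH (f : X -> form) (g : X -> seq form) : PT f -> PT g -> PT (fun x => NH (f x) (g x)).
Proof.
by apply: PT_comp2; apply: (@PT_expr _ _ _ _ (ECons (dexpr (Defs.tag 4)) (EVar 0))) => // s a /= ->.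
Qed.

Lemma PT_NW (f : X -> form) (g : X -> name) : PT f -> PT g -> PT (fun x => NW (f x) (g x)).
Proof.
by apply: PT_comp2; apply: (@PT_expr _ _ _ _ (ECons (dexpr (Defs.tag 2)) (EVar 0))) => // s a /= ->.
Qed.

Lemma PT_NX (f : X -> nat) : PT f -> PT (fun x => NX (f x)).
Proof.
move=> ptf; apply: (PT_comp ptf).
by apply: (@PT_expr _ _ _ _ (ECons (dexpr (Defs.tag 5)) (EVar 0))) => // s a /= ->.
Qed.

Lemma PT_NT (k c : X -> seq form) (A B : X -> form) (m a : X -> seq form) :
  PT k -> PT c -> PT A -> PT B -> PT m -> PT a ->
  PT (fun x => NT (k x) (c x) (A x) (B x) (m x) (a x)).
Proof.
move=> ptk ptc ptA ptB ptm pta.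
apply: (PT_comp (f := fun x => (k x, c x, A x, B x, m x, a x))
  (g := fun y => NT y.1.1.1.1.1 y.1.1.1.1.2 y.1.1.1.2 y.1.1.2 y.1.2 y.2)).
  by do 5?apply: PT_pair.
apply: (@PT_expr _ _ _ _ (ECons (dexpr (Defs.tag 1)) (EVar 0))) => // s a0 /= ->.
by case: a0 => [[[[[]]]]].
Qed.

End Constructors.

(** * Binary successor and numbering of lists *)

Fixpoint bits_succ (s : seq bool) : seq bool :=
  match s with
  | [::] => [:: true]
  | false :: s' => true :: s'
  | true :: s' => false :: bits_succ s'
  end.

Lemma bits_nat_succ n : bits_nat n.+1 = bits_succ (bits_nat n).
Proof.
have bits_pos_succ p : bits_pos (Pos.succ p) = bits_succ (bits_pos p).
  by elim: p => //= p ->.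
rewrite /bits_nat -{1}[n]bin_of_natK; case: (bin_of_nat n) => [|p] //.
by rewrite -[(nat_of_bin _).+1]nat_of_succ_pos (nat_of_binK (Npos _)) bits_pos_succ.
Qed.

Lemma dsz_bits_succ s : dsz (bits_succ s) <= dsz s + 4.
Proof.
elim: s => [|[] s IHs] //=; rewrite !dsz_cons.
  have: dsz true = 3 by []. have: dsz false = 1 by []. lia.
have: dsz true = 3 by []. have: dsz false = 1 by []. lia.
Qed.

(** A crude bound for a binary notation, but sufficient: the numbers produced are positions in
    lists. *)
Lemma dsz_nat n : dsz n <= 4 * n + 1.
Proof.
have e m : dsz m = dsz (bits_nat m) by [].
elim: n => // n; rewrite !e; have := dsz_bits_succ (bits_nat n); rewrite -bits_nat_succ; lia.
Qed.

Lemma PT_succ (X : Type) {cX : codable X} (f : X -> nat) : PT f -> PT (fun x => (f x).+1).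
Proof.
move=> ptf; apply: (PT_comp ptf (g := succn)).
apply: (@PT_recode _ _ _ _ _ _ (fun n => bits_succ (bits_nat n))).
  by move=> n; rewrite -bits_nat_succ.
apply: (PT_comp (g := bits_succ)); first by apply: PT_recode PT_id.
(* The state is the carry together with the bits written so far, in reverse. *)
pose step (r : bool * seq bool) b := if r.1 then (b, ~~ b :: r.2) else (false, b :: r.2).
have stepF s u : foldl step (false, u) s = (false, catrev s u).
  by elim: s u => //= b s IHs u; rewrite /step /= -/step IHs.
have bE s u : catrev u (bits_succ s) =
    let r := foldl step (true, u) s in rev (if r.1 then true :: r.2 else r.2).
  elim: s u => [|[] s IHs] u //=; first exact: (IHs (false :: u)).
  by rewrite stepF /= !catrevE rev_cat rev_cons revK cat_rcons.
apply: (@eq_PT _ _ _ _ (fun s => let r := foldl step (true, [::]) s in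
  rev (if r.1 then true :: r.2 else r.2))); first by move=> s; rewrite -bE.
have ptr : PT (fun s => foldl step (true, [::]) s).
  apply: (@PT_foldl (seq bool) bool _ _ _ _ (fun=> step) id (fun=> (true, [::]))
    (fun n => 5 * n + 5)).
  - have p11 : PT (fun y : seq bool * (bool * seq bool) * bool => y.1.2.1) by exact/PT_fst/PT_snd/PT_fst/PT_id.
    have p12 : PT (fun y : seq bool * (bool * seq bool) * bool => y.1.2.2) by exact/PT_snd/PT_snd/PT_fst/PT_id.
    have p2 : PT (fun y : seq bool * (bool * seq bool) * bool => y.2) by exact/PT_snd/PT_id.
    apply: PT_if => //; apply: PT_pair => //; first by apply: PT_cons => //; apply: PT_negb.
      exact: PT_const.
    exact: PT_cons.
  - exact: PT_id.
  - exact: PT_const.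
  - by poly_tac.
  move=> s s1 s2 ->.
  have bb (b : bool) : dsz b <= 3 by case: b.
  have h r : dsz (foldl step r s1).2 <= dsz r.2 + 4 * size s1.
    elim: s1 r => [|b s1 IHs] r /=; first by rewrite addn0.
    apply: leq_trans (IHs _) _; rewrite /step; case: r.1 => /=; rewrite dsz_cons.
      by have := bb (~~ b); lia.
    by have := bb b; lia.
  have := h (true, [::]); rewrite [X in dsz X <= _ + _ -> _]/= .
  case: (foldl step _ s1) => r1 r2 /=; rewrite dsz_nil dsz_pair => hr.
  pose proof (size_dsz s1); pose proof (dsz_cat s1 s2); pose proof (dsz_gt0 s2).
  have := bb r1; lia.
apply: PT_rev; apply: PT_if; first exact: PT_fst.
  by apply: PT_cons; [exact: PT_const|exact: PT_snd].
exact: PT_snd.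
Qed.

Lemma PT_number_from (X T : Type) {cX : codable X} {cT : codable T} (f : X -> seq T) :
  PT f -> PT (fun x => number_from 0 (f x)).
Proof.
move=> ptf; apply: (PT_comp ptf (g := number_from 0)).
pose step (r : nat * seq (nat * T)) a := (r.1.+1, (r.1, a) :: r.2).
have stepE s i u : foldl step (i, u) s = (i + size s, catrev (number_from i s) u).
  by elim: s i u => [|a s IHs] i u /=; rewrite ?addn0 // /step /= -/step IHs addSnnS.
apply: (@eq_PT _ _ _ _ (fun s => rev (foldl step (0, [::]) s).2)).
  by move=> s; rewrite stepE /= !catrevE cats0 revK.
apply/PT_rev/PT_snd.
apply: (@PT_foldl (seq T) T _ _ _ _ (fun=> step) id (fun=> (0, [::]))
    (fun n => 5 + 4 * n + n * (5 * n + 5))).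
- have p1 : PT (fun y : seq T * (nat * seq (nat * T)) * T => y.1.2.1) by exact/PT_fst/PT_snd/PT_fst/PT_id.
  have p2 : PT (fun y : seq T * (nat * seq (nat * T)) * T => y.1.2.2) by exact/PT_snd/PT_snd/PT_fst/PT_id.
  have p3 : PT (fun y : seq T * (nat * seq (nat * T)) * T => y.2) by exact/PT_snd/PT_id.
  apply: PT_pair; first exact: PT_succ.
  by apply: PT_cons => //; apply: PT_pair.
- exact: PT_id.
- exact: PT_const.
- by poly_tac.
move=> s s1 s2 es; rewrite stepE dsz_pair add0n.
have h i u : dsz (catrev (number_from i s1) u) + 1 <= dsz u + dsz s1 + size s1 * (4 * (i + size s1) + 2).
  elim: s1 i u {es} => [|a s1 IHs] i u /=; first by rewrite dsz_nil; lia.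
  have := IHs i.+1 ((i, a) :: u); rewrite !dsz_cons dsz_pair; have := dsz_nat i; nia.
have := h 0 [::]; rewrite dsz_nil; have := dsz_nat (size s1).
pose proof (size_dsz s1); pose proof (dsz_cat s1 s2); pose proof (dsz_gt0 s2).
rewrite -es in H0; rewrite [dsz (id s)]/=; nia.
Qed.

Section CompN.
Context {X A1 A2 A3 A4 A5 A6 A7 B : Type}.
Context {cX : codable X} {c1 : codable A1} {c2 : codable A2} {c3 : codable A3}
  {c4 : codable A4} {c5 : codable A5} {c6 : codable A6} {c7 : codable A7} {cB : codable B}.
Variables (f1 : X -> A1) (f2 : X -> A2) (f3 : X -> A3) (f4 : X -> A4) (f5 : X -> A5)
  (f6 : X -> A6) (f7 : X -> A7).
Hypotheses (p1 : PT f1) (p2 : PT f2) (p3 : PT f3) (p4 : PT f4).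

Lemma PT_comp4 (h : A1 -> A2 -> A3 -> A4 -> B) :
  PT (fun y : A1 * A2 * A3 * A4 => h y.1.1.1 y.1.1.2 y.1.2 y.2) ->
  PT (fun x => h (f1 x) (f2 x) (f3 x) (f4 x)).
Proof. by move=> pth; apply: (PT_comp (PT_pair (PT_pair (PT_pair p1 p2) p3) p4) pth). Qed.

Hypothesis p5 : PT f5.

Lemma PT_comp5 (h : A1 -> A2 -> A3 -> A4 -> A5 -> B) :
  PT (fun y : A1 * A2 * A3 * A4 * A5 => h y.1.1.1.1 y.1.1.1.2 y.1.1.2 y.1.2 y.2) ->
  PT (fun x => h (f1 x) (f2 x) (f3 x) (f4 x) (f5 x)).
Proof.
by move=> pth; apply: (PT_comp (PT_pair (PT_pair (PT_pair (PT_pair p1 p2) p3) p4) p5) pth).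
Qed.

Hypotheses (p6 : PT f6) (p7 : PT f7).

Lemma PT_comp7 (h : A1 -> A2 -> A3 -> A4 -> A5 -> A6 -> A7 -> B) :
  PT (fun y : A1 * A2 * A3 * A4 * A5 * A6 * A7 =>
    h y.1.1.1.1.1.1 y.1.1.1.1.1.2 y.1.1.1.1.2 y.1.1.1.2 y.1.1.2 y.1.2 y.2) ->
  PT (fun x => h (f1 x) (f2 x) (f3 x) (f4 x) (f5 x) (f6 x) (f7 x)).
Proof.
move=> pth; apply: (PT_comp (PT_pair (PT_pair (PT_pair (PT_pair (PT_pair (PT_pair
  p1 p2) p3) p4) p5) p6) p7) pth).
Qed.

End CompN.

Ltac pt_step :=
  lazymatch goal with
  | |- PT (fun x => x) => exact: PT_id
  | |- PT id => exact: PT_id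
  | |- PT (@fst _ _) => exact: (PT_fst PT_id)
  | |- PT (@snd _ _) => exact: (PT_snd PT_id)
  | |- PT (fun _ => ?b) => exact: PT_const
  | |- PT (fun x => (_, _)) => apply: PT_pair
  | |- PT (fun x => fst _) => apply: PT_fst
  | |- PT (fun x => snd _) => apply: PT_snd
  | |- PT (fun x => _ :: _) => apply: PT_cons
  | |- PT (fun x => cat _ _) => apply: PT_cat
  | |- PT (fun x => rcons _ _) => apply: PT_rcons
  | |- PT (fun x => rev _) => apply: PT_rev
  | |- PT (fun x => map _ _) => apply: PT_map
  | |- PT (fun x => filter _ _) => apply: PT_filter
  | |- PT (fun x => flatmap _ _) => apply: PT_flatmap
  | |- PT (flatmap ?f) => apply: (PT_flatmap (g := fun=> f) (l := id))
  | |- PT (fun x => has _ _) => apply: PT_has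
  | |- PT (fun x => all _ _) => apply: PT_all
  | |- PT (fun x => in_mem _ (mem _)) => apply: PT_mem
  | |- PT (fun x => eq_op _ _) => apply: PT_eq
  | |- PT (fun x => _ || _) => apply: PT_orb
  | |- PT (fun x => tails _) => apply: PT_tails
  | |- PT (fun x => prefixes _) => apply: PT_prefixes
  | |- PT (fun x => number_from 0 _) => apply: PT_number_from
  | |- PT (@tails _) => exact: (PT_tails PT_id)
  | |- PT (@prefixes _) => exact: (PT_prefixes PT_id)
  | |- PT (@rev _) => exact: (PT_rev PT_id)
  | |- PT (number_from 0) => exact: (PT_number_from PT_id)
  | |- PT (fun x => if _ then _ else _) => apply: PT_if
  | |- PT (fun x => Dec _ _ _) => apply: PT_Dec
  | |- PT (fun x => Or _ _) => apply: PT_Or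
  | |- PT (fun x => And _ _) => apply: PT_And
  | |- PT (fun x => Evar _) => apply: PT_Evar
  | |- PT (fun x => Uvar _) => apply: PT_Uvar
  | |- PT (fun x => Xvar _) => apply: PT_Xvar
  | |- PT (fun x => pvar _) => apply: PT_pvar
  | |- PT (fun x => NC _ _) => apply: PT_NC
  | |- PT (fun x => NT _ _ _ _ _ _) => apply: PT_NT
  | |- PT (fun x => NW _ _) => apply: PT_NW
  | |- PT (fun x => ND _ _) => apply: PT_ND
  | |- PT (fun x => NH _ _) => apply: PT_NH
  | |- PT (fun x => NX _) => apply: PT_NX
  end.

Ltac pt := repeat pt_step.

Lemma PT_lookup (K : eqType) (V : Type) {cK : codable K} {cV : codable V} (d : V) :
  PT (fun y : seq (K * V) * K => lookup d y.1 y.2).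
Proof. by rewrite /lookup; apply: PT_head; pt. Qed.

(** * Computing subformulas and translated formulas *)

Definition kids (A : form) : seq form :=
  match A with
  | Dec B _ C | Or B C | And B C => [:: B; C]
  | _ => [::]
  end.

Lemma PT_kids : PT kids.
Proof. by apply: (PT_form_match (h := fun _ => kids) PT_id) => /=; pt. Qed.

Lemma subsE A : subs A = A :: flatmap subs (kids A).
Proof. by case: A => //= *; rewrite /flatmap /= cats0. Qed.

Lemma dsz_Dec A p B : dsz (Dec A p B) = (5 + (dsz A + (dsz p + (dsz B + 1).+1).+1).+1).+1.
Proof. by []. Qed.

Lemma dsz_Or A B : dsz (Or A B) = (7 + (dsz A + (dsz B + 1).+1).+1).+1.
Proof. by []. Qed.

Lemma dsz_And A B : dsz (And A B) = (9 + (dsz A + (dsz B + 1).+1).+1).+1.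
Proof. by []. Qed.

Lemma dsz_Evar i : dsz (Evar i) = (11 + (dsz i + 1).+1).+1.
Proof. by []. Qed.

Lemma dsz_kids A : dsz (kids A) < dsz A.
Proof.
by case: A => // [A p B|A B|A B]; rewrite /= !dsz_cons dsz_nil ?dsz_Dec ?dsz_Or ?dsz_And; lia.
Qed.

Lemma size_subs A : size (subs A) < dsz A.
Proof.
elim: A => [||A IHA p B IHB|A IHA B IHB|A IHA B IHB|i|i|i] //=; rewrite size_cat.
- by rewrite dsz_Dec; lia.
- by rewrite dsz_Or; lia.
- by rewrite dsz_And; lia.
Qed.

Lemma dsz_subs (A B : form) : B \in subs A -> dsz B <= dsz A.
Proof.
elim: A => [||A IHA p C IHC|A IHA C IHC|A IHA C IHC|i|i|i] /=; rewrite inE;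
  try by (rewrite orbF => /eqP->) || by move/eqP->.
- case/predU1P=> [->//|]; rewrite mem_cat => /orP[/IHA|/IHC] h; rewrite dsz_Dec; lia.
- case/predU1P=> [->//|]; rewrite mem_cat => /orP[/IHA|/IHC] h; rewrite dsz_Or; lia.
- case/predU1P=> [->//|]; rewrite mem_cat => /orP[/IHA|/IHC] h; rewrite dsz_And; lia.
Qed.

(* Depth-first traversal with an explicit stack: the state consists of the stack and of
   the reversed output. *)
Definition dfs_step (r : seq form * seq form) : seq form * seq form :=
  if r.1 is A :: w then (kids A ++ w, A :: r.2) else r.

(** The output followed by the preorder of the stack is invariant. The stack never grows in size, as
    the list of immediate subformulas has a smaller code than the formula popped. *)
Lemma dfs_stepP i r : i <= size (flatmap subs r.1) ->
  exists w u, [/\ iter i dfs_step r = (w, u), size (flatmap subs w) + i = size (flatmap subs r.1),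
    rev u ++ flatmap subs w = rev r.2 ++ flatmap subs r.1, dsz w <= dsz r.1
    & dsz u <= dsz r.2 + i * (dsz r.1).+1].
Proof.
elim: i => [|i IHi] ir; first by case: r ir => w u _; exists w, u; split; rewrite ?addn0 //= mul0n addn0.
have [[|A w] [u [e1 e2 e3 e4 e5]]] := IHi (ltnW ir); first by move: ir; rewrite -e2 /= add0n ltnn.
exists (kids A ++ w), (A :: u).
have eA : flatmap subs (A :: w) = A :: flatmap subs (kids A ++ w).
  by rewrite /flatmap /= -/(flatmap _ _) subsE /= map_cat flatten_cat.
rewrite iterS e1; split=> //.
- by rewrite -e2 eA /= addnS.
- by rewrite -e3 eA rev_cons cat_rcons.
- rewrite dsz_cons in e4; pose proof (dsz_cat (kids A) w); have := dsz_kids A; lia.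
by rewrite dsz_cons in e4; rewrite dsz_cons mulSn; lia.
Qed.

Lemma PT_subs : PT subs.
Proof.
pose i0 (A : form) : seq form * seq form := ([:: A], [::]).
have sE A : flatmap subs (i0 A).1 = subs A by rewrite /flatmap /= cats0.
apply: (@eq_PT _ _ _ _ (fun A => rev (iter (size (subs A)) dfs_step (i0 A)).2)).
  move=> A; have [|w [u [-> e2 e3 _ _]]] := @dfs_stepP (size (subs A)) (i0 A); first by rewrite sE.
  move: e3; rewrite sE; case: w e2 => [|C w] /=.
    by rewrite cats0 => _ ->.
  rewrite sE /flatmap /= size_cat subsE /=; lia.
apply/PT_rev/PT_snd.
apply: (@PT_iter _ _ _ _ i0 (fun r => ~~ nilp r.1) dfs_step (fun A => size (subs A))
  (fun n => n.+2 + (1 + n * n.+3).+1)).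
- by rewrite /i0; pt.
- apply: (@eq_PT _ _ _ _ (fun r : seq form * seq form => ~~ (r.1 == [::]))).
    by case=> [[]].
  by apply: PT_negb; pt.
- apply: (PT_seq_match (h := fun (r : seq form * seq form) v =>
    if v is A :: w then (kids A ++ w, A :: r.2) else r)); pt.
  by apply: (PT_comp _ PT_kids); pt.
- by poly_tac.
- move=> A i iA; have [|w [u [-> e2 _ _ _]]] := @dfs_stepP i (i0 A); first by rewrite sE ltnW.
  by case: w e2 => // e2; move: iA; rewrite -(sE A) -e2 add0n ltnn.
- move=> A; have [|w [u [-> e2 _ _ _]]] := @dfs_stepP (size (subs A)) (i0 A); first by rewrite sE.
  by case: w e2 => [|C w] //; rewrite sE /flatmap /= size_cat subsE /=; lia.
- move=> A i iA; have [|w [u [-> _ _ e4 e5]]] := @dfs_stepP i (i0 A); first by rewrite sE.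
  rewrite -/(dsz (w, u)) -/(dsz A) dsz_pair.
  move: e4 e5; rewrite /= !dsz_cons dsz_nil; have := size_subs A; nia.
by move=> A; have := size_subs A; rewrite -/(dsz A); lia.
Qed.

Lemma PT_ev : PT (fun y : seq (name * nat) * name => ev y.1 y.2).
Proof. by apply/PT_Evar/PT_lookup. Qed.

Definition star_step (nm : seq (name * nat)) (L : seq form) (M : seq (form * form)) (P : form) :=
  match P with
  | Zero => Zero
  | One => One
  | Dec A p B => Dec (lookup Zero M A) p (lookup Zero M B)
  | Or A B => Or (lookup Zero M A) (lookup Zero M B)
  | And _ _ | Uvar _ => ev nm (NH P L)
  | Xvar i => ev nm (NX i)
  | Evar _ => Zero
  end.

(** The machine has no recursion on trees, so [star] is computed by dynamic programming: [subs]
    lists constituents after a formula, and a fold from the right finds their translations already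
    tabulated. *)
Definition star_table nm L (s : seq form) : seq (form * form) :=
  foldr (fun Q M => (Q, star_step nm L M Q) :: M) [::] s.

Fixpoint kids_in (s : seq form) : bool :=
  if s is Q :: k then all (fun A => A \in k) (kids Q) && kids_in k else true.

Lemma kids_in_subs A t : kids_in t -> kids_in (subs A ++ t).
Proof.
elim: A t => [||A IHA p B IHB|A IHA B IHB|A IHA B IHB|i|i|i] t tK //=;
by rewrite -catA IHA ?IHB // !mem_cat !mem_subs_self ?orbT.
Qed.

Lemma kids_in_suffix s t : kids_in (s ++ t) -> kids_in t.
Proof. by elim: s => //= Q s IHs /andP[_]. Qed.

Lemma lookup_map (K : eqType) (V : Type) (d : V) (g : K -> V) (s : seq K) k : k \in s ->
  lookup d [seq (x, g x) | x <- s] k = g k.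
Proof.
elim: s => //= x s IHs; rewrite /lookup /= inE eq_sym.
by case: (eqVneq x k) => [->|_] // /IHs.
Qed.

Lemma star_tableE nm L s : kids_in s -> star_table nm L s = [seq (Q, star nm L Q) | Q <- s].
Proof.
elim: s => //= Q k IHk /andP[Qk /IHk->]; congr cons; congr (_, _).
by case: Q Qk => //= [A p B|A B] /and3P[Ak Bk _]; rewrite !lookup_map.
Qed.

Lemma dsz_lookup (K : eqType) (V : Type) {cK : codable K} {cV : codable V} (d : V)
    (s : seq (K * V)) k : dsz (lookup d s k) <= dsz d + dsz s.
Proof.
elim: s => [|[a b] s IHs]; rewrite /lookup /=; first by rewrite leq_addr.
case: eqP => _ /=; rewrite dsz_cons dsz_pair; first by lia.
by move: IHs; rewrite /lookup; lia.
Qed.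

(** Each replaced subformula becomes a single variable whose index is stored in [nm], so the size is
    multiplied by at most the size of such a variable. *)
Lemma dsz_star nm L P : dsz (star nm L P) <= dsz P * (dsz nm + 20).
Proof.
have evb n : dsz (ev nm n) <= dsz nm + 20.
  rewrite /ev dsz_Evar.
  have h : dsz (lookup 0 nm n) <= dsz 0 + dsz nm by exact: dsz_lookup.
  have e0 : dsz 0 = 1 by []. lia.
have K0 : 20 <= dsz nm + 20 by rewrite leq_addl.
move: (dsz nm + 20) evb K0 => K evb K0.
have sm (A : form) : 0 < dsz A by apply: dsz_gt0.
have evP (A : form) n : dsz (ev nm n) <= dsz A * K.
  by apply: leq_trans (evb n) _; apply: leq_pmull.
elim: P => [||A IHA p B IHB|A IHA B IHB|A _ B _|i|i|i] /=; try exact: evP.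
- have -> : dsz Zero = 3 by []. lia.
- have -> : dsz One = 5 by []. lia.
- by rewrite !dsz_Dec; nia.
- by rewrite !dsz_Or; nia.
have -> : dsz Zero = 3 by []. have := sm (Evar i); nia.
Qed.

Lemma PT_star : PT (fun y : seq (name * nat) * seq form * form => star y.1.1 y.1.2 y.2).
Proof.
pose E := (seq (name * nat) * seq form * form)%type.
apply: (@eq_PT _ _ _ _ (fun y : E => lookup Zero (star_table y.1.1 y.1.2 (subs y.2)) y.2)).
  move=> y; rewrite star_tableE; last by have := @kids_in_subs y.2 [::]; rewrite cats0; apply.
  by rewrite lookup_map // mem_subs_self.
apply: (PT_comp2 (@PT_lookup _ _ _ _ Zero)); last by pt.
apply: (@PT_foldr E form (seq (form * form)) _ _ _
  (fun y Q M => (Q, star_step y.1.1 y.1.2 M Q) :: M) (fun y => subs y.2) (fun=> [::])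
  (fun n => (n * (n + n * (n + 20) + 1).+1).+1)).
- apply: PT_cons; last by pt.
  apply: PT_pair; first by pt.
  apply: (PT_form_match (h := fun (y : E * seq (form * form) * form) Q =>
     star_step y.1.1.1.1 y.1.1.1.2 y.1.2 Q)); rewrite /=; pt;
  solve [by apply: (PT_comp2 (@PT_lookup _ _ _ _ Zero)); pt | by apply: (PT_comp2 PT_ev); pt].
- by apply: (PT_comp _ PT_subs); pt.
- by pt.
- by poly_tac.
move=> [[nm L] P] s1 s2 es; rewrite -/(star_table nm L s2) star_tableE; last first.
  by apply: (@kids_in_suffix s1); rewrite -es; have := @kids_in_subs P [::]; rewrite cats0; apply.
rewrite /= in es; rewrite !dsz_pair.
apply: leq_trans (dsz_seq_le (m := dsz P + dsz P * (dsz nm + 20) + 1) _) _.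
  move=> t1 [Q Q'] t2 e.
  have [R Rs [-> ->]] : exists2 R : form, R \in s2 & (Q, Q') = (R, star nm L R).
    by apply/mapP; rewrite e mem_cat mem_head orbT.
  rewrite dsz_pair.
  have RP : dsz R <= dsz P by apply: dsz_subs; rewrite es mem_cat Rs orbT.
  pose proof (leq_mul RP (leqnn (dsz nm + 20))); have := dsz_star nm L R; lia.
rewrite size_map.
have sP : size s2 <= dsz P by have := size_subs P; rewrite es size_cat; lia.
set n := ((dsz nm + dsz L).+1 + dsz P).+1.
have hP : dsz P <= n by rewrite /n; lia.
have hm : dsz nm + 20 <= n + 20 by rewrite /n; lia.
have := leq_mul hP hm; rewrite ltnS => hPm.
by apply: leq_mul; lia.
Qed.

(** * Polynomial time: the translation *)

Ltac pt_call :=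
  lazymatch goal with
  | |- PT (fun x => ev _ _) => apply: (PT_comp2 PT_ev)
  | |- PT (fun x => star _ _ _) => apply: (PT_comp3 PT_star)
  | |- PT (fun x => lookup Zero _ _) => apply: (PT_comp2 (@PT_lookup _ _ _ _ Zero))
  | |- PT (fun x => subs _) => apply: (PT_comp _ PT_subs)
  | |- PT subs => exact: PT_subs
  | _ => pt_step
  end.

Ltac pts := rewrite /=; repeat pt_call.

Lemma PT_view : PT (fun y : seq (nat * form) * form => view y.1 y.2).
Proof.
apply: (PT_form_match (h := fun (y : seq (nat * form) * form) P => view y.1 P));
  rewrite /view; by pts.
Qed.

Lemma PT_rhs_W : PT (fun y : seq (nat * form) * seq (name * nat) * form * name =>
  rhs_W y.1.1.1 y.1.1.2 y.1.2 y.2).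
Proof.
rewrite /rhs_W; set E := (_ * _ * _ * _)%type.
apply: (PT_form_match (h := fun (y : E) P =>
  match P with
  | Zero => ev y.1.1.2 y.2
  | Dec A p B => Dec (ev y.1.1.2 (NW A y.2)) p (ev y.1.1.2 (NW B y.2))
  | And A B => Or (ev y.1.1.2 (NW A y.2)) (ev y.1.1.2 (NW B y.2))
  | _ => Zero
  end)); last 8 first; try by rewrite /E; pts.
by apply: (PT_comp2 PT_view); rewrite /E; pts.
Qed.

Lemma PT_unrefuted : PT (fun y : seq (nat * form) * seq (name * nat) * form * seq form * seq form =>
  unrefuted y.1.1.1.1 y.1.1.1.2 y.1.1.2 y.1.2 y.2).
Proof.
rewrite /unrefuted; set E := (_ * _ * _ * _ * _)%type.
apply: (PT_form_match (h := fun (y : E) P =>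
  match P with
  | Zero => Zero
  | Dec A p B => Dec (ev y.1.1.1.2 (NT y.1.2 y.2 A A y.1.2 y.2)) p
                     (ev y.1.1.1.2 (NT y.1.2 y.2 B B y.1.2 y.2))
  | And A B => ev y.1.1.1.2 (NT y.1.2 y.2 A B y.1.2 y.2)
  | _ => ev y.1.1.1.2 (NC y.1.2 y.2)
  end)); last 8 first; try by rewrite /E; pts.
by apply: (PT_comp2 PT_view); rewrite /E; pts.
Qed.

Lemma PT_rhs_C : PT (fun y : seq (nat * form) * seq (name * nat) * seq form * seq form =>
  rhs_C y.1.1.1 y.1.1.2 y.1.2 y.2).
Proof.
set E := (_ * _ * _ * _)%type.
apply: (PT_seq_match (h := fun (y : E) k => rhs_C y.1.1.1 y.1.1.2 k y.2)).
- by rewrite /E; pts.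
- apply: (PT_seq_match (h := fun (y : E) c => rhs_C y.1.1.1 y.1.1.2 [::] c));
    by rewrite /E; pts.
apply: PT_Or.
  by apply: PT_comp5 PT_unrefuted; rewrite /E; pts.
apply: (PT_seq_match (h := fun (y : E * (form * seq form)) c =>
  if c is _ :: c' then ev y.1.1.1.2 (NW y.2.1 (NC y.2.2 c')) else Zero));
  by rewrite /E; pts.
Qed.

Lemma PT_rhs_T : PT (fun y : seq (name * nat) * seq form * seq form * form * form * seq form * seq form =>
  rhs_T y.1.1.1.1.1.1 y.1.1.1.1.1.2 y.1.1.1.1.2 y.1.1.1.2 y.1.1.2 y.1.2 y.2).
Proof.
set E := (_ * _ * _ * _ * _ * _ * _)%type.
apply: (PT_seq_match (h := fun (y : E) m =>
  rhs_T y.1.1.1.1.1.1 y.1.1.1.1.1.2 y.1.1.1.1.2 y.1.1.1.2 y.1.1.2 m y.2)).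
- by rewrite /E; pts.
- apply: (PT_seq_match (h := fun (y : E) a =>
    rhs_T y.1.1.1.1.1.1 y.1.1.1.1.1.2 y.1.1.1.1.2 y.1.1.1.2 y.1.1.2 [::] a));
    by rewrite /E; pts.
apply: PT_if; try by rewrite /E; pts.
apply: PT_Or; first by rewrite /E; pts.
apply: (PT_seq_match (h := fun (y : E * (form * seq form)) a =>
  if a is _ :: a' then ev y.1.1.1.1.1.1.1 (NW y.2.1 (NT y.1.1.1.1.1.1.2 y.1.1.1.1.1.2
    y.1.1.1.1.2 y.1.1.1.2 y.2.2 a')) else Zero)); by rewrite /E; pts.
Qed.

Lemma PT_rhs_D : PT (fun y : seq (name * nat) * seq form * seq form => rhs_D y.1.1 y.1.2 y.2).
Proof.
set E := (_ * _ * _)%type; rewrite /rhs_D.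
apply: (PT_seq_match (h := fun (y : E) c =>
  if c is _ :: c' then Or (ev y.1.1 (ND y.1.2 c')) (ev y.1.1 (NC y.1.2 y.2))
  else ev y.1.1 (NC y.1.2 y.2))); by rewrite /E; pts.
Qed.

Lemma PT_rhs_H : PT (fun y : seq form * seq (name * nat) * form * seq form =>
  rhs_H y.1.1.1 y.1.1.2 y.1.2 y.2).
Proof.
set E := (_ * _ * _ * _)%type; rewrite /rhs_H.
apply: (PT_seq_match (h := fun (y : E) c =>
  let t := ev y.1.1.2 (NT y.1.1.1 y.2 y.1.2 y.1.2 y.1.1.1 y.2) in
  if c is _ :: c' then Or (ev y.1.1.2 (NH y.1.2 c')) t else t));
  by rewrite /E; pts.
Qed.

Lemma PT_rhs : PT (fun y : seq (nat * form) * seq (nat * form) * seq form * seq (name * nat) * name =>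
  rhs y.1.1.1.1 y.1.1.1.2 y.1.1.2 y.1.2 y.2).
Proof.
set E := (_ * _ * _ * _ * _)%type.
apply: (PT_name_match (h := fun (y : E) n => rhs y.1.1.1.1 y.1.1.1.2 y.1.1.2 y.1.2 n)).
- by rewrite /E; pts.
- by apply: PT_comp4 PT_rhs_C; rewrite /E; pts.
- by apply: PT_comp7 PT_rhs_T; rewrite /E; pts.
- by apply: PT_comp4 PT_rhs_W; rewrite /E; pts.
- by apply: (PT_comp3 PT_rhs_D); rewrite /E; pts.
- by apply: PT_comp4 PT_rhs_H; rewrite /E; pts.
- by rewrite /E; pts.
Qed.

Lemma PT_names : PT (fun y : seq form * seq (nat * form) => names y.1 y.2).
Proof. by rewrite /names /names_DH /names_k /names_T /with_W; pts. Qed.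

Lemma PT_nodes : PT (fun y : seq (nat * form) * seq form * seq sequent =>
  nodes y.1.1 y.1.2 y.2).
Proof. by rewrite /nodes /line_forms; pts. Qed.

Lemma PT_table : PT table.
Proof. by rewrite /table; pts. Qed.

Lemma PT_pvar_of : PT pvar_of.
Proof. by apply: (PT_form_match (h := fun _ => pvar_of) PT_id); rewrite /pvar_of; pts. Qed.

Lemma PT_formulas : PT formulas.
Proof. by rewrite /formulas; pts; apply: (PT_comp _ PT_pvar_of); pts. Qed.

(** Polynomial for each fixed [w] only, as the number of words grows exponentially with [w]; the
    simulation therefore depends on a constant width. *)
Lemma PT_words w : PT (fun F : seq form => words w F).
Proof.
elim: w => [|w IHw] /=; first exact: PT_const.
by pts; apply: (PT_comp _ IHw); pts.
Qed.

Lemma PT_candidates w : PT (fun y : seq form * seq sequent => candidates w y.1 y.2).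
Proof.
by rewrite /candidates /candidates_of; pts; apply: (PT_comp _ (PT_words w));
  pts.
Qed.

Lemma PT_swaps : PT swaps.
Proof.
rewrite /swaps /swap_at; pts.
pose E := (seq form * seq form * seq form)%type.
apply: (PT_seq_match (h := fun (y : E) v =>
  if v is a :: b :: w then [:: y.1.2 ++ b :: a :: w] else [::])); try by rewrite /E; pts.
apply: (PT_seq_match (h := fun (y : E * (form * seq form)) v =>
  if v is b :: w then [:: y.1.1.2 ++ b :: y.2.1 :: w] else [::])); by rewrite /E; pts.
Qed.

Lemma PT_unsnoc : PT (@unsnoc form).
Proof.
apply: (PT_seq_match (h := fun (s : seq form) v =>
  if v is a :: r then [:: (rev r, a)] else [::])); by pts.
Qed.

Lemma PT_premisesl : PT (fun y : seq form * seq form * form => premisesl y.1.1 y.1.2 y.2).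
Proof.
by apply: (PT_form_match (h := fun (y : seq form * seq form * form) C =>
  premisesl y.1.1 y.1.2 C)); rewrite /premisesl; pts.
Qed.

Lemma PT_premisesr : PT (fun y : seq form * seq form * form => premisesr y.1.1 y.1.2 y.2).
Proof.
by apply: (PT_form_match (h := fun (y : seq form * seq form * form) C =>
  premisesr y.1.1 y.1.2 C)); rewrite /premisesr; pts.
Qed.

Lemma PT_premises : PT (fun y : seq form * sequent => premises y.1 y.2).
Proof.
rewrite /premises /axiomatic; pts;
  solve [by apply: (PT_comp _ PT_swaps); pts
        |by apply: (PT_comp _ PT_unsnoc); pts
        |by apply: (PT_comp3 PT_premisesl); pts
        |by apply: (PT_comp3 PT_premisesr); pts].
Qed.

Lemma PT_justified : PT (fun y : seq sequent * seq form * seq sequent * sequent =>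
  justified y.1.1.1 y.1.1.2 y.1.2 y.2).
Proof. by rewrite /justified; pts; apply: (PT_comp2 PT_premises); pts. Qed.

(** A round appends a sublist of [cand], possibly repeating earlier lines, so the size grows by at
    most [dsz cand] in each of the [size cand] rounds. *)
Lemma PT_saturation : PT (fun y : seq sequent * seq form * seq sequent =>
  saturation y.1.1 y.1.2 y.2).
Proof.
pose E := (seq sequent * seq form * seq sequent)%type.
have step_dsz hyps F cand l : dsz (saturate_step hyps F cand l) <= dsz l + dsz cand.
  rewrite /saturate_step; pose proof (dsz_cat l (filter (justified hyps F l) cand)).
  have : dsz (filter (justified hyps F l) cand) <= dsz cand.
    elim: (cand) => //= S s IHs; case: (justified _ _ _ _); rewrite !dsz_cons; lia.
  lia.
apply: (@PT_foldl E sequent (seq sequent) _ _ _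
  (fun y l _ => saturate_step y.1.1 y.1.2 y.2 l) (fun y => y.2) (fun=> [::])
  (fun n => 1 + n * n)).
- by rewrite /saturate_step /E; pts; apply: PT_comp4 PT_justified; pts.
- by rewrite /E; pts.
- by pts.
- by poly_tac.
move=> [[hyps F] cand] s1 s2 /= es; set n := dsz (hyps, F, cand).
have h : dsz (foldl (fun l _ => saturate_step hyps F cand l) [::] s1) <= 1 + size s1 * dsz cand.
  elim/last_ind: s1 {s2 es} => [|s1 S IHs]; first by rewrite /= dsz_nil.
  rewrite foldl_rcons size_rcons mulSn; apply: leq_trans (step_dsz _ _ _ _) _; lia.
apply: leq_trans h _; rewrite leq_add2l; apply: leq_mul.
  pose proof (size_dsz cand); rewrite /n !dsz_pair.
  by have := congr1 size es; rewrite size_cat; lia.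
by rewrite /n !dsz_pair; lia.
Qed.

Lemma PT_the_names : PT (fun y : seq (nat * form) * seq form => the_names y.1 y.2).
Proof. by apply: (PT_comp2 PT_names); pts. Qed.

Lemma PT_the_table : PT (fun y : seq (nat * form) * seq form => the_table y.1 y.2).
Proof. exact: PT_comp PT_the_names PT_table. Qed.

Ltac pt_the := pts; repeat (lazymatch goal with
  | |- PT (fun x => the_names _ _) => apply: (PT_comp2 PT_the_names)
  | |- PT (fun x => the_table _ _) => apply: (PT_comp2 PT_the_table)
  | |- PT (fun x => rhs _ _ _ _ _) => apply: PT_comp5 PT_rhs
  end; pts).

Lemma PT_the_axioms : PT (fun y : seq (nat * form) * seq (nat * form) * seq form =>
  the_axioms y.1.1 y.1.2 y.2).
Proof. by rewrite /the_axioms; pt_the. Qed.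

Lemma PT_the_hyps : PT (fun y : seq (nat * form) * seq (nat * form) * seq form =>
  the_hyps y.1.1 y.1.2 y.2).
Proof. by rewrite /the_hyps; pt_the. Qed.

Lemma PT_the_formulas : PT (fun y : seq (nat * form) * seq (nat * form) * seq form =>
  the_formulas y.1.1 y.1.2 y.2).
Proof.
rewrite /the_formulas; apply: (PT_comp _ PT_formulas); pt_the.
by apply: (PT_comp3 PT_the_axioms); pts.
Qed.

Lemma PT_last (X A : Type) {cX : codable X} {cA : codable A} (z : A) (f : X -> seq A) :
  PT f -> PT (fun x => last z (f x)).
Proof.
move=> ptf; apply: (@eq_PT _ _ _ _ (fun x => head z (rev (f x)))).
  by move=> x; case/lastP: (f x) => // s a; rewrite rev_rcons last_rcons.
by apply: PT_head; [exact: PT_const|exact: PT_rev].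
Qed.

Lemma PT_the_lines :
  PT (fun y : seq (nat * form) * seq (nat * form) * seq form * seq sequent =>
    the_lines y.1.1.1 y.1.1.2 y.1.2 y.2).
Proof.
have ptF : PT (fun y : seq (nat * form) * seq (nat * form) * seq form * seq sequent =>
    the_formulas y.1.1.1 y.1.1.2 y.1.2) by apply: (PT_comp3 PT_the_formulas); pts.
have ptl : PT (fun y : seq (nat * form) * seq (nat * form) * seq form * seq sequent =>
    map (star_sequent (the_table y.1.1.2 y.1.2) y.1.2) y.2).
  by rewrite /star_sequent; pt_the.
apply: PT_rcons; last exact: PT_last.
apply: (PT_comp3 PT_saturation) => //; first by apply: (PT_comp3 PT_the_hyps); pts.
exact: (PT_comp2 (PT_candidates (60 + 60))).
Qed.

Lemma enc_eLEADT_pf_inj : injective enc_eLEADT_pf.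
Proof.
move=> [u x l] [u' x' l'] e.
have e' : code (u, (x, l)) = code (u', (x', l')) by exact: e.
by apply code_inj in e'; case: e' => -> -> ->.
Qed.

Lemma enc_eLNDT_pf_inj : injective enc_eLNDT_pf.
Proof.
move=> [u l] [u' l'] e; have e' : code (u, l) = code (u', l') by exact: e.
by apply code_inj in e'; case: e' => -> ->.
Qed.

#[global] Instance codable_eLEADT_pf : codable eLEADT_pf := Codable enc_eLEADT_pf_inj.
#[global] Instance codable_eLNDT_pf : codable eLNDT_pf := Codable enc_eLNDT_pf_inj.

Lemma PT_translate : PT translate.
Proof.
pose E := (seq form * (seq form * seq sequent))%type.
have ptL : PT (fun y : E => nodes (number_from 0 y.1) y.2.1 y.2.2).
  by apply: (PT_comp3 PT_nodes); rewrite /E; pts.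
have ptE : PT (fun y : E => (number_from 0 y.1, number_from 0 y.2.1,
    nodes (number_from 0 y.1) y.2.1 y.2.2)).
  by apply: PT_pair => //; rewrite /E; pts.
apply: (@PT_via _ _ _ _ _ _ (EVar 0) (fun y : E => translate (ELEADTPf y.1 y.2.1 y.2.2))) => //.
  apply: (@PT_recode _ _ _ _ _ _ (fun y : E =>
    (e_axs (translate (ELEADTPf y.1 y.2.1 y.2.2)), e_lines (translate (ELEADTPf y.1 y.2.1 y.2.2))))).
    by move=> y; case: (translate _).
  apply: PT_pair.
    by apply: (PT_comp3 PT_the_axioms) => //; rewrite /E; pts.
  by apply: PT_comp4 PT_the_lines => //; rewrite /E; pts.
by case=> u x l; exists (u, (x, l)).
Qed.

Theorem theorem7p3 :
  exists f : eLEADT_pf -> eLNDT_pf,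
    polytime enc_eLEADT_pf enc_eLNDT_pf f /\
    forall (pi : eLEADT_pf) (Sigma Pi : seq form),
      all is_NDT Sigma -> all is_NDT Pi ->
      eLEADT_proves pi (Sigma, Pi) -> eLNDT_proves (f pi) (Sigma, Pi).
Proof.
exists translate; split; first exact: (PT_polytime PT_translate).
exact: translate_correct.
Qed.
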